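(* Let $P_0$ be an arbitrary probability measure on $\mathbb{T}_2^{\mathrm{cont}}$ and let $X=((T_t,c_t,\mu_t))_{t\ge0}$ be a solution of the $(\Omega_{\mathrm{Ald}},\mathcal{D}(\Omega_{\mathrm{Ald}}),P_0)$-martingale problem with paths in $\mathcal{D}_{\mathbb{T}_2^{\mathrm{cont}}}(\mathbb{R}_+)$. For arbitrary $m\in\mathbb{N}$ and $\mathfrak t\in\mathfrak{C}_m$, let $Y^m=(Y^m_t)_{t\ge0}$ be the $\mathfrak{C}_m$-valued Aldous chain (the Markov chain with generator $\Omega_m$) with $Y^m_0=\mathfrak t$. Assume that $Y^m$ is independent of $X$. Then for all $t\ge 0$ $$\mathbb{E}^X_{P_0}\bigl[\mu_t^{\otimes m}\{\underline u\in T_t^m:\mathfrak{s}_{(T_t,c_t)}(\underline u)=\mathfrak t\}\bigr]=\int_{\mathbb{T}_2^{\mathrm{cont}}}\mathbb{E}^Y_{\mathfrak t}\bigl[\mu^{\otimes m}\{\underline u\in T^m:\mathfrak{s}_{(T,c)}(\underline u)=Y^m_t\}\bigr]\,P_0(\mathrm d(T,c,\mu)).$$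
   Context: **Algebraic trees.** An algebraic tree is a non-empty set $T$ with a symmetric map $c\colon T^3\to T$ (branch point map) such that for all $x_1,\dots,x_4\in T$: $c(x_1,x_2,x_2)=x_2$; $c(x_1,x_2,c(x_1,x_2,x_3))=c(x_1,x_2,x_3)$; $c(x_1,x_2,x_3)\in\{c(x_1,x_2,x_4),c(x_1,x_3,x_4),c(x_2,x_3,x_4)\}$. For $x\in T$ and $y,z\in T\setminus\{x\}$ put $y\sim_x z$ iff $c(x,y,z)\ne x$; the equivalence class $\mathcal{S}_x(y)$ of $y$ is the component of $T\setminus\{x\}$ containing $y$. $\deg(x)$ is the number of components of $T\setminus\{x\}$; $x$ is a leaf ($x\in\mathrm{lf}(T)$) if $\deg(x)=1$ (the point of a one-point tree is also counted as a leaf), a branch point ($x\in\mathrm{br}(T)$) if $\deg(x)\ge3$. $[x,y]=\{z\in T: c(x,y,z)=z\}$; $\{x,y\}$ is an edge if $x\ne y$ and $[x,y]=\{x,y\}$. The component topology on $T$ is generated by all $\mathcal{S}_x(y)$, $x\ne y$; $(T,c)$ is order separable if this topology is separable and there are at most countably many edges. A subtree is a non-empty $S\subseteq T$ with $c(S^3)=S$. A tree isomorphism is a bijection commuting with branch point maps (a tree homomorphism is a map commuting with branch point maps). **Algebraic measure trees.** An algebraic measure tree $(T,c,\mu)$ is an order separable algebraic tree with a probability measure $\mu$ on the Borel $\sigma$-algebra of the component topology. Two such, $(T_i,c_i,\mu_i)$, $i=1,2$, are equivalent if there are subtrees $S_i\subseteq T_i$ with $\mu_i(S_i)=1$ and a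 measure preserving tree isomorphism $S_1\to S_2$. $\mathbb{T}$ is the set of equivalence classes; $\mathbb{T}_2\subset\mathbb{T}$ consists of the classes having a representative (always the one used) with all degrees $\le3$ and atoms of $\mu$ only at leaves; $\mathbb{T}_2^{\mathrm{cont}}\subset\mathbb{T}_2$ is the subset with $\mu$ non-atomic. **Topology.** For $\mathfrak{x}=(T,c,\mu)$ let $\nu=\mu^{\otimes3}\circ c^{-1}$ and $r_\mu(x,y)=\nu([x,y])-\frac12\nu(\{x\})-\frac12\nu(\{y\})$ (a pseudometric). $(T_n,c_n,\mu_n)\to(T,c,\mu)$ (bpdd-Gromov-weakly) iff for all $m$, the law of $(r_{\mu_n}(U^n_i,U^n_j))_{1\le i<j\le m}$ with $U_i^n$ i.i.d. $\sim\mu_n$ converges weakly to that of $(r_\mu(U_i,U_j))_{1\le i<j\le m}$ with $U_i$ i.i.d. $\sim\mu$. With this topology $\mathbb{T}_2$ and $\mathbb{T}_2^{\mathrm{cont}}$ are compact metrizable (known). $\mathcal{D}_{E}(\mathbb{R}_+)$ denotes the space of càdlàg paths in $E$. **Cladograms and shapes.** For $m\in\mathbb{N}$, an $m$-labelled cladogram is a finite binary (degrees $\le3$) algebraic tree $(C,c_C)$ consisting only of leaves and branch points, with a surjection $\zeta\colon\{1,\dots,m\}\to\mathrm{lf}(C)$; it is an $m$-cladogram if $\zeta$ is injective. $\overline{\mathfrak{C}}_m$, $\mathfrak{C}_m$ denote the sets of isomorphism classes (label-preserving tree isomorphisms) of $m$-labelled cladograms and $m$-cladograms. For a binary algebraic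 tree $(T,c)$ and $\underline u=(u_1,\dots,u_m)$ with $u_i\in T\setminus\mathrm{br}(T)$, the shape $\mathfrak{s}_{(T,c)}(\underline u)\in\overline{\mathfrak{C}}_m$ is the unique (up to isomorphism) $m$-labelled cladogram $(C,c_C,\zeta)$ with $\mathrm{lf}(C)=\{u_1,\dots,u_m\}$, $\zeta(i)=u_i$, such that the identity on $\mathrm{lf}(C)$ extends to a tree homomorphism from $C$ onto $c(\{u_1,\dots,u_m\}^3)$. **Aldous chain generator.** For $\mathfrak{t}\in\mathfrak{C}_m$, a leaf $u$ and an edge $e$ of $\mathfrak t$, let $\mathfrak{t}^{(u,e)}=\mathfrak t$ if $u$ is incident to $e$; otherwise $\mathfrak{t}^{(u,e)}$ is obtained by erasing $u$ together with its incident edge and suppressing the resulting degree-2 vertex, and re-attaching $u$ by a new edge at a new branch point in the middle of $e$. For $\phi\colon\mathfrak{C}_m\to\mathbb{R}$, $\Omega_m\phi(\mathfrak t)=\sum_{(u,e)}(\phi(\mathfrak{t}^{(u,e)})-\phi(\mathfrak t))$, the sum over all (leaf, edge) pairs ($\Omega_1=0$). **The operator and martingale problem.** For $m\in\mathbb{N}$, $\mathfrak t\in\mathfrak{C}_m$ let $\Phi^{m,\mathfrak t}(T,c,\mu)=\mu^{\otimes m}(\mathfrak{s}_{(T,c)}^{-1}(\mathfrak t))$; $\mathcal{D}(\Omega_{\mathrm{Ald}})$ is the linear span of all these functions, and $\Omega_{\mathrm{Ald}}$ is the linear operator with $\Omega_{\mathrm{Ald}}\Phi^{m,\mathfrak t}(T,c,\mu)=\int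 \Omega_m\mathbf 1_{\mathfrak t}(\mathfrak{s}_{(T,c)}(\underline u))\,\mu^{\otimes m}(\mathrm d\underline u)$ (integrand $0$ when the shape is not in $\mathfrak{C}_m$). A solution of the $(\Omega_{\mathrm{Ald}},\mathcal{D}(\Omega_{\mathrm{Ald}}),P_0)$-martingale problem is a $\mathbb{T}_2^{\mathrm{cont}}$-valued measurable process $X$ with $X_0\sim P_0$ such that for all $\Phi\in\mathcal{D}(\Omega_{\mathrm{Ald}})$, $\Phi(X_t)-\int_0^t\Omega_{\mathrm{Ald}}\Phi(X_s)\,\mathrm ds$ is a martingale w.r.t. the natural augmented filtration of $X$. *)

(* Defs.v *)
From HB Require Import structures.
From mathcomp Require Import all_boot all_order all_algebra.
From mathcomp Require Import finmap all_classical all_reals all_analysis.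
From mathcomp Require Import measurable_realfun.
From mathcomp Require Import generic_quotient ring lra.
Set Implicit Arguments.
Unset Strict Implicit.
Unset Printing Implicit Defensive.
Import Order.TTheory GRing.Theory Num.Theory.
Import numFieldNormedType.Exports.
Local Open Scope classical_set_scope.
Local Open Scope ring_scope.

Record is_algTree (T : Type) (c : T -> T -> T -> T) : Prop := {
  bpC12 : forall x y z, c x y z = c y x z ;
  bpC23 : forall x y z, c x y z = c x z y ;
  bp_two : forall x y, c x y y = y ;
  bp_idem : forall x y z, c x y (c x y z) = c x y z ;
  bp_four : forall x1 x2 x3 x4,
    [\/ c x1 x2 x3 = c x1 x2 x4, c x1 x2 x3 = c x1 x3 x4
      | c x1 x2 x3 = c x2 x3 x4] }.

Section tree_notions.
Context {T : Type}.
Variable c : T -> T -> T -> T.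

Definition component (x y : T) : set T := [set z | z <> x /\ c x y z <> x].

(* deg x is the cardinality of this set *)
Definition components (x : T) : set (set T) := component x @` ~` [set x].

Definition leaf (x : T) : Prop :=
  (components x #= `I_1)%card \/ [set: T] = [set x].

Definition branch (x : T) : Prop := (`I_3 #<= components x)%card.

Definition binary : Prop := forall x, (components x #<= `I_3)%card.

Definition segment (x y : T) : set T := [set z | c x y z = z].

Definition edge (x y : T) : Prop := x <> y /\ segment x y = [set x; y].

Definition bp_image (S : set T) : set T :=
  [set w | exists x y z, [/\ S x, S y, S z & c x y z = w]].

Definition subtree (S : set T) : Prop := S !=set0 /\ bp_image S = S.

End tree_notions.

Definition tree_hom_on (T1 T2 : Type) (c1 : T1 -> T1 -> T1 -> T1)
    (c2 : T2 -> T2 -> T2 -> T2) (S : set T1) (f : T1 -> T2) : Prop :=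
  forall x y z, S x -> S y -> S z -> f (c1 x y z) = c2 (f x) (f y) (f z).

Record algTree := AlgTree {
  point_of :> Type ;
  bp : point_of -> point_of -> point_of -> point_of ;
  algTree_nonempty : [set: point_of] !=set0 ;
  algTreeP : is_algTree bp }.

HB.instance Definition _ (T : algTree) := gen_eqMixin (point_of T).
HB.instance Definition _ (T : algTree) := gen_choiceMixin (point_of T).
HB.instance Definition _ (T : algTree) :=
  isPointed.Build (point_of T) (projT1 (cid (algTree_nonempty T))).

HB.instance Definition _ (T : algTree) := isSubBaseTopological.Build (point_of T)
  [set p : T * T | p.1 <> p.2] (fun p => component (@bp T) p.1 p.2).

Lemma component_open_ind (T : algTree) (S : topologicalType) (f : S -> T)
    (A : set T) :
  (forall x y : T, x <> y -> open (f @^-1` component (@bp T) x y)) ->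
  open A -> open (f @^-1` A).
Proof.
move=> fo [B BfinI <-]; rewrite preimage_bigcup; apply: bigcup_open => C.
move=> /BfinI[D DI <-]; rewrite preimage_bigcap bigcap_fset.
rewrite big_seq; apply: big_rec => [|p U pD oU]; first exact: openT.
by apply: openI => //; apply: fo; have /DI := pD; rewrite inE.
Qed.

Definition order_separable (T : algTree) : Prop :=
  (exists D : set T, countable D /\ dense D) /\
  countable [set e : T * T | edge (@bp T) e.1 e.2].

Definition borel (T : ptopologicalType) := g_sigma_algebraType (@open T).
HB.instance Definition _ (T : ptopologicalType) := Measurable.on (borel T).

Record amtree (R : realType) := Amtree {
  amt_tree :> algTree ;
  amt_mu : probability (borel amt_tree) R ;
  amt_order_separable : order_separable amt_tree }.


Section amtree_classes.
Context {R : realType}.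
Implicit Types X : amtree R.

Definition amt_equiv X1 X2 : Prop :=
  exists (S1 : set (borel X1)) (S2 : set (borel X2)) (phi : borel X1 -> borel X2),
    [/\ subtree (@bp X1) S1 /\ subtree (@bp X2) S2,
        measurable S1 /\ measurable S2,
        amt_mu X1 S1 = 1%E /\ amt_mu X2 S2 = 1%E,
        set_bij S1 S2 phi /\ tree_hom_on (@bp X1) (@bp X2) S1 phi
      & measurable_fun S1 phi /\
        forall B, measurable B ->
          amt_mu X1 (S1 `&` phi @^-1` B) = amt_mu X2 (S2 `&` B)].

Definition amt_class (A : set (amtree R)) : Prop :=
  exists X, A = [set X' | amt_equiv X X'].

Definition T2_tree X : Prop :=
  binary (@bp X) /\
  forall x : X, amt_mu X [set x] <> 0%E -> leaf (@bp X) x.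

Definition T2cont_tree X : Prop :=
  T2_tree X /\ forall x : X, amt_mu X [set x] = 0%E.

Lemma amt_equiv_refl X : amt_equiv X X.
Proof.
exists setT, setT, id.
have st : subtree (@bp X) setT.
  split; first exact: algTree_nonempty.
  apply/seteqP; split=> // x _; exists x, x, x; split => //.
  exact: (bp_two (algTreeP X)).
split => //; first by rewrite probability_setT.
  by split => //; split=> // y _; exists y.
Qed.

End amtree_classes.

Definition T2cont (R : realType) : Type :=
  {A : set (amtree R) | amt_class A /\ exists2 X, A X & T2cont_tree X}.

(* All functionals of a class are evaluated at this representative, which
   satisfies the defining conditions of T2cont. *)
Definition rep (R : realType) (x : T2cont R) : amtree R :=
  projT1 (cid2 (proj2 (proj2_sig x))).

(* Measurable types are pointed, so that an element of [T2cont R] is needed: the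
   real line, with the median as branch point map and the uniform distribution
   on [0, 1]. *)

Section line.
Context (R : realType).

Definition median (x y z : R) : R :=
  Num.max (Num.min x y) (Num.min (Num.max x y) z).

Ltac case_minmax := repeat match goal with
  | |- context [Num.min ?a ?b] => is_var a; is_var b; case: (lerP a b)
  | |- context [Num.max ?a ?b] => is_var a; is_var b; case: (lerP a b)
  end => *.

Lemma medianC12 x y z : median x y z = median y x z.
Proof. by rewrite /median; case_minmax; lra. Qed.

Lemma medianC23 x y z : median x y z = median x z y.
Proof. by rewrite /median; case_minmax; lra. Qed.

Lemma median_sorted x y z : x <= y -> y <= z -> median x y z = y.
Proof.
by move=> xy yz; rewrite /median (min_idPl xy) (max_idPr xy) (min_idPl yz)
  (max_idPr xy).
Qed.

Lemma median_algTree : is_algTree median.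
Proof.
have H x y z w : x <= y -> y <= z -> median x y w = y \/ median y z w = y.
  move=> xy yz; case: (leP y w) => [yw|/ltW wy].
    by left; rewrite median_sorted.
  by right; rewrite medianC23 medianC12 median_sorted.
split; [exact: medianC12|exact: medianC23|..].
- by move=> x y; rewrite /median; case_minmax; lra.
- by move=> x y z; rewrite /median; case_minmax; lra.
move=> x y z w.
have [xy|/ltW yx] := leP x y; have [yz|/ltW zy] := leP y z.
- rewrite median_sorted//.
  by case: (H x y z w xy yz) => ->; [apply: Or31|apply: Or33].
- have [xz|/ltW zx] := leP x z.
    rewrite medianC23 median_sorted//.
    by case: (H x z y w xz zy) => E; [apply: Or32|apply: Or33; rewrite medianC12].
  rewrite medianC23 medianC12 median_sorted//.
  by case: (H z x y w zx xy) => E; [apply: Or32; rewrite medianC12|apply: Or31].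
- have [xz|/ltW zx] := leP x z.
    rewrite medianC12 median_sorted//.
    by case: (H y x z w yx xz) => E; [apply: Or31; rewrite medianC12|apply: Or32].
  rewrite medianC12 medianC23 median_sorted//.
  by case: (H y z x w yz zx) => E; [apply: Or33|apply: Or32; rewrite medianC12].
- rewrite medianC12 medianC23 medianC12 median_sorted//.
  by case: (H z y x w zy yx) => E; [apply: Or33|apply: Or31]; rewrite medianC12.
Qed.

Definition line : algTree :=
  @AlgTree R median (ex_intro _ 0 I) median_algTree.

Lemma line_component (x y : R) : x <> y ->
  component median x y = if x < y then [set z | x < z] else [set z | z < x].
Proof.
move=> /eqP xy; case: (ltP x y) => [ltxy|leyx]; apply/seteqP; split=> z /=.
- move=> [zx mx]; rewrite ltNge; apply/negP => zlex; apply: mx.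
  by rewrite medianC23 medianC12 median_sorted// ltW.
- move=> ltxz; split; first by move=> E; rewrite E ltxx in ltxz.
  suff: x < median x y z by move=> /[swap] ->; rewrite ltxx.
  rewrite /median (min_idPl (ltW ltxy)) (max_idPr (ltW ltxy)).
  by rewrite lt_max lt_min ltxy ltxz orbT.
- move=> [zx mx]; rewrite ltNge; apply/negP => xlez; apply: mx.
  by rewrite medianC12 median_sorted.
- have ltyx : y < x by rewrite lt_neqAle eq_sym xy.
  move=> ltzx; split; first by move=> E; rewrite E ltxx in ltzx.
  suff: median x y z < x by move=> /[swap] ->; rewrite ltxx.
  rewrite /median (min_idPr leyx) (max_idPl leyx).
  by rewrite gt_max gt_min ltyx ltzx orbT.
Qed.

Lemma line_open (A : set line) : open A -> open (A : set R).
Proof.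
apply: (@component_open_ind line R id) => x y xy.
rewrite preimage_id [X in open X](line_component xy).
by case: ifP => _; [exact: open_gt|exact: open_lt].
Qed.

Lemma line_order_separable : order_separable line.
Proof.
split.
  exists (ratr @` [set: rat] : set R); split.
    exact: (sub_countable (card_image_le _ _) (countableP _)).
  by move=> U U0 /line_open oU; exact: dense_rat.
rewrite [X in countable X](_ : _ = set0) ?countable0//.
apply/seteqP; split=> // -[x y] /= [xy E].
have mid (a b : R) : segment median a b ((a + b) / 2).
  rewrite /segment /=; case: (lerP a b) => h.
    by rewrite medianC23 median_sorted//; lra.
  by rewrite medianC12 medianC23 median_sorted//; lra.
have midE (a b : R) : [set a; b] ((a + b) / 2) -> a = b by case=> /= h; lra.
by apply/xy/midE; have := mid x y; rewrite [segment _ _ _]E.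
Qed.

Definition to_line (x : measurableTypeR R) : borel line := x.

Lemma measurable_to_line : measurable_fun setT to_line.
Proof.
apply: (@measurability _ _ (measurableTypeR R) (borel line) setT to_line (@open line)) => //.
move=> _ [A oA <-]; rewrite setTI; apply: open_measurable.
exact: line_open.
Qed.

HB.instance Definition _ :=
  isMeasurableFun.Build _ _ _ _ to_line measurable_to_line.

Definition line_mu : probability (borel line) R :=
  distribution (uniform_prob (@ltr01 R)) to_line.

Definition line_amtree : amtree R := Amtree line_mu line_order_separable.

Lemma line_T2cont_tree : T2cont_tree line_amtree.
Proof.
have mu0 (x : R) : line_mu [set x] = 0%E.
  rewrite /line_mu /= /distribution /pushforward /=.
  rewrite [X in uniform_prob _ X](_ : _ = [set x])//.
  have /null_content_dominatesP := dominates_uniform_prob (@ltr01 R).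
  by apply; [exact: measurable_set1|exact: lebesgue_measure_set1].
split=> //; split=> [x|x]; last by rewrite mu0.
pose f (n : nat) : set R := if n == 0%N then [set z | x < z] else [set z | z < x].
suff sub : components (@bp line) x `<=` f @` `I_3.
  exact: (card_le_trans (subset_card_le sub) (card_image_le f `I_3)).
move => _ [y /= yx <-].
rewrite line_component; last exact: nesym.
by case: ifP => _; [exists 0%N|exists 1%N].
Qed.

End line.

HB.instance Definition _ (R : realType) := gen_eqMixin (T2cont R).
HB.instance Definition _ (R : realType) := gen_choiceMixin (T2cont R).
HB.instance Definition _ (R : realType) := isPointed.Build (T2cont R)
  (exist _ [set X | amt_equiv (line_amtree R) X]
    (conj (ex_intro _ _ erefl)
      (ex_intro2 _ _ _ (amt_equiv_refl _) (line_T2cont_tree R)))).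

Section power.
Context {d : measure_display} {T : measurableType d} {R : realType}.
Variable mu : probability T R.

Definition cons_tuple n (p : T * n.-tuple T) : n.+1.-tuple T :=
  [the n.+1.-tuple T of p.1 :: p.2].

Lemma measurable_cons_tuple n : measurable_fun setT (@cons_tuple n).
Proof. exact: measurable_cons. Qed.

HB.instance Definition _ n :=
  isMeasurableFun.Build _ _ _ _ (@cons_tuple n) (@measurable_cons_tuple n).

Fixpoint power_measure m : probability (m.-tuple T) R :=
  match m with
  | 0%N => \d_[tuple]
  | m'.+1 => distribution (mu \x power_measure m')%E (@cons_tuple m')
  end.

End power.

Section bpdd.
Context {R : realType}.
Variable X : amtree R.

Definition bp_distr (A : set X) : R :=
  fine (power_measure (amt_mu X) 3
    [set u : 3.-tuple (borel X) | A (bp (tnth u 0) (tnth u 1) (tnth u 2%R))]).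

Definition r_mu (x y : X) : R :=
  bp_distr (segment (@bp X) x y)
    - 2^-1 * bp_distr [set x] - 2^-1 * bp_distr [set y].

(* the entries with i < j; the other ones are set to 0 *)
Definition distance_matrix m (u : m.-tuple (borel X)) : 'M[R]_m :=
  \matrix_(i, j) if (i < j)%N then r_mu (tnth u i) (tnth u j) else 0.

End bpdd.

Section bpdd_topology.
Context (R : realType).

Definition bounded_continuous m : Type :=
  {f : 'M[R]_m -> R | continuous f /\ exists M, forall A, `|f A| <= M}.

Definition test_functional (x : T2cont R)
    (f : {m : nat & bounded_continuous m}) : R :=
  \int[power_measure (amt_mu (rep x)) (tag f)]_u
    (sval (tagged f)) (distance_matrix u).

(* Initial topology of all x |-> E[f((r_mu(U_i, U_j))_(i < j))], f bounded
   continuous: the topology of weak convergence of all distance matrix laws. *)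
HB.instance Definition _ := Topological.copy (T2cont R)
  (initial_topology
    (test_functional : T2cont R -> {ptws {m : nat & bounded_continuous m} -> R})).

End bpdd_topology.

Lemma test_functional_continuous (R : realType)
    (f : {m : nat & bounded_continuous R m}) :
  continuous (fun x : T2cont R => test_functional x f : R).
Proof.
move=> x A /=; rewrite nbhsE => -[W [oW Wx] sWA].
pose U := [set g : {ptws {m : nat & bounded_continuous R m} -> R} | W (g f)].
have oU : open U.
  exists [set U]; last by rewrite bigcup_set1.
  move=> _ ->; exists [fset U]%fset; last by rewrite set_fset1 bigcap_set1.
  by move=> V /fset1P ->; apply/mem_set; exists f => //; exists W.
rewrite nbhsE; exists (@test_functional R @^-1` U); last by move=> y /sWA.
by split=> //; exists U.
Qed.

Lemma T2cont_cvgE (R : realType) (x_ : nat -> T2cont R) (x : T2cont R) :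
  (x_ n @[n --> \oo] --> x) <->
  forall m (f : bounded_continuous R m),
    (\int[power_measure (amt_mu (rep (x_ n))) m]_u
        (sval f) (distance_matrix u)) @[n --> \oo] -->
    (\int[power_measure (amt_mu (rep x)) m]_u
        (sval f) (distance_matrix u) : R).
Proof.
split.
  move=> xx m f.
  exact: (cvg_comp _ _ xx
    (@test_functional_continuous R (Tagged (bounded_continuous R) f) x)).
move=> xf A; rewrite nbhsE => -[_ [[V oV <-] Vx] sVA].
rewrite nbhs_filterE; apply: filterS sVA _.
pose F : T2cont R -> {ptws {m : nat & bounded_continuous R m} -> R} :=
  @test_functional R.
suff /(_ _ (open_nbhs_nbhs (conj oV Vx))) : F (x_ n) @[n --> \oo] --> F x by [].
apply/cvg_sup => -[m f] B; rewrite nbhsE => -[_ [[W oW <-] Wx] sWB].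
rewrite nbhs_filterE; apply: filterS sWB _.
exact: (xf m f W (open_nbhs_nbhs (conj oW Wx))).
Qed.

(* Vertices are taken in some 'I_n.+1: every isomorphism class of finite
   algebraic trees has such a member. *)
Record lcladogram (m : nat) := LCladogram {
  lclado_size : nat ;
  lclado_bp : 'I_lclado_size.+1 -> 'I_lclado_size.+1 -> 'I_lclado_size.+1 ->
    'I_lclado_size.+1 ;
  lclado_label : 'I_m -> 'I_lclado_size.+1 ;
  lclado_algTree : is_algTree lclado_bp ;
  lclado_binary : binary lclado_bp ;
  lclado_leaf_or_branch : forall v, leaf lclado_bp v \/ branch lclado_bp v ;
  lclado_label_onto : range lclado_label = leaf lclado_bp }.

Notation vertex C := 'I_(lclado_size C).+1.

Section cladogram_iso.
Variable m : nat.
Implicit Types C : lcladogram m.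

HB.instance Definition _ := gen_eqMixin (lcladogram m).
HB.instance Definition _ := gen_choiceMixin (lcladogram m).

Definition lclado_iso C C' (f : vertex C -> vertex C') : Prop :=
  [/\ bijective f, tree_hom_on (@lclado_bp m C) (@lclado_bp m C') setT f
    & forall i, f (lclado_label C i) = lclado_label C' i].

Definition lclado_equiv C C' : bool := `[< exists f, @lclado_iso C C' f >].

Lemma lclado_equiv_refl : reflexive lclado_equiv.
Proof. by move=> C; apply/asboolP; exists id; split=> //; exists id. Qed.

Lemma lclado_equiv_trans : transitive lclado_equiv.
Proof.
move=> C2 C1 C3 /asboolP[f [bf hf lf]] /asboolP[g [bg hg lg]].
apply/asboolP; exists (g \o f); split.
- exact: bij_comp.
- by move=> x y z _ _ _ /=; rewrite hf// hg.
- by move=> i /=; rewrite lf lg.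
Qed.

Lemma lclado_equiv_sym : symmetric lclado_equiv.
Proof.
suff H C C' : lclado_equiv C C' -> lclado_equiv C' C.
  by move=> C C'; apply/idP/idP; exact: H.
move=> /asboolP[f [[g fK gK] hf lf]]; apply/asboolP; exists g; split.
- by exists f.
- by move=> x y z _ _ _; apply: (can_inj fK); rewrite hf// !gK.
- by move=> i; rewrite -lf fK.
Qed.

Canonical lclado_equivRel := EquivRel lclado_equiv
  lclado_equiv_refl lclado_equiv_sym lclado_equiv_trans.

End cladogram_iso.

Definition lcladograms (m : nat) := {eq_quot (@lclado_equivRel m)}%qT.
HB.instance Definition _ m := Choice.on (lcladograms m).
HB.instance Definition _ m := EqQuotient.on (lcladograms m).

Definition cladograms (m : nat) :=
  {t : lcladograms m | `[< injective (lclado_label (repr t)) >]}.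
HB.instance Definition _ m := Choice.on (cladograms m).

Definition is_shape (T : algTree) m (u : m.-tuple T) (C : lcladogram m) : Prop :=
  (forall i j, lclado_label C i = lclado_label C j <-> tnth u i = tnth u j) /\
  exists f : vertex C -> T,
    [/\ tree_hom_on (@lclado_bp m C) (@bp T) setT f,
        forall i, f (lclado_label C i) = tnth u i
      & range f = bp_image (@bp T) (range (tnth u))].

(* [None] when some u_i is a branch point *)
Definition tree_shape (T : algTree) m (u : m.-tuple T) : option (lcladograms m) :=
  if pselect ((forall i, ~ branch (@bp T) (tnth u i)) /\
              exists s : lcladograms m, is_shape u (repr s)) is left h
  then Some (projT1 (cid (proj2 h))) else None.

(* [spr u x y C']: C' is C with the leaf u erased and re-attached in the middle
   of the edge {x, y}, where u is not in {x, y}.  The neighbour b of u is erased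
   too, and re-used as the new branch point; f identifies the vertices of C with
   those of C'.  If b is in {x, y}, the edge in which u is re-attached is the one
   which results from suppressing b. *)
Definition spr m (C : lcladogram m) (u x y : vertex C) (C' : lcladogram m) : Prop :=
  exists (f : vertex C -> vertex C') (b : vertex C),
    let c := @lclado_bp m C in
    let c' := @lclado_bp m C' in
    let kept := ~` [set u; b] in
    let target := if (x == b) || (y == b)
                  then [set z | edge c b z /\ z <> u] else [set x; y] in
    [/\ bijective f /\ forall i, f (lclado_label C i) = lclado_label C' i,
        edge c u b /\ edge c' (f u) (f b),
        tree_hom_on c c' kept f
      & forall z1 z2, target z1 -> target z2 -> z1 <> z2 ->
          c' (f z1) (f z2) (f b) = f b].

Definition move_leaf m (t : cladograms m) (u x y : vertex (repr (val t))) :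
    cladograms m :=
  if (u == x) || (u == y) then t
  else xget t [set t' | spr u x y (repr (val t'))].

(* An edge {x, y} is represented by (x, y) with x < y. *)
Definition aldous_generator (R : realType) m (phi : cladograms m -> R)
    (t : cladograms m) : R :=
  let c := @lclado_bp m (repr (val t)) in
  \sum_(u | `[< leaf c u >])
    \sum_(e : vertex (repr (val t)) * vertex (repr (val t)) |
            (e.1 < e.2)%N && `[< edge c e.1 e.2 >])
      (phi (move_leaf u e.1 e.2) - phi t).

Record markov_semigroup (R : realType) (S : Type)
    (L : (S -> R) -> S -> R) (Q : R -> (S -> R) -> S -> R) : Prop := {
  semigroup_linear : forall t, 0 <= t -> forall (a : R) f g x,
    Q t (fun y => a * f y + g y) x = a * Q t f x + Q t g x ;
  semigroup_ge0 : forall t, 0 <= t -> forall f,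
    (forall y, 0 <= f y) -> forall x, 0 <= Q t f x ;
  semigroup_one : forall t, 0 <= t -> forall x, Q t (fun=> 1) x = 1 ;
  semigroup0 : forall f x, Q 0 f x = f x ;
  semigroupD : forall s t, 0 <= s -> 0 <= t -> forall f x,
    Q (s + t) f x = Q s (Q t f) x ;
  semigroup_generator : forall f x,
    (Q h f x - f x) / h @[h --> 0^'+] --> L f x }.

Section processes.
Context {R : realType} {d : measure_display} {Omega : measurableType d}.
Variable P : probability Omega R.

(* sigma(Z_s : s in I), for S equipped with the sigma-algebra G *)
Definition sigma_process (S : Type) (G : set (set S)) (I : set R)
    (Z : R -> Omega -> S) : set (set Omega) :=
  <<s [set A | exists s B, [/\ I s, G B & A = Z s @^-1` B]] >>.

Definition augmented (F : set (set Omega)) : set (set Omega) :=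
  <<s F `|` [set N | measurable N /\ P N = 0%E] >>.

Definition independent (F1 F2 : set (set Omega)) : Prop :=
  forall A B, F1 A -> F2 B -> P (A `&` B) = (P A * P B)%E.

Definition is_martingale (F : R -> set (set Omega)) (M : R -> Omega -> R) : Prop :=
  forall t, 0 <= t ->
    [/\ forall B, measurable B -> F t (M t @^-1` B),
        P.-integrable setT (EFin \o M t)
      & forall s A, 0 <= s <= t -> F s A ->
          (\int[P]_(w in A) (M t w)%:E = \int[P]_(w in A) (M s w)%:E)%E].

Definition cadlag (E : topologicalType) (p : R -> E) : Prop :=
  forall t, 0 <= t ->
    p s @[s --> t^'+] --> p t /\
    (0 < t -> exists l : E, p s @[s --> t^'-] --> l).

(* S is finite and carries the discrete sigma-algebra. *)
Definition markov_chain (S : Type) (L : (S -> R) -> S -> R)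
    (Y : R -> Omega -> S) : Prop :=
  (forall t B, 0 <= t -> measurable (Y t @^-1` B)) /\
  exists2 Q, markov_semigroup L Q &
    forall s t (f : S -> R) A, 0 <= s -> 0 <= t ->
      sigma_process setT `[0, s] Y A ->
      (\int[P]_(w in A) (f (Y (s + t)%R w))%:E
        = \int[P]_(w in A) (Q t f (Y s w))%:E)%E.

End processes.

Section martingale_problem.
Context {R : realType}.

Definition Phi m (t : cladograms m) (x : T2cont R) : R :=
  fine (power_measure (amt_mu (rep x)) m
    [set u : m.-tuple (borel (rep x)) | tree_shape u = Some (val t)]).

Definition extend0 m (phi : cladograms m -> R) (s : option (lcladograms m)) : R :=
  if s is Some s' then if insub s' is Some t then phi t else 0 else 0.

Definition OmegaPhi m (t : cladograms m) (x : T2cont R) : R :=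
  \int[power_measure (amt_mu (rep x)) m]_u
    extend0 (aldous_generator \1_[set t]) (tree_shape u).

(* The graph of Omega_Ald; its domain is the linear span of the [Phi t]. *)
Definition OmegaAld (F G : T2cont R -> R) : Prop :=
  exists l : seq (R * {m : nat & cladograms m}),
    F = (fun x => \sum_(p <- l) p.1 * Phi (tagged p.2) x) /\
    G = (fun x => \sum_(p <- l) p.1 * OmegaPhi (tagged p.2) x).

Context {d : measure_display} {Omega : measurableType d}.

Definition martingale_problem_solution (P : probability Omega R)
    (P0 : probability (borel (T2cont R)) R) (X : R -> Omega -> T2cont R) : Prop :=
  [/\ measurable_fun ([set t : R | 0 <= t] `*` [set: Omega])
        (fun p : R * Omega => X p.1 p.2 : borel (T2cont R)),
      forall B : set (borel (T2cont R)), measurable B -> P (X 0 @^-1` B) = P0 B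
    & forall F G, OmegaAld F G ->
        is_martingale P
          (fun t => augmented P
            (sigma_process (@measurable _ (borel (T2cont R))) `[0, t] X))
          (fun t w => F (X t w) - \int[lebesgue_measure]_(s in `[0, t]) G (X s w))].

End martingale_problem.

(* Main.v *)
Require Import Defs.
From HB Require Import structures.
From mathcomp Require Import all_boot all_order all_algebra.
From mathcomp Require Import generic_quotient.
From mathcomp Require Import all_classical all_reals all_analysis.
From mathcomp Require Import measurable_realfun ring lra.
Set Implicit Arguments.
Unset Strict Implicit.
Unset Printing Implicit Defensive.
Import Order.TTheory GRing.Theory Num.Theory.
Import numFieldNormedType.Exports.
Local Open Scope classical_set_scope.
Local Open Scope ring_scope.

(* Let V_s(t) be the expected Phi^{m,t}(X_s). The operator L = Omega_m is
   symmetric, because pruning a leaf and grafting it elsewhere can be undone by one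
   such move of the same leaf. Hence Omega_Ald Phi^{m,t} = L (Phi^{m,.}) (t), and
   the martingale property together with Fubini gives V_T = V_0 + int_0^T L V_s ds.
   Both V and the semigroup Q of the Aldous chain thus solve a linear equation on
   the finite space of cladograms, so that V_s = Q_s V_0, which is the claim.

   Fubini requires Phi^{m,t} to be Borel. A cladogram is determined by the quartets
   ij|kl that it displays, and for almost every sample u these are read off from
   the strict inequalities r(u_i,u_j) + r(u_k,u_l) < r(u_i,u_k) + r(u_j,u_l). So
   Phi^{m,t} is a pointwise limit of integrals of bounded continuous functions of
   the sampled distance matrix, each of which is continuous on T_2^cont. *)

(** * Halfspaces and branch points *)

(** Two obstacles shape the argument. First, the Borel sigma-algebra of the component topology on a
    product may exceed the product sigma-algebra, so topological arguments do not make the branch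
    point map jointly measurable. Measurability is tested on components only: a component is a
    halfspace, its preimage under the branch point map is a majority of preimages, and by order
    separability countably many components separate points. Second, [Q] has a known derivative only
    at time 0, and of V one knows at first just that it is a bounded measurable solution of an
    integral equation. Both are compared along an Euler scheme of step T/N, where contractivity of
    [Q] keeps the one-step errors from growing. The strict inequalities hold almost surely because
    the inner path of a quartet has positive length: either an end is a branch point, which carries
    mass of the branch point distribution, or both ends are sample points and non-atomicity gives
    mass to the path between them. Symmetry of the rates is a count: for distinct cladograms, each
    leaf has at most one edge that leads from one to the other. *)

Definition maj (a b c : bool) : bool := [|| a && b, a && c | b && c].

Section halfspaces.
Context {T : Type} (c : T -> T -> T -> T).
Hypothesis tree : is_algTree c.

Lemma bpC x y z : c x y z = c y z x.
Proof. by rewrite (bpC12 tree) (bpC23 tree). Qed.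

Lemma bp_same1 x y : c x x y = x.
Proof. by rewrite bpC -bpC (bpC23 tree) (bpC12 tree) (bp_two tree). Qed.

Lemma bp_same2 x y : c x y x = x.
Proof. by rewrite (bpC23 tree) bp_same1. Qed.

Lemma bp_idem2 x y z : c x z (c x y z) = c x y z.
Proof. by rewrite (bpC23 tree x y) (bp_idem tree). Qed.

Lemma bp_idem3 x y z : c y z (c x y z) = c x y z.
Proof. by rewrite (bpC x y z) (bp_idem tree). Qed.

(** Such an [h] is a homomorphism into the two-point tree, whose branch point map is the
    majority. *)
Definition halfspace (h : T -> bool) : Prop :=
  forall x y z, h (c x y z) = maj (h x) (h y) (h z).

(** [c p x y <> p] says that x and y lie in one component at p; transitivity is the four-point
    axiom. *)
Lemma separated_trans p x y z :
  c p x y <> p -> c p y z <> p -> c p x z <> p.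
Proof.
move=> xy yz xz; case: (bp_four tree p x z y); rewrite xz => E.
- exact: xy.
- by apply: yz; rewrite (bpC23 tree).
- by apply: xy; rewrite E bpC (bpC23 tree x z) bp_idem.
Qed.

(** Both the component and its complement contain the branch point of a triple as soon as they
    contain two of its members ([inside], [outside]), and one of the two always contains at least
    two. *)
Lemma component_halfspace p q : q <> p ->
  halfspace (fun z => `[< component c p q z >]).
Proof.
move=> qp x y z.
have sym u v : c p u v = c p v u by exact: bpC23.
have inside u v w : component c p q u -> component c p q v ->
    component c p q (c u v w).
  move=> [up qu] [vp qv]; set m := c u v w.
  have uv : c p u v <> p by apply: (separated_trans (y := q)) => //; rewrite sym.
  have mp : m <> p by move=> E; apply: uv; rewrite bpC -E (bp_idem tree).
  split=> //; apply: (separated_trans (y := u)) => // um.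
  have uvm : c u v m = m by exact: bp_idem.
  have vm : c p v m = p.
    case: (bp_four tree p u m v); rewrite um => E.
    - by case: (uv).
    - by rewrite sym.
    - by case: mp; rewrite E (bpC23 tree).
  case: (bp_four tree p u v m) => E; first by apply: uv; rewrite E.
  - by apply: uv; rewrite E.
  - by apply: mp; rewrite -um -uvm -E (bp_idem tree).
have outside u v w : ~ component c p q u -> ~ component c p q v ->
    ~ component c p q (c u v w).
  set m := c u v w => nu nv [mp qm].
  have sep w' : ~ component c p q w' -> c p w' m = p.
    move=> nw; apply: contrapT => h; apply: nw.
    split; first by move=> E; apply: h; rewrite E bp_same1.
    by apply: (separated_trans (y := m)) => //; rewrite sym.
  have um := sep _ nu; have vm := sep _ nv.
  have uvm : c u v m = m by exact: bp_idem.
  case: (bp_four tree u v m p); rewrite uvm => E.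
  - by apply: mp; rewrite -um E -(bpC p u v) (bp_idem tree).
  - by apply: mp; rewrite E -bpC.
  - by apply: mp; rewrite E -bpC.
have E w1 w2 w3 b : (`[< component c p q w1 >] = b) ->
    (`[< component c p q w2 >] = b) -> `[< component c p q (c w1 w2 w3) >] = b.
  case: b => [/asboolP h1 /asboolP h2|/asboolPn h1 /asboolPn h2].
    by apply/asboolP; exact: inside.
  by apply/asboolPn; exact: outside.
case ex: `[< component c p q x >]; case ey: `[< component c p q y >];
  case ez: `[< component c p q z >]; rewrite /maj /=;
  by [apply: E|rewrite bpC; apply: E|rewrite -bpC; apply: E].
Qed.

Lemma halfspace_ext p q : (forall h, halfspace h -> h p = h q) -> p = q.
Proof.
move=> H; apply: contrapT => pq.
have qp : q <> p by exact/nesym.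
have := H _ (component_halfspace qp).
have -> : `[< component c p q q >] = true.
  by apply/asboolP; split=> //; rewrite (bp_two tree).
by move/asboolP => -[].
Qed.

End halfspaces.

(* Halfspaces separate the points of a tree and turn the branch point map into
   the majority function, so that an implication between equations of tree terms
   holds in all trees as soon as it holds for majorities of booleans. *)
Ltac by_halfspaces tree :=
  let h := fresh "h" in let hE := fresh "hE" in
  apply: (halfspace_ext tree) => h hE;
  repeat match goal with H : _ = _ |- _ => move: {H} (congr1 h H) end;
  rewrite ?hE /maj;
  repeat match goal with |- context [h ?x] => case: (h x) end; done.

Section geometry.
Context {T : Type} (c : T -> T -> T -> T).
Hypothesis tree : is_algTree c.
Implicit Types p q v x y z : T.

Lemma between_uniq x y z w :
  c x y w = w -> c x z w = w -> c y z w = w -> c x y z = w.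
Proof. by move=> h1 h2 h3; by_halfspaces tree. Qed.

Lemma bp_apart x y z v : c x y z = v -> c v x y = v.
Proof. by move=> h1; by_halfspaces tree. Qed.

Lemma apart_or x y v p : c v x y = v -> c v p x = v \/ c v p y = v.
Proof.
move=> xy; apply: contrapT => /not_orP[px py].
apply: (separated_trans tree (y := p) _ py) xy.
by rewrite (bpC23 tree).
Qed.

(** [c v x y = v] means that v lies on the path from x to y. The directions of x, y, z at v are
    pairwise apart, so p shares a direction with at most one of them. *)
Lemma apart_two x y z v p : c x y z = v ->
  [\/ c v p x = v /\ c v p y = v, c v p x = v /\ c v p z = v
    | c v p y = v /\ c v p z = v].
Proof.
move=> E; have xy := bp_apart E.
have yz : c v y z = v by apply: (@bp_apart y z x); rewrite -bpC.
have xz : c v x z = v by apply: (@bp_apart x z y); rewrite -(bpC23 tree).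
have [px|px] := apart_or p xy; have [py|py] := apart_or p yz;
  have [pz|pz] := apart_or p xz; by [apply: Or31|apply: Or32|apply: Or33].
Qed.

Lemma apart_bp x y z v : c v x y = v -> c v x z = v -> c v y z = v ->
  c x y z = v.
Proof. by move=> h1 h2 h3; by_halfspaces tree. Qed.

Lemma apart_beyond x y z v : v <> y ->
  c v x y = v -> c v z y = y -> c v x z = v.
Proof.
move=> vy xy zy; have [|//] := apart_or z xy; first by rewrite (bpC23 tree).
by rewrite zy => /nesym.
Qed.

End geometry.

(** * Extending a map of leaves to a tree homomorphism *)

Section extension.
Context {T1 T2 : Type} (c1 : T1 -> T1 -> T1 -> T1) (c2 : T2 -> T2 -> T2 -> T2).
Hypotheses (tree1 : is_algTree c1) (tree2 : is_algTree c2).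

(** A branch point is the only common point of the three paths joining its arguments, so betweenness
    determines it. *)
Lemma between_hom (f : T1 -> T2) :
  (forall x y z, c1 x y z = z -> c2 (f x) (f y) (f z) = f z) ->
  tree_hom_on c1 c2 setT f.
Proof.
move=> H x y z _ _ _; apply/esym/(between_uniq tree2); apply: H.
- exact: (bp_idem tree1).
- exact: (bp_idem2 tree1).
- exact: (bp_idem3 tree1).
Qed.

Context {I : Type} (a : I -> T1) (b : I -> T2).
Hypothesis span : forall v, exists i j k, c1 (a i) (a j) (a k) = v.
Hypothesis quartet : forall i j k l,
  c1 (a i) (a j) (a k) = c1 (a i) (a j) (a l) ->
  c2 (b i) (b j) (b k) = c2 (b i) (b j) (b l).

(** Makes the extension well defined. One spanning triple of v is turned into the other by
    exchanging one index at a time; each exchange ([step]) replaces an index by one in a direction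
    apart from the two that stay, which is a single quartet. *)
Lemma quartet_bp i j k i' j' k' v :
  c1 (a i) (a j) (a k) = v -> c1 (a i') (a j') (a k') = v ->
  c2 (b i) (b j) (b k) = c2 (b i') (b j') (b k').
Proof.
move=> E E'.
have step x x' y z : c1 (a x) (a y) (a z) = v -> c1 v (a x') (a y) = v ->
    c1 v (a x') (a z) = v ->
    c1 (a x') (a y) (a z) = v /\ c2 (b x') (b y) (b z) = c2 (b x) (b y) (b z).
  move=> {E E'} h1 h2 h3; have h : c1 (a x') (a y) (a z) = v by by_halfspaces tree1.
  split=> //; rewrite !(bpC tree2 (b _) (b y)); apply: quartet.
  by rewrite -!(bpC tree1 _ (a y)) h1.
have [x [y [h1 <-]]] : exists x y, c1 (a i') (a x) (a y) = v /\
    c2 (b i') (b x) (b y) = c2 (b i) (b j) (b k).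
  have [[]|[]|[]] := apart_two tree1 (a i') E => p q.
  - exists i, j; have [|//|//|h1 h2] := step k i' i j; first by by_halfspaces tree1.
    by split=> //; by_halfspaces tree2.
  - exists i, k; have [|//|//|h1 h2] := step j i' i k; first by by_halfspaces tree1.
    by split=> //; by_halfspaces tree2.
  - by exists j, k; exact: step.
have [z [h2 <-]] : exists z, c1 (a i') (a j') (a z) = v /\
    c2 (b i') (b j') (b z) = c2 (b i') (b x) (b y).
  have ij : c1 v (a j') (a i') = v by by_halfspaces tree1.
  have xy : c1 v (a x) (a y) = v by by_halfspaces tree1.
  have [h|h] := apart_or tree1 (a j') xy.
  - exists x; have [|//|//|h2 h3] := step y j' i' x; first by by_halfspaces tree1.
    by split; [by_halfspaces tree1|by_halfspaces tree2].
  - exists y; have [|//|//|h2 h3] := step x j' i' y; first by by_halfspaces tree1.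
    by split; [by_halfspaces tree1|by_halfspaces tree2].
have [|||h3 h4] := step z k' i' j'; [by by_halfspaces tree1..|].
by by_halfspaces tree2.
Qed.

Lemma quartet_extension : exists f : T1 -> T2,
  (forall i j k, f (c1 (a i) (a j) (a k)) = c2 (b i) (b j) (b k)) /\
  tree_hom_on c1 c2 setT f.
Proof.
have /choice[i_ /choice[j_ /choice[k_ ijkE]]] := span.
pose f v := c2 (b (i_ v)) (b (j_ v)) (b (k_ v)); exists f.
have fE i j k v : c1 (a i) (a j) (a k) = v -> f v = c2 (b i) (b j) (b k).
  by move=> h; apply: (quartet_bp (ijkE v)).
split; first by move=> i j k; exact: fE.
apply: between_hom => x y z xyz.
have [->|zx] := pselect (z = x); first exact: (bp_same2 tree2).
have [->|zy] := pselect (z = y); first exact: (bp_two tree2).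
have xy : x <> y by move=> h; apply: zx; rewrite -xyz h (bp_same1 tree1).
(* The path from x to y is prolonged to leaves i and j. *)
have beyond v w : v <> w -> exists i k, c1 v (a i) (a k) = v /\
    c1 v (a i) w = v /\ c1 v (a k) w = v.
  move=> _; have E := ijkE v; have S := bp_apart tree1 E.
  have [[h1 h2]|[h1 h2]|[h1 h2]] := apart_two tree1 w E;
    [exists (i_ v), (j_ v)|exists (i_ v), (k_ v)|exists (j_ v), (k_ v)];
    by split; [|split]; by_halfspaces tree1.
have [i [k1 [ik [iy k1y]]]] := beyond _ _ xy.
have [j [k2 [jk [jx k2x]]]] := beyond _ _ (nesym xy).
have xij : c1 x (a i) (a j) = x.
  by apply: (apart_beyond tree1 xy iy); by_halfspaces tree1.
have yij : c1 y (a i) (a j) = y.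
  rewrite (bpC23 tree1).
  by apply: (apart_beyond tree1 (nesym xy) jx); by_halfspaces tree1.
have zij : c1 z (a i) (a j) = z by clear ik jk k1y k2x; by_halfspaces tree1.
(* A side branch at z: a triple spanning z has two members apart from i, and as these are apart from
   each other, one of them is apart from j too. *)
have [k3 [ik3 jk3]] : exists k3, c1 z (a i) (a k3) = z /\ c1 z (a j) (a k3) = z.
  have E := ijkE z.
  have pair p q : c1 z (a i) (a p) = z -> c1 z (a i) (a q) = z ->
      c1 z (a p) (a q) = z ->
      exists k3, c1 z (a i) (a k3) = z /\ c1 z (a j) (a k3) = z.
    by move=> h1 h2 /(apart_or tree1 (a j))[h|h]; [exists p|exists q].
  by have [[h1 h2]|[h1 h2]|[h1 h2]] := apart_two tree1 (a i) E;
    apply: pair h1 h2 _; clear -E tree1; by_halfspaces tree1.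
have zx' : c1 z (a i) x = x by clear -iy xyz xy tree1; by_halfspaces tree1.
have k3x : c1 x (a k3) z = z by clear -zx' ik3 tree1; by_halfspaces tree1.
have zy' : c1 z (a j) y = y by clear -jx xyz xy tree1; by_halfspaces tree1.
have k3y : c1 y (a k3) z = z by clear -zy' jk3 tree1; by_halfspaces tree1.
have xk3 p : c1 x (a p) y = x -> c1 x (a p) (a k3) = x.
  move=> py; apply: (apart_beyond tree1 (y := z)) k3x; first exact/nesym.
  by clear -py xyz tree1; by_halfspaces tree1.
have yk3 p : c1 y (a p) x = y -> c1 y (a p) (a k3) = y.
  move=> px; apply: (apart_beyond tree1 (y := z)) k3y; first exact/nesym.
  by clear -px xyz tree1; by_halfspaces tree1.
have k1xj : c1 x (a k1) (a j) = x.
  by apply: (apart_beyond tree1 xy k1y); clear -jx tree1; by_halfspaces tree1.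
have k2yi : c1 y (a k2) (a i) = y.
  by apply: (apart_beyond tree1 (nesym xy) k2x); clear -iy tree1; by_halfspaces tree1.
have ik1 := xk3 _ iy; have k1k3 := xk3 _ k1y.
have jk2 := yk3 _ jx; have k2k3 := yk3 _ k2x.
(* x is the branch point of i, k1 with either j or k3, y that of j, k2 with either i or k3, and z
   that of i, j, k3. These five equations carry over to [T2], where they force z to lie between x
   and y. *)
have e1 : c1 (a i) (a k1) (a j) = x by clear -ik xij k1xj tree1; by_halfspaces tree1.
have e2 : c1 (a i) (a k1) (a k3) = x by clear -ik ik1 k1k3 tree1; by_halfspaces tree1.
have e3 : c1 (a j) (a k2) (a i) = y by clear -jk yij k2yi tree1; by_halfspaces tree1.
have e4 : c1 (a j) (a k2) (a k3) = y by clear -jk jk2 k2k3 tree1; by_halfspaces tree1.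
have e5 : c1 (a i) (a j) (a k3) = z by clear -zij ik3 jk3 tree1; by_halfspaces tree1.
have := fE _ _ _ _ e1; have := fE _ _ _ _ e2; have := fE _ _ _ _ e3.
have := fE _ _ _ _ e4; have := fE _ _ _ _ e5; clear -tree2.
move: (f x) (f y) (f z) => fx fy fz -> -> h1 -> h2.
by by_halfspaces tree2.
Qed.

End extension.

(** * Leaves and branch points in terms of components *)

Section degrees.
Context {T : Type} (c : T -> T -> T -> T).
Hypothesis tree : is_algTree c.

Lemma component_refl x y : y <> x -> component c x y y.
Proof. by move=> yx; split=> //; rewrite (bp_two tree). Qed.

Lemma component_eq x y z : component c x y z -> component c x y = component c x z.
Proof.
move=> [zx yz]; apply/seteqP; split=> w [wx ww]; split=> //.
  by apply: (separated_trans tree (y := y)) => //; rewrite (bpC23 tree).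
by apply: (separated_trans tree (y := z)).
Qed.

Lemma componentC x y z : y <> x -> component c x y z -> component c x z y.
Proof. by move=> yx [_ yz]; split=> //; rewrite (bpC23 tree). Qed.

Lemma component_inj x y z : y <> x -> z <> x ->
  component c x y = component c x z <-> c x y z <> x.
Proof.
move=> yx zx; split=> [E|h]; last exact: component_eq.
have : component c x y z by rewrite E; exact: component_refl.
by case.
Qed.

Lemma card_ge_seq (U : Type) (A : set U) n (f : nat -> U) :
  (forall i, (i < n)%N -> A (f i)) ->
  (forall i j, (i < n)%N -> (j < n)%N -> f i = f j -> i = j) ->
  (`I_n #<= A)%card.
Proof.
move=> fA finj; have E : (f @` `I_n #= `I_n)%card.
  by apply: inj_card_eq => i j; rewrite !inE /=; exact: finj.
by rewrite -(card_le_eql E); apply: subset_card_le => _ [i /= /fA Ai <-].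
Qed.

Lemma leafE x : leaf c x <-> forall y z, y <> x -> z <> x -> c x y z <> x.
Proof.
split.
  move=> [/card_eqPle[cardS _]|xE] y z yx zx; last first.
    by have : [set: T] y by []; rewrite xE.
  apply/component_inj => //; apply: contrapT => yz.
  have : (`I_2 #<= `I_1)%card.
    apply: (card_le_trans _ cardS).
    apply: (@card_ge_seq _ _ _ (fun i => component c x (if i == 0%N then y else z))).
      by move=> i _; case: ifP => _; [exists y|exists z].
    by move=> [|[|i]] [|[|j]] //= _ _ /esym/yz.
  by rewrite card_le_II.
move=> H; have [[y yx]|nex] := pselect (exists y, y <> x); last first.
  right; apply/seteqP; split=> // y _; apply: contrapT => yx.
  by apply: nex; exists y.
left; rewrite (_ : components c x = [set component c x y]) ?card_set1//.
apply/seteqP; split=> [_ [z /= zx <-]|_ ->] /=; last by exists y.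
by apply/component_inj => //; exact: H.
Qed.

Lemma branchP x : branch c x -> exists y1 y2 y3,
  [/\ y1 <> x, y2 <> x, y3 <> x & [/\ c x y1 y2 = x, c x y1 y3 = x & c x y2 y3 = x]].
Proof.
move=> /pcard_leP[f].
have fE i : (i < 3)%N -> exists2 y, y <> x & component c x y = f i.
  move=> i3; have [y yx yE] : components c x (f i) by exact: funS.
  by exists y.
have [y1 h1 e1] := fE 0%N erefl; have [y2 h2 e2] := fE 1%N erefl.
have [y3 h3 e3] := fE 2%N erefl.
have ne i j y z : (i < 3)%N -> (j < 3)%N -> i <> j -> component c x y = f i ->
    component c x z = f j -> y <> x -> z <> x -> c x y z = x.
  move=> i3 j3 ij yE zE yx zx; apply: contrapT => /(component_inj yx zx).
  by rewrite yE zE => /inj E; apply/ij/E; rewrite inE.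
exists y1, y2, y3; split=> //; split.
- exact: (ne 0%N 1%N _ _ erefl erefl _ e1 e2).
- exact: (ne 0%N 2%N _ _ erefl erefl _ e1 e3).
- exact: (ne 1%N 2%N _ _ erefl erefl _ e2 e3).
Qed.

Lemma branch3 x y1 y2 y3 : y1 <> x -> y2 <> x -> y3 <> x ->
  c x y1 y2 = x -> c x y1 y3 = x -> c x y2 y3 = x -> branch c x.
Proof.
move=> h1 h2 h3 h12 h13 h23.
have ne y z : y <> x -> z <> x -> c x y z = x -> component c x y <> component c x z.
  by move=> yx zx yz /(component_inj yx zx).
pose y i := if i is 0%N then y1 else if i is 1%N then y2 else y3.
apply: (@card_ge_seq _ _ _ (fun i => component c x (y i))).
  by move=> [|[|i]] _; [exists y1|exists y2|exists y3].
by move=> [|[|[|i]]] [|[|[|j]]] //= _ _ E; exfalso; move: E;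
  do ?[exact: ne|move/esym; exact: ne].
Qed.

Lemma binary_no4 x y1 y2 y3 y4 : binary c ->
  y1 <> x -> y2 <> x -> y3 <> x -> y4 <> x ->
  c x y1 y2 = x -> c x y1 y3 = x -> c x y2 y3 = x ->
  c x y1 y4 = x -> c x y2 y4 = x -> c x y3 y4 <> x.
Proof.
move=> bin h1 h2 h3 h4 h12 h13 h23 h14 h24 h34.
have ne y z : y <> x -> z <> x -> c x y z = x -> component c x y <> component c x z.
  by move=> yx zx yz /(component_inj yx zx).
pose y i := if i is 0%N then y1 else if i is 1%N then y2 else
  if i is 2%N then y3 else y4.
have : (`I_4 #<= `I_3)%card; last by rewrite card_le_II.
apply: card_le_trans (bin x).
apply: (@card_ge_seq _ _ _ (fun i => component c x (y i))).
  by move=> [|[|[|i]]] _; [exists y1|exists y2|exists y3|exists y4].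
by move=> [|[|[|[|i]]]] [|[|[|[|j]]]] //= _ _ E; exfalso; move: E;
  do ?[exact: ne|move/esym; exact: ne].
Qed.

Lemma leaf_end x y z : leaf c x -> c y z x = x -> x = y \/ x = z.
Proof.
move=> /leafE lx yz; apply: contrapT => /not_orP[xy xz].
by apply: (lx y z); [exact/nesym..|rewrite -bpC// -bpC].
Qed.

(** The projection of p onto the edge is u or b, and it is not u because a leaf has only one
    direction. *)
Lemma leaf_edge u b p : leaf c u -> edge c u b -> p <> u -> c u p b = b.
Proof.
move=> /leafE lu [ub E] pu.
have : segment c u b (c u p b) by exact: bp_idem2.
by rewrite E => -[] // /lu; case => //; exact/nesym.
Qed.

End degrees.

Lemma component_apart (T : Type) (c : T -> T -> T -> T) (tree : is_algTree c)
  v x y p q : c v x y = v -> component c v x p -> component c v y q -> c v p q = v.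
Proof.
move=> xy [pv xp] [qv yq]; apply: contrapT => pq; move: xy.
apply: (separated_trans tree (y := q)); last by rewrite (bpC23 tree).
exact: (separated_trans tree (y := p)).
Qed.

(** * Vertices of a cladogram as branch points of its labels *)

Section cladogram.
Context {m : nat} (C : lcladogram m).
Notation c := (@lclado_bp m C).
Notation label := (lclado_label C).
Let tree : is_algTree c := lclado_algTree C.

Lemma label_leaf i : leaf c (label i).
Proof. by rewrite -(lclado_label_onto C); exists i. Qed.

Lemma leaf_label v : leaf c v -> exists i, label i = v.
Proof. by rewrite -(lclado_label_onto C) => -[i _ <-]; exists i. Qed.

(** A vertex w of the component with longest path from v is a leaf: at a branch point some direction
    leads further away from v. *)
Lemma component_label v y : y <> v -> exists i, component c v y (label i).
Proof.
move=> yv.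
pose P : pred (vertex C) := fun w => `[< component c v y w >].
(* [F w] is the number of vertices on the path from v to w. *)
pose F (w : vertex C) := #|[set z | c v w z == z]%SET|.
have y_in : P y by apply/asboolP/(component_refl tree).
have [w /asboolP wy wmax] := arg_maxnP F y_in.
have [/leaf_label[i iw]|/(branchP tree)[y1 [y2 [y3 [y1w y2w _ [y12 _ _]]]]]] :=
  lclado_leaf_or_branch w; first by exists i; rewrite iw.
have [z zw vz] : exists2 z, z <> w & c w v z = w.
  by have [h|h] := apart_or tree v y12; [exists y1|exists y2].
have wz : c v z w = w by clear -vz tree; by_halfspaces tree.
have wv : w <> v by case: wy.
have zy : component c v y z.
  rewrite (component_eq tree wy); split; last by rewrite (bpC23 tree) wz.
  by move=> zv; apply: wv; rewrite -wz zv (bp_same1 tree).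
have /wmax : P z by exact/asboolP.
rewrite /geq /= leqNgt => /negP[]; apply: proper_card; apply/properP; split.
  apply/fintype.subsetP => p; rewrite !inE => /eqP h; apply/eqP.
  by clear -wz h tree; by_halfspaces tree.
exists z; rewrite !inE; first by rewrite (bp_two tree).
by apply/eqP => h; apply: zw; rewrite -h -(bpC23 tree) wz.
Qed.

Lemma branch_span (Q : 'I_m -> Prop) v : branch c v ->
  (forall y, y <> v -> exists2 i, component c v y (label i) & Q i) ->
  exists i j k, [/\ Q i, Q j, Q k & c (label i) (label j) (label k) = v].
Proof.
move=> /(branchP tree)[y1 [y2 [y3 [y1v y2v y3v [y12 y13 y23]]]]] H.
have [i i1 Qi] := H _ y1v; have [j j2 Qj] := H _ y2v; have [k k3 Qk] := H _ y3v.
exists i, j, k; split=> //; apply: (apart_bp tree).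
- exact: (component_apart tree y12).
- exact: (component_apart tree y13).
- exact: (component_apart tree y23).
Qed.

Lemma vertex_span v : exists i j k, c (label i) (label j) (label k) = v.
Proof.
have [/leaf_label[i <-]|bv] := lclado_leaf_or_branch v.
  by exists i, i, i; rewrite (bp_two tree).
have [|i [j [k [_ _ _ <-]]]] := @branch_span xpredT v bv; last by exists i, j, k.
by move=> y /component_label[i]; exists i.
Qed.

Lemma edge_of_leaf_branch u b v : leaf c u -> edge c u b -> v <> u -> v <> b ->
  branch c b.
Proof.
move=> lu ub vu vb; have [lb|//] := lclado_leaf_or_branch b.
have := leaf_edge tree lu ub vu => /(leaf_end tree lb) [/esym|/esym //].
by case: ub.
Qed.

(** Only the direction at v that contains u needs care. It also contains the neighbour b of u, which
    is a branch point, and a direction at b apart from both u and v supplies another label. *)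
Lemma kept_span u b v : leaf c u -> edge c u b -> v <> u -> v <> b ->
  exists i j k, [/\ label i <> u, label j <> u, label k <> u
    & c (label i) (label j) (label k) = v].
Proof.
move=> lu ub vu vb; have [/leaf_label[i iv]|bv] := lclado_leaf_or_branch v.
  by exists i, i, i; rewrite (bp_two tree) iv.
apply: (@branch_span (fun i => label i <> u)) => // y yv.
have [i iy] := component_label yv.
have [iu|iu] := pselect (label i = u); last by exists i.
have ubv := leaf_edge tree lu ub vu.
have yb : component c v y b.
  rewrite (component_eq tree iy) iu; split; first exact/nesym.
  by rewrite (bpC12 tree) ubv; exact/nesym.
have [z [zb uz vz]] : exists z, [/\ z <> b, c b u z = b & c b v z = b].
  have /(branchP tree)[y1 [y2 [y3 [y1b y2b y3b [y12 y13 y23]]]]] :=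
    edge_of_leaf_branch lu ub vu vb.
  have pair p q : p <> b -> q <> b -> c b p q = b -> c b u p = b -> c b u q = b ->
      exists z, [/\ z <> b, c b u z = b & c b v z = b].
    by move=> pb qb /(apart_or tree v)[]; [exists p|exists q].
  have y123 : c y1 y2 y3 = b by exact: (apart_bp tree).
  have [[]|[]|[]] := apart_two tree u y123.
  - exact: pair y12.
  - exact: pair y13.
  - exact: pair y23.
have [j jz] := component_label zb; exists j.
  rewrite (component_eq tree yb).
  have jv : c b v (label j) = b.
    apply: (component_apart tree vz) jz; exact: component_refl.
  split; last by rewrite (bpC12 tree) jv; exact/nesym.
  by move=> E; apply: vb; rewrite -jv E (bp_two tree).
move=> ju; have : c b u u = b.
  rewrite -{2}ju; apply: (component_apart tree uz) jz.
  by apply: component_refl => //; case: ub.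
by rewrite (bp_two tree); case: ub.
Qed.

End cladogram.

(** * Quartets and cladograms *)

(* The labels display the (possibly degenerate) split ij|kl. *)
Definition quartet (T I : Type) (c : T -> T -> T -> T) (a : I -> T) (i j k l : I) :=
  c (a i) (a j) (a k) = c (a i) (a j) (a l).

Section quartets.
Context {T : Type} (c : T -> T -> T -> T) (tree : is_algTree c).

Lemma leaf_not_branch x : leaf c x -> ~ branch c x.
Proof.
by move=> /(leafE tree) lx /(branchP tree)[y [z [_ [yx zx _ [yz _ _]]]]]; apply: (lx y z).
Qed.

Lemma quartet_or (I : Type) (a : I -> T) i j k l :
  [\/ quartet c a i j k l, quartet c a i k j l | quartet c a i l j k].
Proof.
rewrite /quartet; have [h|h|h] := bp_four tree (a i) (a j) (a k) (a l).
- exact: Or31.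
- by apply: Or32; rewrite -h (bpC23 tree).
- by apply: Or33; clear -tree h; by_halfspaces tree.
Qed.

(** Both pairings together make one vertex v the branch point of all triples among the four points.
    Then v has four directions, or it is one of the four points and that point is a branch point. *)
Lemma quartet_excl (I : eqType) (a : I -> T) i j k l : binary c ->
  (forall i, ~ branch c (a i)) -> injective a -> uniq [:: i; j; k; l] ->
  quartet c a i j k l -> ~ quartet c a i k j l.
Proof.
move=> bin nb inj; rewrite /= !inE !negb_or !andbT => /and3P[/and3P[ij ik il]].
move=> /andP[jk jl] kl q1 q2.
have ne p q : p != q -> a p <> a q by move=> /eqP pq /inj.
move: q1; rewrite /quartet; set v := c (a i) (a j) (a k) => q1.
have vE : c (a i) (a j) (a k) = v by [].
have q3 : v = c (a i) (a k) (a l) by rewrite -q2 (bpC23 tree).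
clear q2; clearbody v.
have hij : c v (a i) (a j) = v by clear -tree vE; by_halfspaces tree.
have hik : c v (a i) (a k) = v by clear -tree vE; by_halfspaces tree.
have hjk : c v (a j) (a k) = v by clear -tree vE; by_halfspaces tree.
have hil : c v (a i) (a l) = v by clear -tree q1; by_halfspaces tree.
have hjl : c v (a j) (a l) = v by clear -tree q1; by_halfspaces tree.
have hkl : c v (a k) (a l) = v by clear -tree q3; by_halfspaces tree.
have br p q r s : v = a p -> p != q -> p != r -> p != s ->
    c v (a q) (a r) = v -> c v (a q) (a s) = v -> c v (a r) (a s) = v -> False.
  move=> -> pq pr ps h1 h2 h3; apply: (nb p).
  by apply: (branch3 tree _ _ _ h1 h2 h3); apply: ne; rewrite eq_sym.
have [vi|vi] := pselect (v = a i); first exact: (br i j k l).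
have [vj|vj] := pselect (v = a j).
  by apply: (br j i k l) => //; rewrite eq_sym.
have [vk|vk] := pselect (v = a k).
  by apply: (br k i j l) => //; rewrite eq_sym.
have [vl|vl] := pselect (v = a l).
  by apply: (br l i j k) => //; rewrite eq_sym.
by apply: (binary_no4 tree bin _ _ _ _ hij hik hjk hil hjl hkl); exact/nesym.
Qed.

End quartets.

Section quartet_cladogram.
Context {m : nat} (C : lcladogram m).
Hypothesis injC : injective (lclado_label C).
Notation c := (@lclado_bp m C).
Notation label := (lclado_label C).
Let tree : is_algTree c := lclado_algTree C.

Section target.
Context {T : Type} (c2 : T -> T -> T -> T) (tree2 : is_algTree c2).
Context (b : 'I_m -> T).
Hypothesis quartet_b : forall i j k l, uniq [:: i; j; k; l] ->
  quartet c label i j k l -> quartet c2 b i j k l.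

(** Coinciding indices add nothing: the quartet is trivial if i = j or k = l, and any other
    coincidence would put a leaf strictly between two others. *)
Lemma quartet_distinct i j k l :
  quartet c label i j k l -> quartet c2 b i j k l.
Proof.
move=> q; rewrite /quartet in q *.
have [->|ij] := eqVneq i j; first by rewrite !(bp_same1 tree2).
have [->|kl] := eqVneq k l; first by [].
have ends x y p : x != p -> y != p -> c (label x) (label y) (label p) <> label p.
  move=> /eqP xp /eqP yp.
  by move=> /(leaf_end tree (label_leaf C p))[/injC/esym|/injC/esym].
have [E|ik] := eqVneq i k.
  subst k; exfalso; apply: (ends j l i) => //; rewrite 1?eq_sym//.
  by clear -tree q; by_halfspaces tree.
have [E|il] := eqVneq i l.
  subst l; exfalso; apply: (ends j k i) => //; rewrite 1?eq_sym//.
  by clear -tree q; by_halfspaces tree.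
have [E|jk] := eqVneq j k.
  subst k; exfalso; apply: (ends i l j) => //; rewrite 1?eq_sym//.
  by clear -tree q; by_halfspaces tree.
have [E|jl] := eqVneq j l.
  subst l; exfalso; apply: (ends i k j) => //; rewrite 1?eq_sym//.
  by clear -tree q; by_halfspaces tree.
by apply: quartet_b q; rewrite /= !inE !negb_or ij ik il jk jl kl.
Qed.

Lemma cladogram_hom : exists f : vertex C -> T,
  (forall i, f (label i) = b i) /\ tree_hom_on c c2 setT f.
Proof.
have [f [fE fhom]] := quartet_extension tree tree2 (@vertex_span m C) quartet_distinct.
exists f; split=> // i.
by have := fE i i i; rewrite (bp_two tree) (bp_two tree2).
Qed.

Hypotheses (bin2 : binary c2) (b_nb : forall i, ~ branch c2 (b i)).
Hypothesis b_inj : injective b.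

(** On each side one of the three pairings of four labels holds, and in the binary target no two of
    them; hence an inclusion between the sets of displayed quartets is an equality. *)
Lemma quartet_reflect i j k l : uniq [:: i; j; k; l] ->
  quartet c2 b i j k l -> quartet c label i j k l.
Proof.
move=> u q; have [//|q'|q'] := quartet_or tree label i j k l.
- have u' : uniq [:: i; k; j; l].
    by rewrite (perm_uniq (_ : perm_eq _ [:: i; j; k; l]))// perm_cons (perm_catCA [:: k] [:: j] [:: l]).
  by case: (quartet_excl tree2 bin2 b_nb b_inj u q); exact: quartet_b.
have u' : uniq [:: i; l; j; k].
  by rewrite (perm_uniq (_ : perm_eq _ [:: i; j; k; l]))// perm_cons (perm_catC [:: l]).
have u'' : uniq [:: i; j; l; k].
  by rewrite (perm_uniq (_ : perm_eq _ [:: i; j; k; l]))// !perm_cons (perm_catC [:: l]).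
case: (quartet_excl tree2 bin2 b_nb b_inj u''); first exact: esym.
exact: quartet_b.
Qed.

End target.
End quartet_cladogram.

(** The identity on labels extends to homomorphisms both ways; they are mutually inverse because the
    labels span all vertices. *)
Lemma lclado_equiv_of_quartet m (C C' : lcladogram m) :
  injective (lclado_label C) -> injective (lclado_label C') ->
  (forall i j k l, uniq [:: i; j; k; l] ->
    quartet (@lclado_bp m C) (lclado_label C) i j k l ->
    quartet (@lclado_bp m C') (lclado_label C') i j k l) ->
  lclado_equiv C C'.
Proof.
move=> inj inj' q.
have q' i j k l : uniq [:: i; j; k; l] ->
    quartet (@lclado_bp m C') (lclado_label C') i j k l ->
    quartet (@lclado_bp m C) (lclado_label C) i j k l.
  apply: (quartet_reflect (lclado_algTree C') q (@lclado_binary m C') _ inj').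
  move=> p; exact: (leaf_not_branch (lclado_algTree C') (label_leaf C' p)).
have [f [fl fhom]] := cladogram_hom inj (lclado_algTree C') q.
have [g [gl ghom]] := cladogram_hom inj' (lclado_algTree C) q'.
apply/asboolP; exists f; split=> //; exists g => v.
  have [i [j [k <-]]] := vertex_span v.
  by rewrite fhom// ghom// !fl !gl.
have [i [j [k <-]]] := vertex_span v.
by rewrite ghom// fhom// !gl !fl.
Qed.

Lemma cladograms_eq m (t t' : cladograms m) :
  lclado_equiv (repr (val t)) (repr (val t')) -> t = t'.
Proof.
move=> h; apply: val_inj; rewrite -[LHS]reprK -[RHS]reprK.
exact/eqquotP.
Qed.

Lemma cladogram_inj m (t : cladograms m) : injective (lclado_label (repr (val t))).
Proof. by have := valP t => /asboolP. Qed.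

Lemma cladograms_finite m : exists s : seq (cladograms m), uniq s /\ forall t, t \in s.
Proof.
pose code (t : cladograms m) : {ffun 'I_m * 'I_m * ('I_m * 'I_m) -> bool} :=
  [ffun p => `[< quartet (@lclado_bp m (repr (val t))) (lclado_label (repr (val t)))
     p.1.1 p.1.2 p.2.1 p.2.2 >]].
have code_inj : injective code.
  move=> t t' E; apply/cladograms_eq/lclado_equiv_of_quartet; try exact: cladogram_inj.
  move=> i j k l _ q; have := congr1 (fun f : {ffun _ -> _} => f ((i, j), (k, l))) E.
  by rewrite !ffunE /= => e; apply/asboolP; rewrite -e; exact/asboolP.
have : finite_set [set: cladograms m].
  rewrite -(preimage_setT code); apply: finite_preimage; first by move=> ? ? _ _; exact: code_inj.
  exact: finite_finset.
move=> /finite_seqP[s sE]; exists (undup s); split; first exact: undup_uniq.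
by move=> t; rewrite mem_undup; have : [set: cladograms m] t by []; rewrite sE.
Qed.

(** Replaces the existence of a homomorphism by finitely many conditions on the sample, a form in
    which measurability can be checked. Displaying the quartets of [t] suffices, since by
    [quartet_reflect] no others are then displayed. *)
Lemma tree_shapeE (T : algTree) m (u : m.-tuple T) (t : cladograms m) :
  binary (@bp T) ->
  tree_shape u = Some (val t) <->
  [/\ forall i, ~ branch (@bp T) (tnth u i), injective (tnth u)
    & forall i j k l, uniq [:: i; j; k; l] ->
      quartet (@lclado_bp m (repr (val t))) (lclado_label (repr (val t))) i j k l ->
      quartet (@bp T) (tnth u) i j k l].
Proof.
move=> bin; set C := repr (val t).
have injC : injective (lclado_label C) := cladogram_inj (t := t).
have shape_inj C' : is_shape u C' ->
    injective (lclado_label C') <-> injective (tnth u).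
  move=> [lu _]; split=> inj i j h.
    by apply: inj; apply/lu.
  by apply: inj; apply/lu.
have shape_quartet C' i j k l : is_shape u C' ->
    quartet (@lclado_bp m C') (lclado_label C') i j k l ->
    quartet (@bp T) (tnth u) i j k l.
  by move=> [_ [f [fhom fl _]]] q; rewrite /quartet -!fl -!fhom// q.
split.
  rewrite /tree_shape; case: pselect => // h [E].
  case: cid E => s /= sh E; rewrite E in sh; split; first by case: h.
    exact/(shape_inj C).
  by move=> i j k l _; exact: shape_quartet.
move=> [nb inj q].
have [f [fl fhom]] := cladogram_hom injC (algTreeP T) q.
have sh : is_shape u C.
  split; first by move=> i j; split=> [/injC|/inj] ->.
  exists f; split=> //; apply/seteqP; split=> [_ [v _ <-]|w].
    have [i [j [k <-]]] := vertex_span v; rewrite fhom// !fl.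
    by exists (tnth u i), (tnth u j), (tnth u k); split=> //; eexists.
  move=> [_ [_ [_ [[i _ <-] [j _ <-] [k _ <-] <-]]]].
  by rewrite -!fl -fhom//; eexists.
rewrite /tree_shape; case: pselect => [h|[]]; last by split=> //; exists (val t).
congr Some; case: cid => s /= ssh.
have sinj : injective (lclado_label (repr s)) by exact/(shape_inj _ ssh).
have s_in : `[< injective (lclado_label (repr s)) >] by exact/asboolP.
suff -> : t = Sub s s_in by rewrite SubK.
apply/esym/cladograms_eq; rewrite SubK; apply: lclado_equiv_of_quartet => //.
move=> i j k l uq /(shape_quartet _ _ _ _ _ ssh).
exact: (quartet_reflect (algTreeP T) q bin nb inj).
Qed.

(** * Pruning and regrafting a leaf *)

Section neighbour.
Context {m : nat} (C : lcladogram m).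
Notation c := (@lclado_bp m C).
Notation label := (lclado_label C).
Let tree : is_algTree c := lclado_algTree C.

Lemma leaf_edge_uniq u b b' : leaf c u -> edge c u b -> edge c u b' -> b = b'.
Proof.
move=> lu ub ub'; have [_ E] := ub'.
have : segment c u b' b.
  by apply: (leaf_edge tree lu ub); case: ub' => /nesym.
by rewrite E => -[]// /esym; case: ub.
Qed.

(** A vertex of the component with shortest path to b is adjacent to b: anything strictly in between
    would lie in the same component and be closer. *)
Lemma neighbour b y : y <> b -> exists2 z, component c b y z & edge c b z.
Proof.
move=> yb.
pose P : pred (vertex C) := fun w => `[< component c b y w >].
pose F (w : vertex C) := #|[set z | c b w z == z]%SET|.
have y_in : P y by apply/asboolP/(component_refl tree).
have [w /asboolP wy wmin] := arg_minnP F y_in.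
exists w => //; split; first by case: wy => /nesym.
apply/seteqP; split=> [z bwz|z [->|->]]; last first.
- exact: (bp_two tree).
- exact: (bp_same2 tree).
rewrite /segment /= in bwz; apply: contrapT => /not_orP[zb zw].
have /wmin : P z.
  apply/asboolP; rewrite (component_eq tree wy); split=> //.
  by rewrite bwz.
rewrite leqNgt => /negP[]; apply: proper_card; apply/properP; split.
  apply/fintype.subsetP => p; rewrite !inE => /eqP h; apply/eqP.
  by clear -bwz h tree; by_halfspaces tree.
exists w; rewrite !inE; first by rewrite (bp_two tree).
apply/eqP => h; apply: zw; clear -h bwz tree; by_halfspaces tree.
Qed.

End neighbour.

(* Pruning the leaf u, whose neighbour is b, makes z1 and z2 adjacent; f
   identifies the vertices of C with those of the tree C' in which u has been
   grafted between z1 and z2. *)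
Definition graft m (C C' : lcladogram m) (u b z1 z2 : vertex C)
    (f : vertex C -> vertex C') : Prop :=
  let c := @lclado_bp m C in
  let c' := @lclado_bp m C' in
  let kept := ~` [set u; b] in
  [/\ bijective f /\ forall i, f (lclado_label C i) = lclado_label C' i,
      edge c u b /\ edge c' (f u) (f b),
      tree_hom_on c c' kept f,
      [/\ z1 <> z2, kept z1, kept z2
        & forall p, kept p -> c z1 z2 p = z1 \/ c z1 z2 p = z2]
    & c' (f z1) (f z2) (f b) = f b].

Lemma graft_sym m (C C' : lcladogram m) u b z1 z2 f :
  @graft m C C' u b z1 z2 f -> graft u b z2 z1 f.
Proof.
move=> [? ? ? [z12 k1 k2 H] E]; split=> //.
  by split=> //; [exact/nesym|move=> p /H; rewrite (bpC12 (lclado_algTree C)) => -[];[right|left]].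
by rewrite (bpC12 (lclado_algTree C')).
Qed.

(** [c x y p = x] says that p projects to the end x of the path from x to y, that is, p hangs on the
    side of x. *)
Lemma between_sides (T : Type) (c : T -> T -> T -> T) (tree : is_algTree c) x y p q :
  x <> y -> c x y p = x -> c x y q = y -> c p q x = x /\ c p q y = y.
Proof.
move=> xy hp hq.
have h1 : c x p q = x.
  by apply: (apart_beyond tree xy); clear -hp hq tree; by_halfspaces tree.
have h2 : c y q p = y.
  by apply: (apart_beyond tree (nesym xy)); clear -hp hq tree; by_halfspaces tree.
by split; [clear -h1 tree|clear -h2 tree]; by_halfspaces tree.
Qed.

Lemma same_side (T : Type) (c : T -> T -> T -> T) (tree : is_algTree c) x y p q b :
  c x y p = x -> c x y q = x -> c x y b = b -> c p q b = b -> b = x.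
Proof. by move=> h1 h2 h3 h4; by_halfspaces tree. Qed.

(** * Uniqueness of grafts *)

Section graft.
Context {m : nat} (C : lcladogram m) (u b : vertex C).
Notation c := (@lclado_bp m C).
Notation kept := (~` [set u; b]).
Hypothesis lu : leaf c u.

Lemma graft_leaf (C' : lcladogram m) z1 z2 f :
  @graft m C C' u b z1 z2 f -> leaf (@lclado_bp m C') (f u).
Proof.
move=> [[_ fl] _ _ _ _]; have [i <-] := leaf_label lu.
by rewrite fl; exact: label_leaf.
Qed.

Section uniqueness.
Context (z1 z2 : vertex C) (C' C'' : lcladogram m).
Variables (f : vertex C -> vertex C') (g : vertex C -> vertex C'').
Hypotheses (fG : graft u b z1 z2 f) (gG : graft u b z1 z2 g).
Notation c' := (@lclado_bp m C').
Notation c'' := (@lclado_bp m C'').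
Let t' : is_algTree c' := lclado_algTree C'.
Let t'' : is_algTree c'' := lclado_algTree C''.

(** If q hangs on the side of [z1], the path from b to q runs through [z1], so r lies between [z1]
    and q. This is a relation among kept vertices, which f reflects and g preserves. *)
Lemma graft_between_side q r : kept q -> kept r -> c z1 z2 q = z1 ->
  c' (f b) (f q) (f r) = f r -> c'' (g b) (g q) (g r) = g r.
Proof.
move: (fG) (gG) => [[fbij fl] _ fhom [z12 k1 k2 side] fb] [_ _ ghom _ gb] kq kr qz h.
have finj := bij_inj fbij.
have fz12 : f z1 <> f z2 by move/finj.
have fq : c' (f z1) (f z2) (f q) = f z1 by rewrite -fhom// qz.
have [rz|rz] := side _ kr; last first.
  exfalso; have fr : c' (f z1) (f z2) (f r) = f z2 by rewrite -fhom// rz.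
  have [h1 h2] := between_sides t' fz12 fq fr.
  have : f r = f b by clear -fb h h1 h2 t'; by_halfspaces t'.
  by move/finj => rb; apply: kr; right.
have fr : c' (f z1) (f z2) (f r) = f z1 by rewrite -fhom// rz.
have h1 : c' (f z1) (f q) (f r) = f r by clear -fb fq fr h t'; by_halfspaces t'.
have h2 : c z1 q r = r by apply: finj; rewrite fhom.
have gq : c'' (g z1) (g z2) (g q) = g z1 by rewrite -ghom// qz.
have gr : c'' (g z1) (g z2) (g r) = g z1 by rewrite -ghom// rz.
have h3 : c'' (g z1) (g q) (g r) = g r by rewrite -ghom// h2.
by clear -gb gq gr h3 t''; by_halfspaces t''.
Qed.

End uniqueness.

Section uniqueness.
Context (z1 z2 : vertex C) (C' C'' : lcladogram m).
Variables (f : vertex C -> vertex C') (g : vertex C -> vertex C'').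
Hypotheses (fG : graft u b z1 z2 f) (gG : graft u b z1 z2 g).
Notation c' := (@lclado_bp m C').
Notation c'' := (@lclado_bp m C'').
Let tree : is_algTree c := lclado_algTree C.
Let t' : is_algTree c' := lclado_algTree C'.
Let t'' : is_algTree c'' := lclado_algTree C''.

Lemma graft_between_kept q r : kept q -> kept r ->
  c' (f b) (f q) (f r) = f r -> c'' (g b) (g q) (g r) = g r.
Proof.
move=> kq kr; have [_ _ _ [_ _ _ side] _] := fG; have [qz|qz] := side _ kq.
  exact: (graft_between_side fG gG).
apply: (graft_between_side (graft_sym fG) (graft_sym gG)) => //.
by rewrite (bpC12 tree).
Qed.

(** The new branch point lies between p and q exactly if they hang on different sides of the edge,
    which is visible in the pruned tree. *)
Lemma graft_between_new p q : kept p -> kept q ->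
  c' (f p) (f q) (f b) = f b -> c'' (g p) (g q) (g b) = g b.
Proof.
move: (fG) (gG) => [[fbij fl] _ fhom [z12 k1 k2 side] fb] [[gbij _] _ ghom _ gb].
move=> kp kq h; have finj := bij_inj fbij; have ginj := bij_inj gbij.
have gz12 : g z1 <> g z2 by move/ginj.
have fE v z : kept v -> c z1 z2 v = z -> c' (f z1) (f z2) (f v) = f z.
  by move=> kv <-; rewrite fhom.
have gE v z : kept v -> c z1 z2 v = z -> c'' (g z1) (g z2) (g v) = g z.
  by move=> kv <-; rewrite ghom.
have final x y : c'' (g z1) (g z2) (g x) = g z1 -> c'' (g z1) (g z2) (g y) = g z2 ->
    c'' (g x) (g y) (g b) = g b.
  move=> hx hy; have [h1 h2] := between_sides t'' gz12 hx hy.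
  by clear -h1 h2 gb t''; by_halfspaces t''.
have [pz|pz] := side _ kp; have [qz|qz] := side _ kq.
- have := same_side t' (fE _ _ kp pz) (fE _ _ kq qz) fb h.
  by move/finj => bz; exfalso; apply: k1; right.
- by apply: final; [exact: gE pz|exact: gE qz].
- by rewrite (bpC12 t''); apply: final; [exact: gE qz|exact: gE pz].
- have fb' : c' (f z2) (f z1) (f b) = f b by rewrite (bpC12 t').
  have swap v : c' (f z1) (f z2) v = c' (f z2) (f z1) v by rewrite (bpC12 t').
  have hp := fE _ _ kp pz; have hq := fE _ _ kq qz; rewrite !swap in hp hq.
  have := same_side t' hp hq fb' h.
  by move/finj => bz; exfalso; apply: k2; right.
Qed.

(** Paths from the leaf u run through its neighbour b, so everything reduces to paths among kept
    vertices and b. *)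
Lemma graft_between p q r :
  c' (f p) (f q) (f r) = f r -> c'' (g p) (g q) (g r) = g r.
Proof.
move: (fG) (gG) => [[fbij fl] [ub fub] fhom _ _] [[gbij _] [_ gub] ghom _ _].
have finj := bij_inj fbij; have ginj := bij_inj gbij.
have flu := graft_leaf fG; have glu := graft_leaf gG.
have [<-|pr] := pselect (p = r); first by rewrite (bp_same2 t'').
have [<-|qr] := pselect (q = r); first by rewrite (bp_two t'').
move: p q pr qr.
suff H p q : p <> r -> q <> r -> q <> u ->
    c' (f p) (f q) (f r) = f r -> c'' (g p) (g q) (g r) = g r.
  move=> p q pr qr; have [qu|qu] := pselect (q = u); last exact: H.
  have [pu|pu] := pselect (p = u).
    by rewrite qu pu (bp_same1 t') => /finj ur; rewrite qu in qr.
  by rewrite (bpC12 t') (bpC12 t''); exact: H.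
move=> pr qr qu h.
have ru : r <> u.
  by move=> ru; rewrite ru in pr qr h; have [/finj|/finj] := leaf_end t' flu h => /esym.
have fbq : c' (f u) (f q) (f b) = f b by apply: leaf_edge => //; move/finj.
have gbq : c'' (g u) (g q) (g b) = g b by apply: leaf_edge => //; move/ginj.
have [rb|rb] := pselect (r = b).
  subst r; have [->//|pu] := pselect (p = u).
  by apply: graft_between_new h => -[].
have H x : x <> r -> x <> u -> c' (f x) (f q) (f r) = f r -> c'' (g x) (g q) (g r) = g r.
  move=> xr xu {}h; have kr : kept r by case.
  have [xb|xb] := pselect (x = b); have [qb|qb] := pselect (q = b).
  - by move: h; rewrite xb qb (bp_same1 t') => /finj /esym.
  - by rewrite xb in h *; apply: graft_between_kept h => -[].
  - rewrite qb (bpC12 t'') in h *; rewrite (bpC12 t') in h.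
    by apply: graft_between_kept h => // -[].
  - rewrite -ghom; [|by case..].
    by congr g; apply: finj; rewrite fhom// => -[].
have [pu|pu] := pselect (p = u); last exact: H.
subst p; have fbr : c' (f u) (f r) (f b) = f b by apply: leaf_edge => //; move/finj.
have h1 : c' (f b) (f q) (f r) = f r by clear -fbr h t'; by_halfspaces t'.
have h2 : c'' (g b) (g q) (g r) = g r.
  by apply: H => //; [exact/nesym|case: ub => /nesym].
by clear -gbq h2 t''; by_halfspaces t''.
Qed.

(** Makes the result of a move single-valued. Comparison with C as a graft of itself also shows that
    regrafting u at its old place gives back C. *)
Lemma graft_unique : lclado_equiv C' C''.
Proof.
move: (fG) (gG) => [[fbij fl] _ _ _ _] [[gbij gl] _ _ _ _].
have [f' f'K f'K'] := fbij; apply/asboolP; exists (g \o f'); split.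
- by apply: bij_comp => //; exists f.
- apply: (between_hom t' t'') => x y z xyz /=; apply: graft_between.
  by rewrite !f'K'.
- by move=> i /=; rewrite -fl f'K gl.
Qed.

End uniqueness.

(** The vertex map is forced by the labels: u is a label, kept vertices are spanned by the labels
    other than u, and b is the only vertex left for a bijection. *)
Lemma graft_eq z1 z2 w1 w2 (C' : lcladogram m) f g :
  @graft m C C' u b z1 z2 f -> @graft m C C' u b w1 w2 g -> f = g.
Proof.
move=> [[fbij fl] [ub _] fhom [_ /not_orP[z1u z1b] _ _] _].
move=> [[gbij gl] _ ghom _ _].
have bb : branch c b by exact: edge_of_leaf_branch ub z1u z1b.
have label_kept i : lclado_label C i <> u -> kept (lclado_label C i).
  move=> iu [//|ib]; apply: (leaf_not_branch (lclado_algTree C) (label_leaf C i)).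
  by rewrite ib.
have fg_kept v : kept v -> f v = g v.
  move=> /not_orP[vu vb]; have [i [j [k [iu ju ku <-]]]] := kept_span lu ub vu vb.
  by rewrite fhom ?ghom ?fl ?gl//; exact: label_kept.
have fgu : f u = g u by have [i <-] := leaf_label lu; rewrite fl gl.
have fgb : f b = g b.
  have [g' gK gK'] := gbij; have gw : g (g' (f b)) = f b by [].
  have finj := bij_inj fbij; case: ub => ub _.
  have [wu|wu] := pselect (g' (f b) = u).
    by move: gw; rewrite wu -fgu => /finj.
  have [wb|wb] := pselect (g' (f b) = b); first by rewrite -gw wb.
  have kw : kept (g' (f b)) by case.
  by exfalso; apply: wb; apply: finj; rewrite fg_kept.
apply/funext => v; have [->//|vu] := pselect (v = u).
have [->//|vb] := pselect (v = b).
by apply: fg_kept => -[].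
Qed.

(** If x' and y' hung on the same side of the path from x to y, then [f b], lying between both
    pairs, would be the image of x or of y. So they hang on different sides, x and y lie on the path
    from x' to y', and adjacency after pruning identifies the pairs. *)
Lemma graft_pair x y x' y' (C' : lcladogram m) f :
  @graft m C C' u b x y f -> @graft m C C' u b x' y' f ->
  (x = x' /\ y = y') \/ (x = y' /\ y = x').
Proof.
move=> fG fG'; move: (fG) (fG').
move=> [[fbij _] _ fhom [xy kx ky side] fb] [_ _ _ [_ kx' ky' side'] fb'].
have finj := bij_inj fbij; have t := lclado_algTree C; have t' := lclado_algTree C'.
have fE v z : kept v -> c x y v = z -> @lclado_bp m C' (f x) (f y) (f v) = f z.
  by move=> kv <-; rewrite fhom.
have both : c x' y' x = x -> c x' y' y = y -> (x = x' /\ y = y') \/ (x = y' /\ y = x').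
  move=> hx hy; have := side' _ kx; have := side' _ ky; rewrite hx hy.
  by move=> [h1|h1] [h2|h2]; [case: xy; congruence|right|left|case: xy; congruence].
have [h1|h1] := side _ kx'; have [h2|h2] := side _ ky'.
- have := same_side t' (fE _ _ kx' h1) (fE _ _ ky' h2) fb fb'.
  by move/finj => bx; case: kx; right.
- have [] := between_sides t xy h1 h2; exact: both.
- have [] := between_sides t xy h2 h1; rewrite !(bpC12 t y' x'); exact: both.
- have swap v : @lclado_bp m C' (f x) (f y) v = @lclado_bp m C' (f y) (f x) v.
    by rewrite (bpC12 t').
  have hp := fE _ _ kx' h1; have hq := fE _ _ ky' h2; rewrite swap in fb.
  rewrite !swap in hp hq; have := same_side t' hp hq fb fb'.
  by move/finj => bx; case: ky; right.
Qed.

(** C is a graft of itself: u sits between the two other neighbours of b. This describes both the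
    old place of u and the edge created by suppressing b. *)
Lemma branch_neighbours : edge c u b -> branch c b ->
  exists z1 z2, [/\ edge c b z1, edge c b z2 & @graft m C C u b z1 z2 id].
Proof.
move=> ub bb; have t := lclado_algTree C; have [y1 [y2 [y3 [y1b y2b y3b [y12 y13 y23]]]]] := branchP t bb.
have y123 := apart_bp t y12 y13 y23.
have ub' : u <> b by case: ub.
(* Two of the three directions at b are apart from u. *)
have [w1 [w2 [w1b w2b [w12 uw1 uw2]]]] : exists w1 w2, [/\ w1 <> b, w2 <> b
    & [/\ c b w1 w2 = b, c b u w1 = b & c b u w2 = b]].
  by have [[h1 h2]|[h1 h2]|[h1 h2]] := apart_two t u y123;
    [exists y1, y2|exists y1, y3|exists y2, y3].
have [z1 z1w e1] := neighbour w1b; have [z2 z2w e2] := neighbour w2b.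
have z12 : c b z1 z2 = b by exact: (component_apart t w12).
have uz1 : c b u z1 = b.
  by apply: (component_apart t uw1) z1w; exact: component_refl.
have uz2 : c b u z2 = b.
  by apply: (component_apart t uw2) z2w; exact: component_refl.
have z1b : z1 <> b by case: e1 => /nesym.
have z2b : z2 <> b by case: e2 => /nesym.
have ne z : z <> b -> c b u z = b -> z <> u.
  by move=> zb h zu; apply: ub'; rewrite -h zu (bp_two t).
exists z1, z2; split=> //; split=> //.
- by split=> //; exists id.
- split.
  + by move=> h; apply: z1b; rewrite -z12 -h (bp_two t).
  + by move=> [|//]; exact: ne.
  + by move=> [|//]; exact: ne.
  move=> p /not_orP[pu pb].
  have up : c u p b = b by exact: leaf_edge ub pu.
  have nb z : edge c b z -> c b z p <> b -> c b z p = z.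
    move=> [_ E] h; have : segment c b z (c b z p) by exact: (bp_idem t).
    by rewrite E => -[].
  have far z w : z <> b -> edge c b z -> c b z w = b -> c b z p <> b -> c z w p = z.
    move=> zb e zw zp; rewrite (bpC23 t); apply: (apart_beyond t (y := b)) => //.
      by have := nb _ e zp; clear -t => h; by_halfspaces t.
    by clear -t zw; by_halfspaces t.
  have [h1|h1] := pselect (c b z1 p = b); last by left; exact: far.
  have [h2|h2] := pselect (c b z2 p = b); last first.
    right; rewrite (bpC12 t); apply: far => //.
    by rewrite (bpC23 t).
  (* Otherwise u, z1, z2 and p would lie in four different directions at b. *)
  exfalso; have := @lclado_binary m C.
  move/(binary_no4 t) => /(_ b u z1 z2 p ub' z1b z2b pb uz1 uz2 z12); apply=> //.
  by rewrite (bpC t).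
- by rewrite -(bpC t).
Qed.

(** An edge that touches b is absorbed, when b is suppressed, into the edge between the other two
    neighbours of b; both [C'] and C are then grafts of u into that edge. *)
Lemma spr_graft x y (C' : lcladogram m) : edge c x y -> u <> x -> u <> y ->
  spr u x y C' -> edge c u b -> exists f : vertex C -> vertex C',
  ([/\ x <> b, y <> b & graft u b x y f] \/
   ((x = b \/ y = b) /\ exists z1 z2, graft u b z1 z2 f /\ @graft m C C u b z1 z2 id)).
Proof.
move=> xy ux uy [f [b' [[fbij fl] [ub' fub'] fhom fb]]] ub.
have E := leaf_edge_uniq lu ub ub'; subst b'.
exists f; have [xyb|nxy] := boolP ((x == b) || (y == b)); last first.
  have /norP[/eqP xb /eqP yb] := nxy; left; split=> //; split=> //.
    split; first by case: xy.
    - by case=> [/esym|].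
    - by case=> [/esym|].
    move=> p _; case: xy => _ E; have : segment c x y (c x y p) by exact: (bp_idem (lclado_algTree C)).
    by rewrite E => -[]; [left|right].
  apply: fb; rewrite ?(negPf nxy); [by left|by right|by case: xy].
right; split; first by case/orP: xyb => /eqP; [left|right].
have bb : branch c b.
  case: xy => xy _.
  have [xb|xb] := pselect (x = b).
    by apply: (edge_of_leaf_branch lu ub (v := y)); [exact/nesym|move=> yb; apply: xy; rewrite xb yb].
  by apply: (edge_of_leaf_branch lu ub (v := x)); [exact/nesym|].
have [z1 [z2 [e1 e2 G]]] := branch_neighbours ub bb.
exists z1, z2; split=> //; have [_ _ _ [z12 k1 k2 side] _] := G.
split=> //; apply: fb => //; rewrite xyb; split=> //.
  by move/not_orP: k1 => [].
by move/not_orP: k2 => [].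
Qed.

End graft.

Section reverse.
Context {m : nat} (C C' : lcladogram m) (u : vertex C).
Notation c := (@lclado_bp m C).
Notation c' := (@lclado_bp m C').
Let t : is_algTree c := lclado_algTree C.
Let t' : is_algTree c' := lclado_algTree C'.

(** The way back grafts u between the images of the former neighbours of b. These images are
    adjacent in [C'] unless [f b] lies between them, but then [C'] and C are grafts into the same
    edge and hence isomorphic. *)
Lemma graft_reverse b x y (f : vertex C -> vertex C') :
  leaf c u -> graft u b x y f -> ~ lclado_equiv C' C ->
  exists x' y' : vertex C', [/\ (x' < y')%N, edge c' x' y', f u <> x', f u <> y'
    & spr (f u) x' y' C].
Proof.
move=> lu fG CC'; have flu := graft_leaf lu fG.
have [[fbij fl] [ub fub] fhom [xy /not_orP[xu xb] ky side] fb] := fG.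
have finj := bij_inj fbij.
have bb : branch c b by exact: (edge_of_leaf_branch lu ub xu).
have [z1 [z2 [_ _ G]]] := branch_neighbours lu ub bb.
have [g fK gK] := fbij.
have key w1 w2 : @graft m C C u b w1 w2 id -> (f w1 < f w2)%N ->
    exists x' y' : vertex C', [/\ (x' < y')%N, edge c' x' y', f u <> x', f u <> y'
    & spr (f u) x' y' C].
  move=> G' lt; have [_ _ _ [w12 k1 k2 wside] wb] := G'.
  have [/not_orP[w1u w1b] /not_orP[w2u w2b]] := conj k1 k2.
  exists (f w1), (f w2); split=> //.
  - split; first by move/finj.
    apply/seteqP; split=> [r|r [->|->]]; last first.
    + exact: (bp_two t').
    + exact: (bp_same2 t').
    rewrite -(gK r); move: (g r) => {}r; rewrite /segment /= => h.
    have [ru|ru] := pselect (r = u).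
      by rewrite ru in h *; exact: (leaf_end t' flu h).
    have [rb|rb] := pselect (r = b).
      exfalso; apply: CC'; apply: (@graft_unique m C u b lu w1 w2 C' C f id) => //.
      by split=> //; rewrite -rb.
    have kr : (~` [set u; b]) r by case.
    have hr : c w1 w2 r = r by apply: finj; rewrite fhom.
    by have := wside _ kr; rewrite hr => -[->|->]; [left|right].
  - by move/finj/esym.
  - by move/finj/esym.
  exists g, (f b); split=> //.
  - split; first by exists f.
    by move=> i; rewrite -fl fK.
  - by rewrite !fK.
  - move=> p q r kp kq kr.
    have kept z : (~` [set f u; f b]) z -> (~` [set u; b]) (g z).
      by move=> kz [zu|zb]; apply: kz; [left|right]; rewrite -[z]gK ?zu ?zb.
    by rewrite -[in LHS](gK p) -[in LHS](gK q) -[in LHS](gK r) -fhom ?fK//; exact: kept.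
  move=> p q; rewrite !(inj_eq finj) (negPf (introN eqP w1b)) (negPf (introN eqP w2b)) /=.
  by move=> [->|->] [->|->] // _; rewrite !fK // (bpC12 t).
have [lt|lt|E] := ltngtP (f z1) (f z2).
- exact: key lt.
- by apply: key lt; exact: graft_sym.
have [_ _ _ [z12 _ _ _] _] := G; exfalso; apply: z12.
by apply: finj; exact: val_inj.
Qed.

End reverse.

(** * Symmetry of the Aldous rates *)

Section generator.
Context {m : nat}.
Implicit Types t : cladograms m.
Notation tree_of t := (repr (val t)).
Notation c_ t := (@lclado_bp m (repr (val t))).

(** Describes the outcome of a move as a relation, free of the choice and of the default value in
    [move_leaf]. *)
Definition movable (t t' : cladograms m) (i : 'I_m)
    (e : vertex (tree_of t) * vertex (tree_of t)) : Prop :=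
  let u := lclado_label (tree_of t) i in
  [/\ (e.1 < e.2)%N, edge (c_ t) e.1 e.2, u <> e.1, u <> e.2
    & spr u e.1 e.2 (tree_of t')].

Arguments movable t t' i e : clear implicits.

(** Since the move changes the cladogram, its edge does not touch the neighbour of u, and the graft
    goes into that very edge. *)
Lemma movable_graft t t' i e : t <> t' -> movable t t' i e ->
  let u := lclado_label (tree_of t) i in
  exists b (f : vertex (tree_of t) -> vertex (tree_of t')),
    edge (c_ t) u b /\ graft u b e.1 e.2 f.
Proof.
move=> tt' [lt ee ux uy sp] u.
have lu : leaf (c_ t) u by exact: label_leaf.
have [_ [b [_ [ub _] _ _]]] := sp.
have [f [[_ _ G]|[_ [z1 [z2 [G1 G2]]]]]] := spr_graft lu ee ux uy sp ub.
  by exists b, f.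
case: tt'; apply: cladograms_eq; rewrite lclado_equiv_sym.
exact: (graft_unique lu G1 G2).
Qed.

Lemma movable_uniq t t' i e e' : t <> t' -> movable t t' i e ->
  movable t t' i e' -> e = e'.
Proof.
move=> tt' mv mv'; have lu := label_leaf (tree_of t) i.
have [b [f [ub G]]] := movable_graft tt' mv.
have [b' [f' [ub' G']]] := movable_graft tt' mv'.
have bb := leaf_edge_uniq lu ub ub'; subst b'.
have ff := graft_eq lu G G'; subst f'.
have [lt _ _ _ _] := mv; have [lt' _ _ _ _] := mv'.
case: e e' {mv mv'} G G' lt lt' => [x y] [x' y'] /= G G' lt lt'.
have [[-> ->]//|[E1 E2]] := graft_pair G G'; subst x' y'.
by move: lt lt'; rewrite ltnNge => /negP h /ltnW.
Qed.

Lemma movable_target_uniq t t' t'' i e : t <> t' ->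
  movable t t' i e -> movable t t'' i e -> t' = t''.
Proof.
move=> tt' mv [lt ee ux uy sp]; have lu := label_leaf (tree_of t) i.
have [b [f [ub G]]] := movable_graft tt' mv; apply: cladograms_eq.
have [g [[_ _ G']|[xyb _]]] := spr_graft lu ee ux uy sp ub.
  exact: (graft_unique lu G G').
have [_ _ _ [_ /not_orP[_ xb] /not_orP[_ yb] _] _] := G.
by case: xyb.
Qed.

Lemma movable_sym t t' i e : t <> t' -> movable t t' i e ->
  exists e', movable t' t i e'.
Proof.
move=> tt' mv; have lu := label_leaf (tree_of t) i.
have [b [f [ub G]]] := movable_graft tt' mv.
have [|x' [y' [lt ee fux fuy sp]]] := graft_reverse lu G.
  by move/cladograms_eq/esym.
have [[_ fl] _ _ _ _] := G; rewrite fl in sp fux fuy.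
by exists (x', y').
Qed.

(** The assumption [t <> t'] excludes the default value t of [xget], and uniqueness of the target
    makes the chosen value equal to t'. *)
Lemma move_leafE t t' i (e : vertex (tree_of t) * vertex (tree_of t)) : t <> t' ->
  let u := lclado_label (tree_of t) i in
  (e.1 < e.2)%N -> edge (c_ t) e.1 e.2 ->
  move_leaf u e.1 e.2 = t' <-> movable t t' i e.
Proof.
move=> tt' u lt ee; rewrite /move_leaf.
have [uxy|/norP[/eqP ux /eqP uy]] := boolP ((u == e.1) || (u == e.2)).
  split=> // -[_ _ ux uy _]; by case/orP: uxy => /eqP.
set Q := [set t' | _]; split=> [E|mv].
  split=> //; have [Qt|nQ] := pselect (exists t'', Q t'').
    have [t'' Qt''] := Qt; have := xgetPex t Qt.
    by rewrite E.
  by case: tt'; rewrite -E xgetPN// => t'' Qt; apply: nQ; exists t''.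
have Qt' : Q t' by case: mv.
have := xgetPex t (ex_intro _ t' Qt'); set s := xget t Q => Qs.
by apply/esym; apply: (movable_target_uniq tt' mv).
Qed.

(** For each leaf at most one edge leads to t', so the rate is the number of labels that can be
    moved, and that count is symmetric because each move has a reverse by the same label. *)
Lemma aldous_generator_indic (R : realType) t t' : t <> t' ->
  aldous_generator (\1_[set t'] : _ -> R) t =
  \sum_i (`[< exists e, movable t t' i e >])%:R.
Proof.
move=> tt'; rewrite /aldous_generator.
rewrite [RHS](partition_big (lclado_label (tree_of t))
    (fun u => `[< leaf (c_ t) u >])) /=; last first.
  by move=> i _; apply/asboolP; exact: label_leaf.
apply: eq_bigr => u /asboolP/leaf_label[i <-].
rewrite (big_pred1 i); last first.
  by move=> j /=; rewrite (inj_eq (@cladogram_inj m t)).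
have term (e : vertex (tree_of t) * vertex (tree_of t)) :
    (e.1 < e.2)%N && `[< edge (c_ t) e.1 e.2 >] ->
    (\1_[set t'] (move_leaf (lclado_label (tree_of t) i) e.1 e.2) - \1_[set t'] t : R)
    = (`[< movable t t' i e >])%:R.
  move=> /andP[lt /asboolP ee]; rewrite !indicE.
  rewrite (_ : t \in [set t'] = false) ?subr0; last by apply/negbTE/negP; rewrite inE.
  congr (nat_of_bool _)%:R; apply/idP/asboolP.
    by rewrite inE /= => /move_leafE; apply.
  by move=> mv; rewrite inE /=; apply/move_leafE.
rewrite (eq_bigr _ term).
have [[e mv]|nmv] := pselect (exists e, movable t t' i e).
  rewrite (bigD1 e) /=; last by case: mv => lt ee _ _ _; rewrite lt asboolT.
  rewrite big1 ?addr0; last first.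
    move=> e' /andP[_ /eqP e'e]; case: asboolP => // mv'.
    by case: e'e; exact: (movable_uniq tt' mv' mv).
  by rewrite !asboolT//; exists e.
rewrite big1; first by rewrite asboolF.
by move=> e _; rewrite asboolF// => mv; apply: nmv; exists e.
Qed.

Lemma aldous_generator_sym (R : realType) t t' :
  aldous_generator (\1_[set t'] : _ -> R) t = aldous_generator \1_[set t] t'.
Proof.
have [->//|tt'] := pselect (t = t').
rewrite !aldous_generator_indic//; last exact/nesym.
apply: eq_bigr => i _; congr (nat_of_bool _)%:R; apply/asboolP/asboolP => -[e].
  exact: movable_sym.
exact/movable_sym/nesym.
Qed.

Lemma aldous_generator_sum (R : realType) (s : seq (cladograms m))
  (phi : cladograms m -> R) t : uniq s -> (forall t, t \in s) ->
  aldous_generator phi t = \sum_(t' <- s) phi t' * aldous_generator \1_[set t'] t.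
Proof.
move=> us sP; rewrite /aldous_generator.
have phiE x : phi x = \sum_(t' <- s) phi t' * \1_[set t'] x.
  rewrite (bigD1_seq x)//= indicE mem_set// mulr1 big1 ?addr0// => y /negP yx.
  by rewrite indicE memNset ?mulr0// => /= xy; apply: yx; rewrite xy.
under [RHS]eq_bigr do rewrite mulr_sumr.
rewrite [RHS]exchange_big /=; apply: eq_bigr => u _.
under [RHS]eq_bigr do rewrite mulr_sumr.
rewrite [RHS]exchange_big /=; apply: eq_bigr => e _.
rewrite [in LHS]phiE [X in _ - X]phiE -sumrB; apply: eq_bigr => y _.
by rewrite mulrBr.
Qed.

End generator.

(** * Measurability in the component topology *)

(** Pieces with at most one point, rather than a sequence of points, cover the case of an empty [D]
    without a default element. *)
Lemma countable_enum (U : Type) (D : set U) : countable D ->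
  exists D_ : nat -> set U, (forall n x y, D_ n x -> D_ n y -> x = y) /\
    \bigcup_n D_ n = D.
Proof.
move=> /pcard_leP[f]; exists (fun n => D `&` f @^-1` [set n]); split.
  move=> n x y [Dx fx] [Dy fy]; apply: (inj (f := f)); rewrite ?inE//.
  by move: fx fy => /= -> ->.
apply/seteqP; split=> [x [n _ []]//|x Dx].
by exists (f x).
Qed.

Lemma countable_bigcup_measurable (d : measure_display) (W : measurableType d)
  (U : Type) (D : set U) (F : U -> set W) : countable D ->
  (forall i, D i -> measurable (F i)) -> measurable (\bigcup_(i in D) F i).
Proof.
move=> /countable_enum[D_ [D1 <-]] mF.
rewrite bigcup_bigcup; apply: bigcup_measurable => n _.
have [[i Di]|nD] := pselect (exists i, D_ n i).
  rewrite (_ : D_ n = [set i]) ?bigcup_set1; first by apply: mF; exists n.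
  by apply/seteqP; split=> [j Dj|j ->//]; exact: D1 Dj Di.
rewrite (_ : D_ n = set0) ?bigcup_set0//.
by apply/seteqP; split=> // j Dj; apply: nD; exists j.
Qed.

Lemma countable_bigcup_null (d : measure_display) (W : measurableType d)
  (R : realType) (mu : measure W R) (U : Type) (D : set U) (F : U -> set W) :
  countable D ->
  (forall i, D i -> mu.-negligible (F i)) -> mu.-negligible (\bigcup_(i in D) F i).
Proof.
move=> /countable_enum[D_ [D1 <-]] nF.
rewrite bigcup_bigcup; apply: negligible_bigcup => n.
have [[i Di]|nD] := pselect (exists i, D_ n i).
  rewrite (_ : D_ n = [set i]) ?bigcup_set1; first by apply: nF; exists n.
  by apply/seteqP; split=> [j Dj|j ->//]; exact: D1 Dj Di.
rewrite (_ : D_ n = set0) ?bigcup_set0//; first exact: negligible_set0.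
by apply/seteqP; split=> // j Dj; apply: nD; exists j.
Qed.

(** * Countable separating families of components *)

Section order_separable.
Context (T : algTree).
Notation c := (@bp T).
Let tree : is_algTree c := algTreeP T.

Lemma component_open (x y : T) : x <> y -> open (component c x y).
Proof.
move=> xy; exists [set component c x y]; last exact: bigcup_set1.
move=> _ ->; exact: (finI_from1 (fun p : T * T => component c p.1 p.2) (i := (x, y))).
Qed.

Lemma component_measurable (x y : T) : x <> y ->
  measurable (component c x y : set (borel T)).
Proof. by move=> xy; apply: sub_sigma_algebra; exact: component_open. Qed.

Lemma component_dense (D : set T) x y : dense D -> y <> x ->
  exists2 d, D d & component c x y d.
Proof.
move=> dD yx; have [d [xd Dd]] : component c x y `&` D !=set0.
  by apply: dD; [exists y; exact: component_refl|apply: component_open; exact/nesym].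
by exists d.
Qed.

Lemma branch_dense (D : set T) x : dense D -> branch c x ->
  exists d1 d2 d3, [/\ D d1, D d2, D d3 & c d1 d2 d3 = x].
Proof.
move=> dD /(branchP tree)[y1 [y2 [y3 [y1x y2x y3x [y12 y13 y23]]]]].
have [d1 D1 h1] := component_dense dD y1x.
have [d2 D2 h2] := component_dense dD y2x.
have [d3 D3 h3] := component_dense dD y3x.
exists d1, d2, d3; split=> //; apply: (apart_bp tree).
- exact: (component_apart tree y12).
- exact: (component_apart tree y13).
- exact: (component_apart tree y23).
Qed.

Definition bp3 (D : set T) : set T :=
  (fun p => c p.1.1 p.1.2 p.2) @` (D `*` D `*` D).

Lemma bp3_countable D : countable D -> countable (bp3 D).
Proof.
move=> cD; apply: sub_countable (card_image_le _ _) _.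
by do 2!apply: countableX => //.
Qed.

Lemma branch_bp3 D : dense D -> branch c `<=` bp3 D.
Proof.
move=> dD x /(branch_dense dD)[d1 [d2 [d3 [D1 D2 D3 <-]]]].
by exists ((d1, d2), d3).
Qed.

Hypothesis sep : order_separable T.

Lemma branch_countable : countable (branch c).
Proof.
have [[D [cD dD]] _] := sep.
exact: sub_countable (subset_card_le (branch_bp3 dD)) (bp3_countable cD).
Qed.

(** Adjacent points are separated by the components along the countably many edges, other points by
    components at a vertex of the countable set [bp3 D] in a direction given by another such
    vertex. *)
Lemma separating_components : exists E : set (T * T), [/\ countable E,
  forall e, E e -> e.1 <> e.2
  & forall p q, (forall e, E e -> component c e.1 e.2 p <-> component c e.1 e.2 q) ->
    p = q].
Proof.
have [[D [cD dD]] cE] := sep.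
pose E1 := [set e : T * T | edge c e.1 e.2].
pose E2 := [set e : T * T | (bp3 D `*` bp3 D) e /\ e.1 <> e.2].
have D3 d : D d -> bp3 D d.
  by move=> Dd; exists ((d, d), d) => //=; rewrite (bp_two tree).
exists (\bigcup_(b in [set: bool]) if b then E1 else E2); split.
- apply: bigcup_countable; first exact: countableP.
  move=> [_|_]; first exact: cE.
  apply: (sub_countable (B := bp3 D `*` bp3 D)); first by apply: subset_card_le => e [].
  by apply: countableX; exact: bp3_countable.
- by move=> e [[] _] [].
move=> p q H; apply: contrapT => pq.
have qp : q <> p by exact/nesym.
have [pqE|npqE] := pselect (edge c p q).
  have := H (p, q); case; first by exists true.
  by move=> _ /(_ (component_refl tree qp)) [].
have [z [zp zq pqz]] : exists z, [/\ z <> p, z <> q & c p q z = z].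
  apply: contrapT => nz; apply: npqE; split=> //.
  apply/seteqP; split=> z; last by move=> [->|->]; [exact: bp_same2|exact: bp_two].
  rewrite /segment /= => pqz; apply: contrapT => /not_orP[zp zq].
  by apply: nz; exists z.
have O : (component c p q `&` component c q p) !=set0.
  exists z; split; split=> //.
    by rewrite pqz.
  by rewrite (bpC12 tree) pqz.
(* Some d in [D] branches off strictly between p and q. The point v where it does so is d itself or
   a branch point, and so belongs to [bp3 D] either way. *)
have [d [[[dp pd] [dq qd]] Dd]] := dD _ O (openI (component_open pq) (component_open qp)).
set v := c p q d.
have qd' : v <> q by rewrite /v (bpC12 tree).
have vd : bp3 D v.
  have [->|vd] := pselect (v = d); first exact: D3.
  apply: (branch_bp3 dD); apply: (branch3 tree (y1 := p) (y2 := q) (y3 := d)).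
  - exact/nesym.
  - exact/nesym.
  - exact/nesym.
  - by rewrite /v; clear; by_halfspaces (algTreeP T).
  - by rewrite /v; clear; by_halfspaces (algTreeP T).
  - by rewrite /v; clear; by_halfspaces (algTreeP T).
have [d2 Dd2 vd2] := component_dense dD (nesym pd : p <> v).
have d2v : d2 <> v by case: vd2.
have vpq : c v p q = v by rewrite /v; clear; by_halfspaces (algTreeP T).
have vd2p : component c v d2 p by exact: (componentC tree (nesym pd) vd2).
have Ee : (\bigcup_(b in [set: bool]) if b then E1 else E2) (v, d2).
  by exists false => //; split; [split => //; exact: D3|exact/nesym].
have [_ vd2q] := (H _ Ee).1 vd2p.
by apply: (separated_trans tree (y := d2)) vpq => //; case: vd2.
Qed.

End order_separable.

Section tree_valued.
Context (T : algTree) (sep : order_separable T).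
Notation c := (@bp T).
Let tree : is_algTree c := algTreeP T.
Context {d : measure_display} {W : measurableType d}.
Implicit Types F G H : W -> T.

(* Tree-valued maps that are measurable for the sigma-algebra generated by the
   components; that of the open sets may be larger, and the branch point map need
   not be measurable for it. *)
Definition tree_measurable F : Prop :=
  forall x y, x <> y -> measurable (F @^-1` component c x y).

Lemma tree_measurable_cst x : tree_measurable (fun=> x).
Proof.
move=> y z yz; have [h|h] := pselect (component c y z x).
  by rewrite (_ : _ @^-1` _ = setT)//; apply/seteqP; split.
by rewrite (_ : _ @^-1` _ = set0)//; apply/seteqP; split.
Qed.

Lemma measurable_fun_tree F :
  measurable_fun setT (F : W -> borel T) -> tree_measurable F.
Proof.
move=> mF x y xy; rewrite -[X in measurable X]setTI; apply: mF => //.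
exact: component_measurable.
Qed.

(** By [component_halfspace] the preimage of a component is the majority of its preimages under F, G
    and H. *)
Lemma tree_measurable_bp F G H : tree_measurable F -> tree_measurable G ->
  tree_measurable H -> tree_measurable (fun w => c (F w) (G w) (H w)).
Proof.
move=> mF mG mH x y xy.
have hS := component_halfspace tree (nesym xy).
set S := component c x y in hS *.
rewrite (_ : _ @^-1` _ = (F @^-1` S `&` G @^-1` S) `|` (F @^-1` S `&` H @^-1` S)
    `|` (G @^-1` S `&` H @^-1` S)).
  by apply: measurableU; [apply: measurableU|]; apply: measurableI;
    [apply: mF|apply: mG|apply: mF|apply: mH|apply: mG|apply: mH].
apply/seteqP; split=> w /=.
  move/asboolP; rewrite hS => /or3P[] /andP[/asboolP ? /asboolP ?];
  by [left; left|left; right|right].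
move=> h; apply/asboolP; rewrite hS; apply/or3P.
by case: h => [[[/asboolP -> /asboolP ->]|[/asboolP -> /asboolP ->]]|[/asboolP -> /asboolP ->]];
  [apply: Or31|apply: Or32|apply: Or33].
Qed.

(** Two values differ exactly if one of countably many components contains one of them only. *)
Lemma measurable_tree_eq F G : tree_measurable F -> tree_measurable G ->
  measurable [set w | F w = G w].
Proof.
move=> mF mG; have [E [cE Ene Esep]] := separating_components sep.
rewrite (_ : [set w | _] = ~` \bigcup_(e in E)
   ((F @^-1` component c e.1 e.2 `\` G @^-1` component c e.1 e.2) `|`
    (G @^-1` component c e.1 e.2 `\` F @^-1` component c e.1 e.2))).
  apply: measurableC; apply: countable_bigcup_measurable => // e /Ene ene.
  by apply: measurableU; apply: measurableD; [apply: mF|apply: mG|apply: mG|apply: mF].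
apply/seteqP; split=> w /=.
  by move=> FG [e _]; rewrite /= FG => -[[]|[]].
move=> h; apply: Esep => e Ee; split=> h1; apply: contrapT => h2; apply: h.
  by exists e => //; left.
by exists e => //; right.
Qed.

Lemma measurable_tree_mem F (D : set T) : countable D -> tree_measurable F ->
  measurable (F @^-1` D).
Proof.
move=> cD mF; rewrite (_ : _ @^-1` _ = \bigcup_(x in D) [set w | F w = x]).
  apply: countable_bigcup_measurable => // x _.
  by apply: measurable_tree_eq => //; exact: tree_measurable_cst.
apply/seteqP; split=> [w Dw|w [x Dx /= Fw]]; first by exists (F w).
by rewrite /preimage /= Fw.
Qed.

End tree_valued.

(** * Product measures *)

Section power_measure.
Context {d : measure_display} {T : measurableType d} {R : realType}.
Variable mu : probability T R.

Lemma product_probabilityE (d1 d2 : measure_display) (T1 : measurableType d1)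
    (T2 : measurableType d2) (m1 : probability T1 R) (m2 : probability T2 R) A B :
  measurable A -> measurable B -> (m1 \x m2)%E (A `*` B) = (m1 A * m2 B)%E.
Proof. exact: product_measure1E. Qed.

Lemma product_null_xsection (d1 d2 : measure_display) (T1 : measurableType d1)
    (T2 : measurableType d2) (m1 : probability T1 R) (m2 : probability T2 R)
    (B : set (T1 * T2)) :
  (forall x, m2 (xsection B x) = 0%E) -> (m1 \x m2)%E B = 0%E.
Proof. by move=> B0; apply: integral0_eq => x _; exact: B0. Qed.

Lemma product_null_ysection (d1 d2 : measure_display) (T1 : measurableType d1)
    (T2 : measurableType d2) (m1 : probability T1 R) (m2 : probability T2 R)
    (B : set (T1 * T2)) : measurable B ->
  (forall y, m1 (ysection B y) = 0%E) -> (m1 \x m2)%E B = 0%E.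
Proof.
move=> mB B0; have := indic_fubini_tonelli m1 m2 mB.
rewrite (indic_fubini_tonelli_FE _ mB) (indic_fubini_tonelli_GE _ mB).
rewrite [X in _ = X -> _]integral0_eq; last by move=> y _; exact: B0.
by [].
Qed.

Lemma power_measureS m (S : set (m.+1.-tuple T)) :
  power_measure mu m.+1 S = (mu \x power_measure mu m)%E (@Defs.cons_tuple _ T m @^-1` S).
Proof. by []. Qed.

Lemma power_measure_coord m (i : 'I_m) (A : set T) : measurable A ->
  power_measure mu m [set u | A (tnth u i)] = mu A.
Proof.
move=> mA; elim: m i => [[]//|m IH] i.
rewrite power_measureS.
have [j ->|->] := unliftP ord0 i.
  rewrite [X in (_ \x _)%E X](_ : _ = setT `*` [set u | A (tnth u j)]).
    rewrite product_probabilityE//; last first.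
      by rewrite -[X in measurable X]setTI; apply: measurable_tnth.
    by rewrite probability_setT mul1e IH.
  by apply/seteqP; split=> -[x u] /=; rewrite tnthS//; case.
rewrite [X in (_ \x _)%E X](_ : _ = A `*` setT).
  by rewrite product_probabilityE// probability_setT mule1.
by apply/seteqP; split=> -[x u] /=; rewrite tnth0//; case.
Qed.

Lemma power_measure_pair m (i j : 'I_m) (B : set (T * T)) : measurable B ->
  (mu \x mu)%E B = 0%E -> i != j ->
  power_measure mu m [set u | B (tnth u i, tnth u j)] = 0%E.
Proof.
move=> mB B0; elim: m i j => [[]//|m IH] i j ij.
rewrite power_measureS.
have [i' iE|iE] := unliftP ord0 i; have [j' jE|jE] := unliftP ord0 j.
- rewrite [X in (_ \x _)%E X](_ : _ = setT `*` [set u | B (tnth u i', tnth u j')]).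
    rewrite product_probabilityE//; last first.
      rewrite -[X in measurable X]setTI.
      by apply: (measurable_fun_pair (measurable_tnth i') (measurable_tnth j')).
    rewrite IH ?mule0//; apply: contra ij => /eqP ij.
    by rewrite iE jE ij.
  by apply/seteqP; split=> -[x u] /=; rewrite iE jE !tnthS//; case.
- have mB' : measurable ([set p | B (tnth p.2 i', p.1)] : set (T * m.-tuple T)).
    rewrite -[X in measurable X]setTI.
    apply: (measurable_fun_pair (f := fun p : T * m.-tuple T => tnth p.2 i')) => //.
    by apply: (measurableT_comp (measurable_tnth i')).
  rewrite [X in (_ \x _)%E X](_ : _ = [set p | B (tnth p.2 i', p.1)]).
    (* Here the coordinates come in the opposite order, so Tonelli exchanges sections of B in one
       variable for sections in the other. *)
    have := indic_fubini_tonelli mu mu mB.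
    rewrite (indic_fubini_tonelli_FE _ mB) (indic_fubini_tonelli_GE _ mB).
    rewrite [X in X = _ -> _](_ : _ = 0%E)// => E.
    rewrite [RHS]E; apply: eq_integral => x _ /=.
    rewrite -(power_measure_coord i'); last exact: measurable_ysection.
    by congr (power_measure _ _ _); apply/seteqP; split=> u;
      rewrite /xsection /ysection /= !inE.
  by apply/seteqP; split=> -[x u] /=; rewrite iE jE tnthS tnth0.
- rewrite [X in (_ \x _)%E X](_ : _ = [set p | B (p.1, tnth p.2 j')]).
    rewrite -[RHS]B0; apply: eq_integral => x _ /=.
    rewrite -(power_measure_coord j'); last exact: measurable_xsection.
    by congr (power_measure _ _ _); apply/seteqP; split=> u;
      rewrite /xsection /ysection /= !inE.
  by apply/seteqP; split=> -[x u] /=; rewrite iE jE tnthS tnth0.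
- by rewrite iE jE eqxx in ij.
Qed.

Lemma power_measure_box (A0 A1 A2 : set T) :
  measurable A0 -> measurable A1 -> measurable A2 ->
  power_measure mu 3 [set u | [/\ A0 (tnth u 0), A1 (tnth u 1) & A2 (tnth u 2%R)]]
  = (mu A0 * (mu A1 * mu A2))%E.
Proof.
move=> m0 m1 m2.
have mt n (i : 'I_n) A : measurable A -> measurable [set u : n.-tuple T | A (tnth u i)].
  by move=> mA; rewrite -[X in measurable X]setTI; apply: measurable_tnth.
have p2 : power_measure mu 2 [set u | A1 (tnth u 0) /\ A2 (tnth u 1)] = (mu A1 * mu A2)%E.
  rewrite power_measureS.
  rewrite [X in (_ \x _)%E X](_ : _ = A1 `*` [set u | A2 (tnth u 0)]); last first.
    apply/seteqP; split=> -[x u] /=; rewrite !(tnth_nth x) /=.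
      by [].
    by [].
  rewrite product_probabilityE//; last exact: mt.
  by rewrite power_measure_coord.
rewrite power_measureS.
rewrite [X in (_ \x _)%E X](_ : _ =
    A0 `*` [set u | A1 (tnth u 0) /\ A2 (tnth u 1)]); last first.
  apply/seteqP; split=> -[x u] /=; rewrite !(tnth_nth x) /=.
    by case.
  by case=> h0 [h1 h2].
rewrite product_probabilityE//; last by apply: measurableI; exact: mt.
by rewrite p2.
Qed.

End power_measure.

(** * Generic samples *)

Section mass.
Context {R : realType} (X : amtree R).
Notation c := (@bp X).
Notation mu := (amt_mu X).
Let tree : is_algTree c := algTreeP X.
Let sep : order_separable X := amt_order_separable X.
Notation tm F := (tree_measurable (T := X) F).

Lemma tm_tnth m (i : 'I_m) : tm (fun u : m.-tuple (borel X) => tnth u i).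
Proof. by apply: measurable_fun_tree; exact: measurable_tnth. Qed.

Lemma tm_comp (d d' : measure_display) (W : measurableType d) (W' : measurableType d')
  (F : W -> X) (g : W' -> W) : tm F -> measurable_fun setT g -> tm (F \o g).
Proof.
move=> mF mg x y xy; rewrite -[X in measurable X]setTI.
exact: (mg measurableT _ (mF x y xy)).
Qed.

Lemma tm_id : tm (fun x : borel X => x).
Proof. by apply: measurable_fun_tree; exact: measurable_id. Qed.

Lemma tm_fst (d : measure_display) (W : measurableType d) :
  tm (fun p : borel X * W => p.1).
Proof. by apply: measurable_fun_tree; exact: measurable_fst. Qed.

Lemma tm_snd (d : measure_display) (W : measurableType d) :
  tm (fun p : W * borel X => p.2).
Proof. by apply: measurable_fun_tree; exact: measurable_snd. Qed.

(** The points that branch off the path from p to q strictly between its ends. *)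
Definition between_open (p q : X) : set X := [set z | c p q z <> p /\ c p q z <> q].

Lemma measurable_section_null (K : set ((borel X * borel X) * borel X)) :
  measurable K -> measurable [set p | mu (xsection K p) = 0%E].
Proof.
move=> mK; have := measurable_fun_xsection mu mK.
move=> /(_ measurableT [set 0%E] (emeasurable_set1 _)); rewrite setTI.
exact.
Qed.

Definition thin_side : set (borel X * borel X) :=
  [set p | mu (component c p.1 p.2) = 0%E].

Definition thin_middle : set (borel X * borel X) :=
  [set p | mu (between_open p.1 p.2) = 0%E].

Let tm1 : tm (fun w : (borel X * borel X) * borel X => w.1.1).
Proof. by apply: (tm_comp (@tm_fst _ (borel X))); exact: measurable_fst. Qed.

Let tm2 : tm (fun w : (borel X * borel X) * borel X => w.1.2).
Proof. by apply: (tm_comp (@tm_snd _ (borel X))); exact: measurable_fst. Qed.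

Let tm3 : tm (fun w : (borel X * borel X) * borel X => w.2).
Proof. exact: tm_snd. Qed.

Lemma measurable_thin_side : measurable thin_side.
Proof.
pose K : set ((borel X * borel X) * borel X) :=
  [set w | component c w.1.1 w.1.2 w.2].
rewrite (_ : thin_side = [set p | mu (xsection K p) = 0%E]).
  apply: measurable_section_null; rewrite (_ : K = ~` [set w | w.2 = w.1.1] `&`
      ~` [set w | c w.1.1 w.1.2 w.2 = w.1.1])//.
  apply: measurableI; apply: measurableC; apply: (measurable_tree_eq sep) => //.
  exact: tree_measurable_bp.
by apply/seteqP; split=> p; rewrite /= xsectionE.
Qed.

Lemma measurable_thin_middle : measurable thin_middle.
Proof.
pose K : set ((borel X * borel X) * borel X) :=
  [set w | between_open w.1.1 w.1.2 w.2].
rewrite (_ : thin_middle = [set p | mu (xsection K p) = 0%E]).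
  apply: measurable_section_null; rewrite (_ : K =
      ~` [set w | c w.1.1 w.1.2 w.2 = w.1.1] `&`
      ~` [set w | c w.1.1 w.1.2 w.2 = w.1.2])//.
  by apply: measurableI; apply: measurableC; apply: (measurable_tree_eq sep) => //;
    exact: tree_measurable_bp.
by apply/seteqP; split=> p; rewrite /= xsectionE.
Qed.

Hypothesis atomless : forall x : X, mu [set x] = 0%E.

Lemma point_measurable (x : X) : measurable ([set x] : set (borel X)).
Proof. exact: (measurable_tree_eq sep tm_id (tree_measurable_cst x)). Qed.

Lemma point_negligible (x : X) : mu.-negligible ([set x] : set (borel X)).
Proof. by apply/negligibleP; [exact: point_measurable|exact: atomless]. Qed.

(** For fixed p, every component at p meets a countable dense set, so the null components have a
    null union; p itself is no atom. *)
Lemma thin_side_null : (mu \x mu)%E thin_side = 0%E.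
Proof.
have [[D [cD dD]] _] := sep.
apply: product_null_xsection => p; apply: measure_negligible.
  by apply: measurable_xsection; exact: measurable_thin_side.
apply: (negligibleS (A := [set p] `|` \bigcup_(d in
    [set d | D d /\ d <> p /\ mu (component c p d) = 0%E]) component c p d)).
  move=> x /xsectionP thin; have [->|xp] := pselect (x = p); [by left|right].
  have [d Dd xd] := component_dense dD xp.
  have E := component_eq tree xd.
  exists d; last exact: (componentC tree xp).
  by split=> //; split; [case: xd|rewrite -E].
apply: negligibleU; first exact: point_negligible.
apply: countable_bigcup_null.
  apply: (sub_countable (B := D)) => //.
  by apply: subset_card_le => d [].
move=> d [_ [dp d0]]; apply/negligibleP => //.
by apply: component_measurable; exact/nesym.
Qed.

(** For fixed p, the set [E] of bad partners is cut by the countably many components at p. Each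
    piece A is null because [A * A] is covered by the diagonal and two sets all of whose sections
    are null. *)
Lemma thin_middle_null : (mu \x mu)%E thin_middle = 0%E.
Proof.
have [[D [cD dD]] _] := sep.
apply: product_null_xsection => p; apply: measure_negligible.
  by apply: measurable_xsection; exact: measurable_thin_middle.
set E := xsection thin_middle p.
have mE : measurable E by apply: measurable_xsection; exact: measurable_thin_middle.
have mM : measurable ([set w | between_open p w.1 w.2] : set (borel X * borel X)).
  rewrite (_ : [set w | _] = ~` [set w | c p w.1 w.2 = p] `&`
      ~` [set w | c p w.1 w.2 = w.1])//.
  by apply: measurableI; apply: measurableC; apply: (measurable_tree_eq sep);
    try exact: tm_fst; try exact: tree_measurable_cst;
    apply: tree_measurable_bp; [exact: tree_measurable_cst|exact: tm_fst|exact: tm_snd|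
      exact: tree_measurable_cst|exact: tm_fst|exact: tm_snd].
have MS q : measurable ([set z | between_open p q z] : set (borel X)).
  have := measurable_xsection (q : borel X) mM.
  by rewrite xsectionE.
have component_null d : d <> p -> mu (E `&` component c p d) = 0%E.
  (* For q, q' in one component at p the point c p q q' is not p, so that if q and
     q' differ, then q' is in the middle of p, q or q in the middle of p, q'. *)
  move=> dp; set A := E `&` component c p d.
  have mA : measurable A.
    by apply: measurableI => //; apply: component_measurable; exact/nesym.
  pose diag : set (borel X * borel X) := [set w | w.1 = w.2].
  pose P1 : set (borel X * borel X) := (A `*` setT) `&` [set w | between_open p w.1 w.2].
  pose P2 : set (borel X * borel X) := (setT `*` A) `&` [set w | between_open p w.2 w.1].
  have sub : A `*` A `<=` diag `|` (P1 `|` P2).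
    move=> [q q'] [/= [Eq [qp dq]] [Eq' [q'p dq']]].
    have qq' : c p q q' <> p.
      by apply: (separated_trans tree (y := d)) => //; rewrite (bpC23 tree).
    have [E1|h1] := pselect (c p q q' = q); last by right; left.
    have [E2|h2] := pselect (c p q' q = q'); last first.
      right; right; split; first by split=> //; split.
      by split=> //=; rewrite (bpC23 tree).
    by left; rewrite /diag /= -[LHS]E1 -[RHS]E2 (bpC23 tree).
  have mdiag : measurable diag.
    by apply: (measurable_tree_eq sep); [exact: tm_fst|exact: tm_snd].
  have mP1 : measurable P1 by apply: measurableI => //; exact: measurableX.
  have mswap : measurable_fun setT (fun w : borel X * borel X => (w.2, w.1)).
    by apply: measurable_fun_pair; [exact: measurable_snd|exact: measurable_fst].
  have mP2 : measurable P2.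
    apply: measurableI; first exact: measurableX.
    rewrite -[X in measurable X]setTI.
    exact: (mswap measurableT _ mM).
  have slice q : A q -> mu (between_open p q) = 0%E by move=> [/xsectionP].
  have diag0 : (mu \x mu)%E diag = 0%E.
    apply: product_null_xsection => q; rewrite (_ : xsection _ _ = [set q])//.
    by apply/seteqP; split=> z; rewrite /xsection /= inE /diag /=.
  have P10 : (mu \x mu)%E P1 = 0%E.
    apply: product_null_xsection => q; have [Aq|nAq] := pselect (A q).
      rewrite -[RHS](slice q Aq); congr (mu _); apply/seteqP.
      by split=> z; rewrite /xsection /= inE /P1 /=; [case|split].
    rewrite (_ : xsection _ _ = set0) ?measure0//; apply/seteqP.
    by split=> // z; rewrite /xsection /= inE /P1 /= => -[[]].
  have P20 : (mu \x mu)%E P2 = 0%E.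
    apply: product_null_ysection => // q; have [Aq|nAq] := pselect (A q).
      rewrite -[RHS](slice q Aq); congr (mu _); apply/seteqP.
      by split=> z; rewrite /ysection /= inE /P2 /=; [case|split].
    rewrite (_ : ysection _ _ = set0) ?measure0//; apply/seteqP.
    by split=> // z; rewrite /ysection /= inE /P2 /= => -[[]].
  have AA : (mu A * mu A = 0)%E.
    rewrite -product_probabilityE//; apply: measure_negligible.
      exact: measurableX.
    apply: (negligibleS sub); apply: negligibleU; first exact/negligibleP.
    by apply: negligibleU; exact/negligibleP.
  by move/eqP: AA; rewrite mule_eq0 orbb => /eqP.
apply: (negligibleS (A := [set p] `|` \bigcup_(d in
    [set d | D d /\ d <> p]) (E `&` component c p d))).
  move=> x Ex; have [->|xp] := pselect (x = p); [by left|right].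
  have [d Dd xd] := component_dense dD xp.
  exists d; last by split=> //; exact: (componentC tree xp).
  by split=> //; case: xd.
apply: negligibleU; first exact: point_negligible.
apply: countable_bigcup_null.
  apply: (sub_countable (B := D)) => //.
  by apply: subset_card_le => d [].
move=> d [_ dp]; apply/negligibleP; last exact: component_null.
by apply: measurableI => //; apply: component_measurable; exact/nesym.
Qed.

Definition thin_point : set (borel X) :=
  branch c `|` [set x | exists2 v, branch c v & x <> v /\ mu (component c v x) = 0%E].

(** There are countably many branch points, and countably many components at each of them. *)
Lemma thin_point_negligible : mu.-negligible thin_point.
Proof.
have [[D [cD dD]] _] := sep.
apply: (negligibleS (A := ((\bigcup_(v in branch c) [set v]) `|`
   \bigcup_(v in branch c) \bigcup_(d in
    [set d | D d /\ d <> v /\ mu (component c v d) = 0%E]) component c v d)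
    : set (borel X))).
  move=> x [bx|[v bv [xv xv0]]]; first by left; exists x.
  right; exists v => //; have [d Dd xd] := component_dense dD xv.
  have E := component_eq tree xd.
  exists d; last exact: (componentC tree xv).
  by split=> //; split; [case: xd|rewrite -E].
have cb := branch_countable sep.
apply: negligibleU; first by apply: countable_bigcup_null => // v _; exact: point_negligible.
apply: countable_bigcup_null => // v _; apply: countable_bigcup_null.
  apply: (sub_countable (B := D)) => //.
  by apply: subset_card_le => d [].
move=> d [_ [dp d0]]; apply/negligibleP => //.
by apply: component_measurable; exact/nesym.
Qed.

(** These conditions give positive length to the inner path of every quartet that a sample in a
    binary tree displays. *)
Definition generic m (u : m.-tuple (borel X)) : Prop :=
  (forall i, ~ thin_point (tnth u i)) /\
  (forall i j, i != j -> ~ thin_side (tnth u i, tnth u j) /\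
     ~ thin_middle (tnth u i, tnth u j)).

Lemma generic_ae m : (power_measure mu m).-negligible (~` @generic m).
Proof.
have cI : countable [set: 'I_m] by exact: countableP.
apply: (negligibleS (A := (\bigcup_(i in [set: 'I_m]) [set u | thin_point (tnth u i)])
  `|` (\bigcup_(i in [set: 'I_m]) \bigcup_(j in [set j | i != j])
        ([set u | thin_side (tnth u i, tnth u j)] `|`
         [set u | thin_middle (tnth u i, tnth u j)])))).
  move=> u ng; apply: contrapT => h; apply: ng; split=> [i hi|i j ij].
    by apply: h; left; exists i.
  split=> hij; apply: h; right; exists i => //; exists j => //; [by left|by right].
apply: negligibleU.
  apply: countable_bigcup_null => // i _.
  (* [thin_point] is only known to be negligible, so a measurable null set containing it is pulled
     back instead. *)
  have [A [mA A0 sA]] := thin_point_negligible.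
  exists [set u | A (tnth u i)]; split.
  - by rewrite -[X in measurable X]setTI; exact: measurable_tnth.
  - exact: etrans (power_measure_coord mu i mA) A0.
  - by move=> u; exact: sA.
apply: countable_bigcup_null => // i _; apply: countable_bigcup_null => [|j /= ij].
  exact: (sub_countable (subset_card_le (@subsetT _ _)) cI).
have mpair : measurable_fun setT (fun u : m.-tuple (borel X) => (tnth u i, tnth u j)).
  by apply: measurable_fun_pair; exact: measurable_tnth.
apply: negligibleU; apply/negligibleP.
- rewrite -[X in measurable X]setTI; exact: (mpair _ _ measurable_thin_side).
- exact: power_measure_pair measurable_thin_side thin_side_null ij.
- rewrite -[X in measurable X]setTI; exact: (mpair _ _ measurable_thin_middle).
- exact: power_measure_pair measurable_thin_middle thin_middle_null ij.
Qed.

End mass.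

(** * Shapes from distances *)

(** The four-point condition of an additive tree metric; p and q are the ends of the inner path of
    the quartet xy|zw. *)
Lemma quartet_additive (R : realType) (T : Type) (c : T -> T -> T -> T)
  (r : T -> T -> R) (x y z w p q : T) : is_algTree c ->
  (forall x y, r x y = r y x) ->
  (forall x y z, c x z y = y -> r x z = r x y + r y z) ->
  c x y z = p -> c x y w = p -> c x z w = q ->
  r x z + r y w = r x y + r z w + 2 * r p q /\ r x z + r y w = r x w + r y z.
Proof.
move=> tree rC rD h1 h2 h3.
have h4 : c y z w = q by clear -h1 h2 h3 tree; by_halfspaces tree.
have xy : r x y = r x p + r p y.
  by apply: rD; clear -h1 tree; by_halfspaces tree.
have zw : r z w = r z q + r q w.
  by apply: rD; clear -h3 tree; by_halfspaces tree.
have across a b : c a b p = p -> c p b q = q -> r a b = r a p + r p q + r q b.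
  by move=> ab pb; rewrite (rD _ _ _ ab) (rD _ _ _ pb) addrA.
have xz : r x z = r x p + r p q + r q z.
  by apply: across; clear -h1 h2 h3 h4 tree; by_halfspaces tree.
have xw : r x w = r x p + r p q + r q w.
  by apply: across; clear -h1 h2 h3 h4 tree; by_halfspaces tree.
have yz : r y z = r y p + r p q + r q z.
  by apply: across; clear -h1 h2 h3 h4 tree; by_halfspaces tree.
have yw : r y w = r y p + r p q + r q w.
  by apply: across; clear -h1 h2 h3 h4 tree; by_halfspaces tree.
by rewrite xz yw xw yz xy zw (rC p y) (rC z q); split; ring.
Qed.

(** The two sums differ by twice the length of the inner path. The pairing ik|jl would reverse the
    inequality, and il|jk would make the two sums equal. *)
Lemma quartet_ltP (R : realType) (T I : Type) (c : T -> T -> T -> T)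
  (r : T -> T -> R) (a : I -> T) i j k l : is_algTree c ->
  (forall x y, r x y = r y x) ->
  (forall x y z, c x z y = y -> r x z = r x y + r y z) ->
  (quartet c a i j k l -> 0 < r (c (a i) (a j) (a k)) (c (a i) (a k) (a l))) ->
  (quartet c a i k j l -> 0 < r (c (a i) (a k) (a j)) (c (a i) (a j) (a l))) ->
  quartet c a i j k l <->
  r (a i) (a j) + r (a k) (a l) < r (a i) (a k) + r (a j) (a l).
Proof.
move=> tree rC rD posj posk; split=> [q|lt].
  have [E _] := quartet_additive tree rC rD (erefl _) (esym q)
    (erefl (c (a i) (a k) (a l))).
  by have := posj q; lra.
have [//|q|q] := quartet_or tree a i j k l.
  have [E _] := quartet_additive tree rC rD (erefl _) (esym q)
    (erefl (c (a i) (a j) (a l))).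
  by have := posk q; lra.
have [_ E] := quartet_additive tree rC rD (erefl _) (esym q)
  (erefl (c (a i) (a j) (a k))).
by move: lt E; rewrite (rC (a l) (a k)) (rC (a l) (a j)); lra.
Qed.

Local Opaque power_measure.

(** * The branch point distribution and its tree metric *)

Section distance.
Context {R : realType} (X : amtree R).
Notation c := (@bp X).
Notation mu := (amt_mu X).
Let tree : is_algTree c := algTreeP X.
Let sep : order_separable X := amt_order_separable X.

Let bp_sample (u : 3.-tuple (borel X)) : X :=
  c (tnth u 0) (tnth u 1) (tnth u 2%R).

Lemma tm_bp_sample : tree_measurable (T := X) bp_sample.
Proof. by apply: tree_measurable_bp; exact: tm_tnth. Qed.

(** [bp_distr] is additive only on sets whose preimage under the branch point of three samples is
    measurable. *)
Definition bp_event (A : set X) : Prop :=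
  measurable [set u : 3.-tuple (borel X) | A (c (tnth u 0) (tnth u 1) (tnth u 2%R))].

Lemma bp_event_segment x y : bp_event (segment c x y).
Proof.
apply: (measurable_tree_eq sep) tm_bp_sample.
by apply: tree_measurable_bp tm_bp_sample; exact: tree_measurable_cst.
Qed.

Lemma bp_event_point x : bp_event [set x].
Proof. exact: (measurable_tree_eq sep tm_bp_sample (tree_measurable_cst x)). Qed.

Lemma bp_eventD A B : bp_event A -> bp_event B -> bp_event (A `\` B).
Proof. by move=> mA mB; exact: measurableD. Qed.

Lemma bp_distr_ge0 (A : set X) : 0 <= bp_distr A.
Proof. by rewrite /bp_distr fine_ge0. Qed.

Lemma bp_distrE (A : set X) : bp_event A ->
  (bp_distr A)%:E = power_measure mu 3 [set u | A (bp_sample u)].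
Proof. by move=> mA; rewrite /bp_distr fineK// fin_num_measure. Qed.

Lemma bp_distrU (A B : set X) : bp_event A -> bp_event B -> A `&` B = set0 ->
  bp_distr (A `|` B) = bp_distr A + bp_distr B.
Proof.
move=> mA mB AB.
rewrite /bp_distr -fineD; [|exact: fin_num_measure|exact: fin_num_measure].
congr fine; apply: (measureU _ mA mB).
apply/seteqP; split=> // u [Au Bu].
by have : (A `&` B) (bp_sample u) by []; rewrite AB.
Qed.

(* Hides the measures from lra, whose comparison of atoms would unfold them. *)
Ltac lra_abstract :=
  try move: (@bp_distr R X) => ?; try move: (@r_mu R X) => ?; lra.

Lemma r_muC (x y : X) : r_mu x y = r_mu y x.
Proof.
have E : segment c x y = segment c y x.
  by apply/seteqP; split=> z; rewrite /segment /= (bpC12 tree).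
by rewrite /r_mu E; lra_abstract.
Qed.

Lemma bp_distr_point (A : set X) x : A x -> bp_event A ->
  bp_distr A = bp_distr (A `\ x) + bp_distr [set x].
Proof.
move=> Ax mA; rewrite -bp_distrU; first by congr bp_distr; rewrite setUC setDUK// => _ ->.
- by apply: bp_eventD => //; exact: bp_event_point.
- exact: bp_event_point.
- by apply/seteqP; split=> // z [[_]].
Qed.

(** The halves in [r_mu] are what makes it additive: the mass of the inner point y is counted in
    both segments, and each of them gives up half of it. *)
Lemma r_mu_add (x y z : X) : c x z y = y -> r_mu x z = r_mu x y + r_mu y z.
Proof.
move=> xyz; have mS := bp_event_segment; have mP := bp_event_point.
have xy_y : segment c x y y by exact: (bp_two tree).
have yz_y : segment c y z y by exact: (bp_same2 tree).
have E : segment c x z = segment c x y `|` (segment c y z `\ y).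
  apply/seteqP; split=> w; rewrite /segment /=.
    move=> xzw; have [h|h|h] := bp_four tree x z w y.
    - by left; rewrite -xzw h xyz (bp_two tree).
    - by left; rewrite -xzw h; clear; by_halfspaces (algTreeP X).
    - have [->|wy] := pselect (w = y); first by left; exact: (bp_two tree).
      by right; split=> //; rewrite -[RHS]xzw h (bpC12 tree) (bpC23 tree).
  move=> [h|[h _]]; first by clear -xyz h tree; by_halfspaces tree.
  by clear -xyz h tree; by_halfspaces tree.
rewrite /r_mu E bp_distrU//; last 2 first.
- exact: bp_eventD.
- apply/seteqP; split=> // w [h1 [h2 wy]]; apply: wy.
  by rewrite /segment /= in h1 h2 *; clear -xyz h1 h2 tree; by_halfspaces tree.
rewrite (bp_distr_point yz_y (mS _ _)); lra_abstract.
Qed.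

(** For distinct x and y only half of the mass of each end is subtracted, so at least half of the
    mass of the segment remains. *)
Lemma r_mu_gt0 (x y : X) : x <> y -> 0 < bp_distr (segment c x y) -> 0 < r_mu x y.
Proof.
move=> xy; have mS := bp_event_segment; have mP := bp_event_point.
have xs : segment c x y x by exact: (bp_same2 tree).
have ys : (segment c x y `\ x) y by split; [exact: (bp_two tree)|exact/nesym].
rewrite /r_mu (bp_distr_point xs (mS _ _)) (bp_distr_point ys); last exact: bp_eventD.
have := bp_distr_ge0 ((segment c x y `\ x) `\ y).
have := bp_distr_ge0 [set x]; have := bp_distr_ge0 [set y].
lra_abstract.
Qed.

Lemma bp_distr_box (A : set X) (A0 A1 A2 : set (borel X)) : bp_event A ->
  measurable A0 -> measurable A1 -> measurable A2 ->
  mu A0 <> 0%E -> mu A1 <> 0%E -> mu A2 <> 0%E ->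
  (forall x y z, A0 x -> A1 y -> A2 z -> A (c x y z)) -> 0 < bp_distr A.
Proof.
move=> mA m0 m1 m2 n0 n1 n2 sub.
rewrite -lte_fin bp_distrE//.
apply: (@lt_le_trans _ _ (mu A0 * (mu A1 * mu A2))%E).
  by rewrite !mule_gt0// lt0e measure_ge0 andbT; apply/eqP.
rewrite -(power_measure_box mu m0 m1 m2).
have mt (i : 'I_3) B : measurable B ->
    measurable [set u : 3.-tuple (borel X) | B (tnth u i)].
  by move=> mB; rewrite -[X in measurable X]setTI; apply: measurable_tnth.
apply: (le_measure (power_measure mu 3)).
- rewrite inE (_ : [set u | _] = [set u | A0 (tnth u 0)] `&` [set u | A1 (tnth u 1)]
      `&` [set u | A2 (tnth u 2%R)]).
    by apply: measurableI; [apply: measurableI|]; exact: mt.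
  by apply/seteqP; split=> u /=; [case|case=> -[]].
- by rewrite inE.
by move=> u [] /sub h /h {}h /h.
Qed.

(** Three independent samples fall into the three components at v with positive probability, and v
    is then their branch point. *)
Lemma branch_mass x y z v : c x y z = v -> branch c v ->
  ~ @thin_point R X x -> ~ @thin_point R X y -> ~ @thin_point R X z ->
  0 < bp_distr [set v].
Proof.
move=> E bv tx ty tz.
have side t : ~ @thin_point R X t -> t <> v /\ mu (component c v t) <> 0%E.
  move=> tt; have tv : t <> v by move=> tv; apply: tt; left; rewrite tv.
  by split=> // t0; apply: tt; right; exists v.
have [xv x0] := side _ tx; have [yv y0] := side _ ty; have [zv z0] := side _ tz.
apply: (bp_distr_box (bp_event_point v) _ _ _ x0 y0 z0).
- by apply: component_measurable; exact/nesym.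
- by apply: component_measurable; exact/nesym.
- by apply: component_measurable; exact/nesym.
move=> x' y' z' hx hy hz; apply: (apart_bp tree).
- apply: (component_apart tree _ hx hy); by clear -E tree; by_halfspaces tree.
- apply: (component_apart tree _ hx hz); by clear -E tree; by_halfspaces tree.
- apply: (component_apart tree _ hy hz); by clear -E tree; by_halfspaces tree.
Qed.

(** A sample beyond p, one beyond q and one that branches off strictly in between have their branch
    point on the path from p to q. *)
Lemma segment_mass p q x y : p <> q -> c p x q = p -> c q y p = q ->
  ~ @thin_side R X (p, x) -> ~ @thin_side R X (q, y) -> ~ @thin_middle R X (p, q) ->
  0 < bp_distr (segment c p q).
Proof.
move=> pq px qy sx sy sm.
have ne v t : ~ @thin_side R X (v, t) -> t <> v.
  move=> ts tv; apply: ts; rewrite /thin_side /= tv (_ : component _ _ _ = set0).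
    exact: measure0.
  by apply/seteqP; split=> // z [_]; rewrite (bp_same1 tree).
have mM : measurable (between_open p q : set (borel X)).
  rewrite (_ : between_open p q = component c p q `&` component c q p).
    by apply: measurableI; apply: component_measurable => //; exact/nesym.
  apply/seteqP; split=> z.
    move=> [h1 h2]; split; split=> //.
    - by move=> zp; apply: h1; rewrite zp (bp_same2 tree).
    - by move=> zq; apply: h2; rewrite zq (bp_two tree).
    - by rewrite (bpC12 tree).
  by move=> [[_ h1] [_ h2]]; split=> //; rewrite (bpC12 tree).
apply: (bp_distr_box (bp_event_segment p q) _ _ mM sx sy sm).
- by apply: component_measurable; exact/nesym/ne.
- by apply: component_measurable; exact/nesym/ne.
move=> u0 u1 u2 /= h0 h1 [h2p h2q].
have p0 : c p u0 q = p.
  by apply: (component_apart tree px) h0 _; apply: component_refl => //; exact/nesym.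
have q1 : c q u1 p = q.
  by apply: (component_apart tree qy) h1 _; exact: component_refl.
have [e0 e1] : c u0 u1 p = p /\ c u0 u1 q = q.
  by apply: (between_sides tree pq); [clear -p0 tree|clear -q1 tree]; by_halfspaces tree.
have e2 : c p u0 u2 = p.
  apply: contrapT => h; apply: (separated_trans tree (y := u2)) p0 => //.
  by rewrite (bpC23 tree).
have e3 : c q u1 u2 = q.
  apply: contrapT => h; apply: (separated_trans tree (y := u2)) q1 => //.
  by rewrite (bpC23 tree) (bpC12 tree).
by rewrite /segment /=; clear -e0 e1 e2 e3 tree; by_halfspaces tree.
Qed.

Hypothesis bin : binary c.

Section generic.
Context {m : nat} (u : m.-tuple (borel X)).
Hypothesis gen : generic u.
Notation a := (tnth u : 'I_m -> X).

Lemma generic_inj : injective a.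
Proof.
move=> i j ij; apply: contrapT => /eqP inj; have [ts _] := gen.2 i j inj.
apply: ts; rewrite /thin_side /= [tnth u i]ij (_ : component _ _ _ = set0).
  exact: measure0.
by apply/seteqP; split=> // z [_]; rewrite (bp_same1 tree).
Qed.

Lemma generic_not_branch i : ~ branch c (a i).
Proof. by move=> bi; apply: (gen.1 i); left. Qed.

Lemma generic_r_mu_gt0 i j k l : uniq [:: i; j; k; l] -> quartet c a i j k l ->
  0 < r_mu (c (a i) (a j) (a k)) (c (a i) (a k) (a l)).
Proof.
move=> uq q; have ex := quartet_excl tree bin generic_not_branch generic_inj uq q.
move: uq; rewrite /= !inE !negb_or !andbT => /and3P[/and3P[ij ik il] /andP[jk jl] kl].
have [v vE] : exists v, c (a i) (a j) (a k) = v by eexists.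
have [w wE] : exists w, c (a i) (a k) (a l) = w by eexists.
have vE' : c (a i) (a j) (a l) = v by rewrite -q.
have wE' : c (a j) (a k) (a l) = w by clear -vE vE' wE tree; by_halfspaces tree.
rewrite vE wE.
(* A trivial inner path would mean that the pairing ik|jl is displayed as well. *)
have vw : v <> w.
  by move=> vw; apply: ex; rewrite /quartet wE -vw -vE (bpC23 tree).
have ne i' j' : i' != j' -> a i' <> a j' by move=> /eqP ij' /generic_inj.
have tp i' := gen.1 i'.
apply: r_mu_gt0 => //.
have mono p : branch c p -> segment c v w p -> 0 < bp_distr [set p] ->
    0 < bp_distr (segment c v w).
  move=> _ sp p0; rewrite (bp_distr_point sp (bp_event_segment _ _)).
  by move: p0 (bp_distr_ge0 (segment c v w `\ p)); lra_abstract.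
(* Either an end of [v, w] is a branch point, or both ends are sample points and
   [v, w] contains the branch points of triples drawn beyond v, beyond w and
   between v and w. *)
have [bv|nbv] := pselect (branch c v).
  by apply: (mono v) => //; [exact: (bp_same2 tree)|exact: (branch_mass vE)].
have [bw|nbw] := pselect (branch c w).
  by apply: (mono w) => //; [exact: (bp_two tree)|exact: (branch_mass wE)].
(* The branch point of three points, if distinct from all of them, has three directions; so if it is
   not in [branch c], it is one of the points. *)
have end_of i1 i2 i3 p : c (a i1) (a i2) (a i3) = p -> ~ branch c p ->
    [\/ p = a i1, p = a i2 | p = a i3].
  move=> E nb; have [n1|n1] := pselect (p = a i1); first exact: Or31.
  have [n2|n2] := pselect (p = a i2); first exact: Or32.
  have [n3|n3] := pselect (p = a i3); first exact: Or33.
  case: nb; apply: (branch3 tree (y1 := a i1) (y2 := a i2) (y3 := a i3));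
    by [exact/nesym|clear -E tree; by_halfspaces tree].
have vij : exists i' j', [/\ v = a i', i' != j' & c v (a j') w = v].
  have [E|E|E] := end_of _ _ _ _ vE nbv.
  - by exists i, j; split=> //; clear -vE vE' wE tree; by_halfspaces tree.
  - by exists j, i; rewrite eq_sym; split=> //; clear -vE vE' wE tree; by_halfspaces tree.
  - by exfalso; apply: vw; clear -E vE vE' wE tree; by_halfspaces tree.
have wkl : exists k' l', [/\ w = a k', k' != l' & c w (a l') v = w].
  have [E|E|E] := end_of _ _ _ _ wE nbw.
  - by exfalso; apply: vw; clear -E vE vE' wE tree; by_halfspaces tree.
  - by exists k, l; split=> //; clear -vE vE' wE tree; by_halfspaces tree.
  - by exists l, k; rewrite eq_sym; split=> //; clear -vE vE' wE tree; by_halfspaces tree.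
have [i' [j' [vi ij' vj]]] := vij; have [k' [l' [wk kl' wl]]] := wkl.
have ik' : i' != k' by apply/eqP => h; apply: vw; rewrite vi wk h.
rewrite vi wk in vj wl vw *.
apply: (segment_mass vw vj wl).
- exact: (gen.2 _ _ ij').1.
- exact: (gen.2 _ _ kl').1.
- exact: (gen.2 _ _ ik').2.
Qed.

Lemma generic_quartetP i j k l : uniq [:: i; j; k; l] ->
  quartet c a i j k l <->
  r_mu (a i) (a j) + r_mu (a k) (a l) < r_mu (a i) (a k) + r_mu (a j) (a l).
Proof.
move=> uq; apply: (quartet_ltP tree r_muC r_mu_add); apply: generic_r_mu_gt0 => //.
rewrite (perm_uniq (_ : perm_eq _ [:: i; j; k; l]))// perm_cons.
by rewrite (perm_catCA [:: k] [:: j] [:: l]).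
Qed.

End generic.
End distance.

(** * The duality function *)

Lemma rep_T2cont (R : realType) (x : T2cont R) : T2cont_tree (rep x).
Proof. by rewrite /rep; case: cid2. Qed.

Section detector.
Context {R : realType} {m : nat} (t : cladograms m).
Notation quad := ('I_m * 'I_m * ('I_m * 'I_m))%type.

Definition displayed (q : quad) : bool :=
  let: (i, j, (k, l)) := q in
  uniq [:: i; j; k; l] &&
  `[< quartet (@lclado_bp m (repr (val t))) (lclado_label (repr (val t))) i j k l >].

(** Distance matrices carry data only above the diagonal. *)
Definition entry (A : 'M[R]_m) (i j : 'I_m) : R := if (i < j)%N then A i j else A j i.

Definition gap (q : quad) (A : 'M[R]_m) : R :=
  let: (i, j, (k, l)) := q in
  entry A i k + entry A j l - entry A i j - entry A k l.

(* Positive on the distance matrix of a generic sample exactly if its shape is t. *)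
Definition detector (A : 'M[R]_m) : R :=
  \prod_(q : quad | displayed q) Num.max 0 (gap q A).

(** Bounded continuous functions that converge pointwise to the indicator of [0 < detector A]. *)
Definition detector_approx (n : nat) (A : 'M[R]_m) : R :=
  Num.min 1 (n%:R * detector A).

Lemma detector_ge0 A : 0 <= detector A.
Proof. by apply: prodr_ge0 => q _; rewrite le_max lexx. Qed.

Lemma detector_gt0 A : 0 < detector A <-> forall q, displayed q -> 0 < gap q A.
Proof.
split=> [d0 q dq|H]; last by apply: prodr_gt0 => q /H; rewrite lt_max => ->; rewrite orbT.
rewrite ltNge; apply/negP => gq; move: d0; rewrite /detector (bigD1 q)//=.
by rewrite max_l// mul0r ltxx.
Qed.

Lemma detector_approx_ge0 n A : 0 <= detector_approx n A.
Proof. by rewrite le_min ler01 mulr_ge0 ?detector_ge0. Qed.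

Lemma detector_approx_le1 n A : detector_approx n A <= 1.
Proof. by rewrite ge_min lexx. Qed.

Lemma continuous_bigprod (T : topologicalType) (I : Type) (s : seq I) (Q : pred I)
  (F : I -> T -> R) :
  (forall i, continuous (F i)) -> continuous (fun x => \prod_(i <- s | Q i) F i x).
Proof.
move=> cF; elim: s => [|i s IH].
  have -> : (fun x => \prod_(i <- [::] | Q i) F i x) = fun=> 1.
    by apply/funext => x; rewrite big_nil.
  exact: cst_continuous.
have -> : (fun x => \prod_(j <- i :: s | Q j) F j x) =
    if Q i then fun x => F i x * \prod_(j <- s | Q j) F j x
    else fun x => \prod_(j <- s | Q j) F j x.
  by apply/funext => x; rewrite big_cons; case: ifP.
by case: ifP => // _ x; apply: continuousM; [exact: cF|exact: IH].
Qed.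

Lemma entry_continuous i j : continuous (fun A => entry A i j).
Proof. by rewrite /entry; case: (i < j)%N; exact: coord_continuous. Qed.

Lemma gap_continuous q : continuous (gap q).
Proof.
case: q => -[i j] [k l] A.
have e i' j' := @entry_continuous i' j' A.
exact: (cvgB (cvgB (cvgD (e i k) (e j l)) (e i j)) (e k l)).
Qed.

Lemma detector_continuous : continuous detector.
Proof.
apply: continuous_bigprod => q A.
by apply: continuous_max; [exact: cst_continuous|exact: gap_continuous].
Qed.

Lemma detector_approx_continuous n : continuous (detector_approx n).
Proof.
move=> A; apply: (@continuous_min R _ (fun=> 1) (fun A => n%:R * detector A) A).
  exact: cst_continuous.
by apply: continuousM; [exact: cst_continuous|exact: detector_continuous].
Qed.

Lemma detector_approx_cvg A :
  detector_approx n A @[n --> \oo] --> ((0 < detector A)%R%:R : R).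
Proof.
have := detector_ge0 A; rewrite le_eqVlt => /orP[/eqP d0|d0].
  have -> : (fun n => detector_approx n A) = fun=> 0.
    by apply/funext => n; rewrite /detector_approx -d0 mulr0 min_r.
  by rewrite -d0 ltxx /=; exact: cvg_cst.
rewrite d0; apply: cvg_near_cst; near=> n.
rewrite /detector_approx min_l// -ler_pdivrMr// ?div1r.
near: n; exact: nbhs_infty_ger.
Unshelve. all: by end_near. Qed.

Lemma detector_approx_bounded n : exists M, forall A, `|detector_approx n A| <= M.
Proof.
by exists 1 => A; rewrite ger0_norm ?detector_approx_ge0 ?detector_approx_le1.
Qed.

Definition detector_test n : {k : nat & bounded_continuous R k} :=
  Tagged (bounded_continuous R)
    (exist _ (detector_approx n)
      (conj (@detector_approx_continuous n) (detector_approx_bounded n))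
      : bounded_continuous R m).

End detector.

Lemma continuous_borel_measurable (R : realType) (T : ptopologicalType) (f : T -> R) :
  continuous f -> measurable_fun setT (f : borel T -> R).
Proof.
move=> /continuousP cf; apply: (measurability _ (RGenOpens.measurableE R)).
move=> _ [_ [a [b ->] <-]]; rewrite setTI; apply: sub_sigma_algebra.
exact/cf/interval_open.
Qed.

Section sampling.
Context {R : realType} (X : amtree R) {m : nat}.
Notation c := (@bp X).
Notation mu := (amt_mu X).
Let sep : order_separable X := amt_order_separable X.

(** The value at u is the measure of the u-section of an equality set in the product, so
    measurability follows from that of section measures. *)
Lemma bp_distr_measurable (F G : m.-tuple (borel X) * 3.-tuple (borel X) -> X) :
  tree_measurable F -> tree_measurable G ->
  measurable_fun setT (fun u : m.-tuple (borel X) => fine (power_measure mu 3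
    [set w | F (u, w) = G (u, w)])).
Proof.
move=> mF mG; have mK := measurable_tree_eq sep mF mG.
have mX := measurable_fun_xsection (power_measure mu 3) mK.
have mfine := measurableT_comp (@fine_measurable R _ measurableT) mX.
have E : (fun u : m.-tuple (borel X) =>
    fine (power_measure mu 3 [set w | F (u, w) = G (u, w)])) =
    fine \o (power_measure mu 3 \o xsection [set p | F p = G p]).
  by apply/funext => u; rewrite /comp xsectionE.
by rewrite E; exact: mfine.
Qed.

Let sample_l (i : 'I_m) :
  tree_measurable (T := X) (fun p : m.-tuple (borel X) * 3.-tuple (borel X) => tnth p.1 i).
Proof. by apply: (tm_comp (tm_tnth i)); exact: measurable_fst. Qed.

Let sample_r : tree_measurable (T := X)
  (fun p : m.-tuple (borel X) * 3.-tuple (borel X) =>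
    c (tnth p.2 0) (tnth p.2 1) (tnth p.2 2%R)).
Proof. by apply: (tm_comp (@tm_bp_sample R X)); exact: measurable_snd. Qed.

Lemma r_mu_measurable (i j : 'I_m) :
  measurable_fun setT (fun u : m.-tuple (borel X) => r_mu (tnth u i : X) (tnth u j)).
Proof.
have seg : measurable_fun setT
    (fun u : m.-tuple (borel X) => bp_distr (segment c (tnth u i) (tnth u j))).
  exact: (bp_distr_measurable (tree_measurable_bp (sample_l i) (sample_l j) sample_r) sample_r).
have pt k : measurable_fun setT
    (fun u : m.-tuple (borel X) => bp_distr ([set (tnth u k : X)])).
  exact: (bp_distr_measurable sample_r (sample_l k)).
have half k := measurable_funM (@measurable_cst _ _ _ _ setT (2^-1 : R)) (pt k).
exact: measurable_funB (measurable_funB seg (half i)) (half j).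
Qed.

Lemma entry_measurable (i j : 'I_m) :
  measurable_fun setT (fun u : m.-tuple (borel X) => entry (distance_matrix u) i j).
Proof.
rewrite /entry; case: (ltnP i j) => ij.
  under eq_fun do rewrite mxE ij; exact: r_mu_measurable.
case: (ltnP j i) => ji; first by under eq_fun do rewrite mxE ji; exact: r_mu_measurable.
(* On the diagonal the entry is 0 by definition. *)
have : forall u : m.-tuple (borel X), distance_matrix u j i = 0.
  by move=> u; rewrite mxE ltnNge ji.
move=> /funext ->; exact: measurable_cst.
Qed.

Lemma entryE (u : m.-tuple (borel X)) (i j : 'I_m) : i != j ->
  entry (distance_matrix u) i j = r_mu (tnth u i) (tnth u j).
Proof.
move=> ij; rewrite /entry; case: ltngtP => [lt|lt|/val_inj E].
- by rewrite mxE lt.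
- by rewrite mxE lt r_muC.
- by rewrite E eqxx in ij.
Qed.

Lemma detector_measurable (t : cladograms m) :
  measurable_fun setT (fun u : m.-tuple (borel X) => detector t (distance_matrix u)).
Proof.
rewrite /detector; under eq_fun do rewrite -big_filter.
apply: measurable_prod => -[[i j] [k l]] _.
apply: measurable_maxr; first exact: measurable_cst.
exact: measurable_funB (measurable_funB (measurable_funD (entry_measurable i k)
  (entry_measurable j l)) (entry_measurable i j)) (entry_measurable k l).
Qed.

Lemma detector_gt0_measurable (t : cladograms m) :
  measurable [set u : m.-tuple (borel X) | 0 < detector t (distance_matrix u)].
Proof.
have mI : measurable (`]0, +oo[ : set R) by exact: measurable_itv.
have := detector_measurable t measurableT mI; rewrite setTI.
by congr measurable; apply/seteqP; split=> u /=; rewrite in_itv/= andbT.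
Qed.

Lemma detector_approx_measurable (t : cladograms m) n :
  measurable_fun setT (fun u : m.-tuple (borel X) => detector_approx t n (distance_matrix u)).
Proof.
apply: measurable_minr; first exact: measurable_cst.
apply: measurable_funM; [exact: measurable_cst|exact: detector_measurable].
Qed.

Hypothesis XT : T2cont_tree X.
Let bin : binary c := XT.1.1.

(** By [tree_shapeE] the event is a finite combination of equations between tree-measurable maps and
    of memberships in the countable set of branch points. *)
Lemma tree_shape_measurable (t : cladograms m) :
  measurable [set u : m.-tuple (borel X) | tree_shape u = Some (val t)].
Proof.
have cI (A : set 'I_m) : countable A.
  exact: (sub_countable (subset_card_le (@subsetT _ _)) (countableP [set: 'I_m])).
have cQ (A : set ('I_m * 'I_m * ('I_m * 'I_m))) : countable A.
  by apply: (sub_countable (subset_card_le (@subsetT _ _))); exact: countableP.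
rewrite (_ : [set u | _] =
  ~` ((\bigcup_(i in [set: 'I_m]) [set u | branch c (tnth u i)]) `|`
      (\bigcup_(i in [set: 'I_m]) \bigcup_(j in [set j | i != j])
          [set u | tnth u i = tnth u j]) `|`
      (\bigcup_(q in [set q | displayed t q])
          ~` [set u | quartet c (tnth u) q.1.1 q.1.2 q.2.1 q.2.2]))).
  apply: measurableC; apply: measurableU; [apply: measurableU|].
  - apply: countable_bigcup_measurable => // i _.
    by apply: (measurable_tree_mem sep (branch_countable sep)); exact: tm_tnth.
  - apply: countable_bigcup_measurable => // i _.
    apply: countable_bigcup_measurable => // j _.
    by apply: (measurable_tree_eq sep); exact: tm_tnth.
  - apply: countable_bigcup_measurable => // -[[i j] [k l]] _; apply: measurableC.
    by apply: (measurable_tree_eq sep); apply: tree_measurable_bp; exact: tm_tnth.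
apply/seteqP; split=> u /=.
  move=> /(tree_shapeE _ _ bin)[nb inj q] [[[i _ bi]|[i _ [j /eqP ij E]]]|[[[i j] [k l]]]].
  - exact: (nb i).
  - by apply: ij; apply: inj.
  - by move=> /= /andP[uq /asboolP qC]; apply; exact: q.
move=> h; apply/(tree_shapeE _ _ bin); split.
- by move=> i bi; apply: h; left; left; exists i.
- move=> i j E; apply: contrapT => /eqP ij; apply: h; left; right.
  by exists i => //; exists j.
- move=> i j k l uq qC; apply: contrapT => nq; apply: h; right.
  by exists ((i, j), (k, l)) => //; apply/andP; split; [exact: uq|exact/asboolP].
Qed.

Lemma generic_detector (t : cladograms m) (u : m.-tuple (borel X)) : generic u ->
  tree_shape u = Some (val t) <-> 0 < detector t (distance_matrix u).
Proof.
move=> gen.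
have gapP q : displayed t q -> quartet c (tnth u) q.1.1 q.1.2 q.2.1 q.2.2 <->
    0 < gap q (distance_matrix u).
  case: q => -[i j] [k l] /andP[uq _] /=; rewrite (generic_quartetP bin gen uq).
  move: uq; rewrite /= !inE !negb_or !andbT => /and3P[/and3P[ij ik il] /andP[jk jl] kl].
  rewrite !entryE//; move: (@r_mu R X) => r; split; lra.
split=> [/(tree_shapeE _ _ bin)[nb inj q]|/detector_gt0 H].
  apply/detector_gt0 => -[[i j] [k l]] dq; apply/(gapP _ dq).
  by move: dq => /andP[uq /asboolP]; exact: q.
apply/(tree_shapeE _ _ bin); split.
- exact: generic_not_branch.
- exact: generic_inj.
- move=> i j k l uq qC; have dq : displayed t ((i, j), (k, l)).
    by apply/andP; split; [exact: uq|exact/asboolP].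
  exact/(gapP _ dq)/H.
Qed.

End sampling.

Section Phi_limit.
Context {R : realType} {m : nat} (t : cladograms m) (x : T2cont R).
Notation mu := (power_measure (amt_mu (rep x)) m).
Notation U := (m.-tuple (borel (rep x))).

Lemma shape_measureE :
  mu [set u : U | tree_shape u = Some (val t)] =
  mu [set u : U | 0 < detector t (distance_matrix u)].
Proof.
have mS := tree_shape_measurable (rep_T2cont x) t.
have mD := @detector_gt0_measurable R (rep x) m t.
have [N [mN N0 sN]] := generic_ae (rep_T2cont x).2 m.
have sub A B : measurable A -> measurable B -> (A `<=` B `|` N) -> (mu A <= mu B)%E.
  move=> mA mB AB; apply: (@le_trans _ _ (mu (B `|` N))).
    by apply: le_measure; rewrite ?inE//; exact: measurableU.
  rewrite -[leRHS]adde0 -N0; apply: measureU2 => //.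
apply/eqP; rewrite eq_le; apply/andP; split; apply: sub => // u h.
  have [gen|ng] := pselect (generic u); last by right; exact: sN.
  by left; exact/(generic_detector (rep_T2cont x) t gen).
have [gen|ng] := pselect (generic u); last by right; exact: sN.
by left; exact/(generic_detector (rep_T2cont x) t gen).
Qed.

Lemma PhiE : (Phi t x)%:E = mu [set u : U | tree_shape u = Some (val t)].
Proof.
rewrite /Phi fineK//; apply: fin_num_measure.
exact: tree_shape_measurable (rep_T2cont x) t.
Qed.

Lemma test_functional_cvg :
  test_functional x (detector_test t n) @[n --> \oo] --> Phi t x.
Proof.
have mF n : measurable_fun setT
    (fun u : U => (detector_approx t n (distance_matrix u))%:E).
  by apply/measurable_EFinP; exact: detector_approx_measurable.
have mD := @detector_gt0_measurable R (rep x) m t.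
have cv : (\int[mu]_u (detector_approx t n (distance_matrix u))%:E)%E @[n --> \oo] -->
    (\int[mu]_u ((0 < detector t (distance_matrix u))%R%:R)%:E)%E.
  apply: (@dominated_cvg _ _ R mu setT measurableT
    (fun n (u : U) => (detector_approx t n (distance_matrix u))%:E)
    (fun u => ((0 < detector t (distance_matrix u))%R%:R)%:E) (cst 1%E) mF) => //.
  - move=> u _; apply/fine_cvgP; split; first by near=> n.
    exact: detector_approx_cvg.
  - exact: finite_measure_integrable_cst.
  - move=> n u _; rewrite abse_EFin lee_fin ger0_norm ?detector_approx_ge0//.
    exact: detector_approx_le1.
have E : (\int[mu]_u ((0 < detector t (distance_matrix u))%R%:R)%:E)%E = (Phi t x)%:E.
  rewrite PhiE shape_measureE -[X in mu X]setIT -integral_indic//.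
  apply: eq_integral => u _; rewrite indicE.
  have -> // : (u \in [set u : U | 0 < detector t (distance_matrix u)]) =
    (0 < detector t (distance_matrix u)) by apply/idP/idP; rewrite inE.
rewrite E in cv; exact: (fine_cvg cv).
Unshelve. all: by end_near. Qed.

End Phi_limit.

Lemma Phi_measurable (R : realType) m (t : cladograms m) :
  measurable_fun setT (Phi t : borel (T2cont R) -> R).
Proof.
apply: (measurable_fun_cvg
  (h := fun n => (fun x => test_functional x (detector_test t n)) : borel (T2cont R) -> R)).
  move=> n; apply: continuous_borel_measurable; exact: test_functional_continuous.
by move=> x _; exact: test_functional_cvg.
Qed.

(** * Linear equations for the semigroup *)

Section semigroup.
Context {R : realType} {S : choiceType} (s : seq S).
Hypotheses (s_uniq : uniq s) (s_all : forall x, x \in s).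
Variables (L : (S -> R) -> S -> R) (Q : R -> (S -> R) -> S -> R).
Hypothesis QP : markov_semigroup L Q.
Hypothesis LE : forall f x, L f x = \sum_(y <- s) f y * L \1_[set y] x.
Implicit Types f g : S -> R.

Lemma indic_sum f x : f x = \sum_(y <- s) f y * \1_[set y] x.
Proof.
rewrite (bigD1_seq x)//= indicE mem_set// mulr1 big1 ?addr0// => y /negP yx.
by rewrite indicE memNset ?mulr0// => /= xy; apply: yx; rewrite xy.
Qed.

Lemma semigroupB t f g x : 0 <= t ->
  Q t (fun y => f y - g y) x = Q t f x - Q t g x.
Proof.
move=> t0; have := semigroup_linear QP t0 (-1) g f x.
rewrite mulN1r addrC => <-; congr (Q t _ x); apply/funext => y.
by rewrite mulN1r addrC.
Qed.

Lemma semigroup_cst0 t x : 0 <= t -> Q t (fun=> 0) x = 0.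
Proof.
move=> t0; rewrite -[RHS](subrr (Q t (fun=> 1) x)) -semigroupB//.
by congr (Q t _ x); apply/funext => y; rewrite subrr.
Qed.

Lemma semigroupZ t a f x : 0 <= t -> Q t (fun y => a * f y) x = a * Q t f x.
Proof.
move=> t0; have := semigroup_linear QP t0 a f (fun=> 0) x.
rewrite semigroup_cst0// addr0 => <-; congr (Q t _ x); apply/funext => y.
by rewrite addr0.
Qed.

(** Positivity and preservation of constants bound [Q t f] by the bounds of f. *)
Lemma semigroup_contraction t f M : 0 <= t -> (forall y, `|f y| <= M) ->
  forall x, `|Q t f x| <= M.
Proof.
move=> t0 fM x; have cM : Q t (fun=> M) x = M.
  rewrite -[RHS](mulr1 M) -(semigroup_one QP t0 x) -semigroupZ//.
  by congr (Q t _ x); apply/funext => y; rewrite mulr1.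
have nonneg g : (forall y, 0 <= g y) -> 0 <= Q t g x.
  by move=> g0; exact: (semigroup_ge0 QP t0).
rewrite ler_norml; apply/andP; split.
  rewrite -subr_ge0 opprK addrC -[X in X + _]cM.
  have -> : Q t (fun=> M) x + Q t f x = Q t (fun y => M - (0 - f y)) x.
    by rewrite !semigroupB// semigroup_cst0// sub0r opprK.
  by apply: nonneg => y; have := fM y; rewrite ler_norml => /andP[]; lra.
rewrite -subr_ge0 -[X in X - _]cM -semigroupB//.
by apply: nonneg => y; have := fM y; rewrite ler_norml => /andP[]; lra.
Qed.

Lemma semigroup_sum t f x : 0 <= t -> Q t f x = \sum_(y <- s) f y * Q t \1_[set y] x.
Proof.
move=> t0; have gen (r : seq S) :
    Q t (fun z => \sum_(y <- r) f y * \1_[set y] z) x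
    = \sum_(y <- r) f y * Q t \1_[set y] x.
  elim: r => [|y r IH].
    rewrite big_nil -[RHS](semigroup_cst0 x t0); congr (Q t _ x).
    by apply/funext => z; rewrite big_nil.
  rewrite big_cons -IH -(semigroup_linear QP t0); congr (Q t _ x).
  by apply/funext => z; rewrite big_cons.
by rewrite -gen; congr (Q t _ x); apply/funext => z; exact: indic_sum.
Qed.

(** The sum of the absolute values of all matrix entries bounds every row sum, hence the supremum
    operator norm of [L]. *)
Definition generator_bound : R := \sum_(x <- s) \sum_(y <- s) `|L \1_[set y] x|.

Lemma generator_bound_ge0 : 0 <= generator_bound.
Proof. by apply: sumr_ge0 => x _; apply: sumr_ge0. Qed.

Lemma sum_seq_ge (F : S -> R) x : (forall y, 0 <= F y) -> F x <= \sum_(y <- s) F y.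
Proof. by move=> F0; rewrite (bigD1_seq x)//= lerDl sumr_ge0. Qed.

(** [J T] stands for the integral of V up to T. With B the generator bound, V is Lipschitz with
    constant B, so V varies by at most B h over one step and its integral differs from h V(r) by at
    most B h^2; one more application of [L] gives B^2 h^2. *)
Lemma volterra_euler (V J : R -> S -> R) :
  (forall T x, 0 <= T -> V T x = V 0 x + \sum_(y <- s) L \1_[set y] x * J T y) ->
  (forall r h a e y, 0 <= r -> 0 <= h -> 0 <= e ->
    (forall p, r <= p <= r + h -> `|V p y - a| <= e) ->
    `|J (r + h) y - J r y - h * a| <= e * h) ->
  (forall r y, `|V r y| <= 1) ->
  forall r h x, 0 <= r -> 0 <= h ->
  `|V (r + h) x - V r x - h * L (V r) x| <= generator_bound ^+ 2 * h ^+ 2.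
Proof.
move=> VE JE V1 r h x r0 h0; set B := generator_bound.
have B0 : 0 <= B by exact: generator_bound_ge0.
have LB z : \sum_(y <- s) `|L \1_[set y] z| <= B.
  apply: (sum_seq_ge (F := fun z => \sum_(y <- s) `|L \1_[set y] z|)) => y.
  exact: sumr_ge0.
have increment q k z : 0 <= q -> 0 <= k -> V (q + k) z - V q z =
    \sum_(y <- s) L \1_[set y] z * (J (q + k) y - J q y).
  move=> q0 k0; rewrite (VE (q + k)) ?addr_ge0// (VE q)//.
  rewrite opprD addrACA subrr add0r -sumrB.
  by apply: eq_bigr => y _; rewrite mulrBr.
have weighted (F : S -> R) e z : 0 <= e -> (forall y, `|F y| <= e) ->
    `|\sum_(y <- s) L \1_[set y] z * F y| <= B * e.
  move=> e0 Fe; apply: (le_trans (ler_norm_sum _ _ _)).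
  apply: (@le_trans _ _ ((\sum_(y <- s) `|L \1_[set y] z|) * e)).
    by rewrite mulr_suml; apply: ler_sum => y _; rewrite normrM ler_wpM2l.
  by rewrite ler_wpM2r.
(* The assumption on [J] with a = 0 and e = 1 bounds its increments by k. *)
have lipschitz q k z : 0 <= q -> 0 <= k -> `|V (q + k) z - V q z| <= B * k.
  move=> q0 k0; rewrite increment//; apply: weighted => // y.
  have := JE q k 0 1 y q0 k0 ler01; rewrite mulr0 subr0 mul1r; apply => p _.
  by rewrite subr0.
rewrite increment// LE mulr_sumr -sumrB.
rewrite (eq_bigr (fun y => L \1_[set y] x * (J (r + h) y - J r y - h * V r y))).
  rewrite (_ : B ^+ 2 * h ^+ 2 = B * (B * h * h)); last by ring.
  apply: weighted => [|y]; first by rewrite !mulr_ge0.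
  apply: JE => // [|p /andP[rp pr]]; first by rewrite mulr_ge0.
  rewrite -[p in V p](subrKC r).
  apply: (le_trans (lipschitz _ _ _ _ _)) => //; first by rewrite subr_ge0.
  by rewrite ler_wpM2l// lerBlDl.
by move=> y _; ring.
Qed.

(** Summation over the finite state space makes the convergence of the difference quotients uniform
    in the state. *)
Let remainder (h : R) : R := \sum_(x <- s) \sum_(y <- s)
  `|(Q h \1_[set y] x - \1_[set y] x) / h - L \1_[set y] x|.

Let remainder_cvg : remainder h @[h --> 0^'+] --> (0 : R).
Proof.
have sum0 (I : Type) (r : seq I) (F : I -> R -> R) :
    (forall i, F i h @[h --> 0^'+] --> (0 : R)) ->
    \sum_(i <- r) F i h @[h --> 0^'+] --> (0 : R).
  move=> F0; elim: r => [|i r IH].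
    by under eq_fun do rewrite big_nil; exact: cvg_cst.
  under eq_fun do rewrite big_cons.
  by have h := cvgD (F0 i) IH; rewrite addr0 in h; exact: h.
apply: (sum0 _ s) => x; apply: (sum0 _ s) => y.
have h := cvg_norm (cvgB (@semigroup_generator _ _ _ _ QP \1_[set y] x)
  (@cvg_cst _ (L \1_[set y] x) _ (0 : R)^'+ _)).
by rewrite subrr normr0 in h; exact: h.
Qed.

Let step_error h f : 0 < h -> (forall y, `|f y| <= 1) ->
  forall x, `|Q h f x - f x - h * L f x| <= h * remainder h.
Proof.
move=> h0 f1 x; rewrite (semigroup_sum _ _ (ltW h0)) (indic_sum f x) LE mulr_sumr.
rewrite -!sumrB; apply: (le_trans (ler_norm_sum _ _ _)).
apply: (@le_trans _ _ (h * \sum_(y <- s)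
    `|(Q h \1_[set y] x - \1_[set y] x) / h - L \1_[set y] x|)).
  rewrite mulr_sumr; apply: ler_sum => y _.
  rewrite (_ : _ - _ - _ = f y * (h * ((Q h \1_[set y] x - \1_[set y] x) / h
      - L \1_[set y] x))); last by field; rewrite gt_eqF.
  rewrite normrM normrM (gtr0_norm h0) ler_piMl// mulr_ge0//; exact: ltW.
rewrite ler_wpM2l//; first exact: ltW.
apply: (sum_seq_ge (F := fun x => \sum_(y <- s)
  `|(Q h \1_[set y] x - \1_[set y] x) / h - L \1_[set y] x|)) => z.
by apply: sumr_ge0.
Qed.

Variables (v : R -> S -> R) (C : R).
Hypothesis v1 : forall r x, 0 <= r -> `|v r x| <= 1.
Hypothesis C0 : 0 <= C.
Hypothesis vL : forall r h x, 0 <= r -> 0 <= h ->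
  `|v (r + h) x - v r x - h * L (v r) x| <= C * h ^+ 2.

(* Telescopes T |-> Q_(T - kh) (v (kh)) over k. *)
Let euler N h : 0 < h -> forall x,
  `|v (N%:R * h) x - Q (N%:R * h) (v 0) x| <= N%:R * (C * h ^+ 2 + h * remainder h).
Proof.
move=> h0; elim: N => [|N IH] x.
  by rewrite !mul0r (semigroup0 QP) subrr normr0.
have Nh : 0 <= N%:R * h by rewrite mulr_ge0// ltW.
have E : N.+1%:R * h = N%:R * h + h by rewrite -natr1 mulrDl mul1r.
have -> : Q (N.+1%:R * h) (v 0) x = Q h (Q (N%:R * h) (v 0)) x.
  by rewrite E addrC (semigroupD QP)// ltW.
rewrite E.
have h1 := vL x Nh (ltW h0).
have h2 := step_error h0 (fun y => v1 y Nh) x.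
(* The error made so far is not amplified, because [Q h] is a contraction. *)
have h3 : `|Q h (v (N%:R * h)) x - Q h (Q (N%:R * h) (v 0)) x|
    <= N%:R * (C * h ^+ 2 + h * remainder h).
  by rewrite -semigroupB ?(ltW h0)//; apply: semigroup_contraction => //; exact: ltW.
rewrite -natr1 mulrDl mul1r.
move: h1 h2 h3; rewrite !ler_norml => /andP[a1 a2] /andP[b1 b2] /andP[c1 c2].
by apply/andP; split; lra.
Qed.

(** With h = T / N the accumulated error is T (C h + [remainder h]), which vanishes as N grows. *)
Lemma semigroup_unique T x : 0 <= T -> v T x = Q T (v 0) x.
Proof.
rewrite le_eqVlt => /orP[/eqP <-|T0]; first by rewrite (semigroup0 QP).
apply/eqP; rewrite -subr_eq0 -normr_le0; apply/ler_addgt0Pr => e e0; rewrite add0r.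
have d0 : 0 < e / (2 * T) by rewrite divr_gt0// mulr_gt0.
have [eta /= eta0 etaP] : \forall h \near (0 : R)^'+,
    remainder h < e / (2 * T) /\ C * h < e / (2 * T).
  near=> h; split.
    have : `|0 - remainder h| < e / (2 * T).
      by near: h; move/cvgrPdist_lt : remainder_cvg; exact.
    by rewrite sub0r normrN ger0_norm// sumr_ge0// => y _; rewrite sumr_ge0.
  (* C may be 0, so the bound on h is obtained by dividing by C + 1. *)
  apply: (@le_lt_trans _ _ ((C + 1) * h)).
    by rewrite ler_wpM2r// lerDl.
  rewrite mulrC -ltr_pdivlMr ?ltr_wpDl//.
  by near: h; apply: nbhs_right_lt; rewrite divr_gt0// ltr_wpDl.
(* The successor makes N positive and larger than T / [eta], so that the step T / N lies below
   [eta]. *)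
pose N := (Num.trunc (T / eta)).+1.
have N0 : 0 < N%:R :> R by rewrite ltr0n.
have NT : T / eta < N%:R by rewrite /N; apply: truncnS_gt.
have h0 : 0 < T / N%:R by exact: divr_gt0.
have heta : T / N%:R < eta by rewrite ltr_pdivrMr// mulrC -ltr_pdivrMr.
have [|rem Ch] := etaP (T / N%:R) _ h0.
  by rewrite /= sub0r normrN gtr0_norm.
have TE : N%:R * (T / N%:R) = T by rewrite mulrC divfK// gt_eqF.
have := euler N h0 x; rewrite TE => /le_trans; apply.
have key (n h r : R) : n * (C * h ^+ 2 + h * r) = n * h * (C * h + r) by ring.
rewrite key TE.
rewrite -ler_pdivlMl//.
have -> : T^-1 * e = e / (2 * T) + e / (2 * T) by field; rewrite gt_eqF.
by rewrite lerD// ltW.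
Unshelve. all: by end_near. Qed.

End semigroup.

(** * The martingale problem *)

Section Rintegral_sum.
Context {d : measure_display} {W : measurableType d} {R : realType}.
Variable mu : measure W R.

Lemma Rintegral_sum (D : set W) (I : Type) (s : seq I) (a : I -> R) (f : I -> W -> R) :
  measurable D -> (forall i, mu.-integrable D (EFin \o f i)) ->
  mu.-integrable D (EFin \o (fun w => \sum_(i <- s) a i * f i w)) /\
  \int[mu]_(w in D) (\sum_(i <- s) a i * f i w)
    = \sum_(i <- s) a i * \int[mu]_(w in D) f i w.
Proof.
move=> mD fi; elim: s => [|i s [IHi IH]].
  have E : (fun w => \sum_(i <- [::]) a i * f i w) = fun=> 0.
    by apply/funext => w; rewrite big_nil.
  rewrite E big_nil Rintegral_cst// mul0r; split=> //.
  exact: integrable0.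
have E : (fun w => \sum_(j <- i :: s) a j * f j w) =
    fun w => a i * f i w + \sum_(j <- s) a j * f j w.
  by apply/funext => w; rewrite big_cons.
have ai : mu.-integrable D (EFin \o (fun w => a i * f i w)).
  rewrite (_ : _ \o _ = fun w => ((a i)%:E * (EFin \o f i) w)%E).
    exact: integrableZl.
  by apply/funext => w /=; rewrite EFinM.
rewrite E; split.
  pose f1 w : R := a i * f i w; pose f2 w : R := \sum_(j <- s) a j * f j w.
  rewrite (_ : _ \o _ = ((EFin \o f1) \+ (EFin \o f2))%E).
    exact: integrableD.
  by apply/funext => w /=; rewrite EFinD.
by rewrite RintegralD// RintegralZl// IH big_cons.
Qed.

End Rintegral_sum.

Lemma probability_bounded_integrable (d : measure_display) (W : measurableType d)
    (R : realType) (P : probability W R) (f : W -> R) M :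
  measurable_fun setT f -> (forall w, `|f w| <= M) -> P.-integrable setT (EFin \o f).
Proof.
move=> mf fM; apply: (le_integrable measurableT _ _
  (finite_measure_integrable_cst P M measurableT)).
  exact/measurable_EFinP.
by move=> w _ /=; rewrite lee_fin (le_trans (fM w))// ler_norm.
Qed.

(** * The generator acting on the duality function *)

Section generator_duality.
Context {R : realType} {m : nat}.

Lemma Phi_ge0 (t : cladograms m) (x : T2cont R) : 0 <= Phi t x.
Proof. by rewrite -lee_fin PhiE. Qed.

Lemma Phi_le1 (t : cladograms m) (x : T2cont R) : Phi t x <= 1.
Proof.
rewrite -lee_fin PhiE; apply: probability_le1.
exact: tree_shape_measurable (rep_T2cont x) t.
Qed.

Lemma extend0E (s : seq (cladograms m)) (phi : cladograms m -> R)
    (o : option (lcladograms m)) : uniq s -> (forall t, t \in s) ->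
  extend0 phi o = \sum_(t <- s) phi t * (o == Some (val t))%:R.
Proof.
move=> us sP; case: o => [l|] /=; last by rewrite big1// => t _; rewrite mulr0.
case: insubP => [t0 _ <-|nl].
  rewrite (bigD1_seq t0)//= eqxx mulr1 big1 ?addr0// => t /negP tt.
  rewrite (_ : (_ == _) = false) ?mulr0//; apply/negbTE/eqP => -[/val_inj E].
  by apply: tt; rewrite E.
rewrite big1// => t _; rewrite (_ : (_ == _) = false) ?mulr0//.
by apply/negbTE/eqP => -[E]; move: nl; rewrite E => /negP; apply; exact: (valP t).
Qed.

(* The symmetry of the generator turns Omega_Ald, which acts on the cladogram of
   a sample, into the generator of the Aldous chain acting on [t]. *)
Lemma OmegaPhiE (s : seq (cladograms m)) (t : cladograms m) (x : T2cont R) :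
  uniq s -> (forall t, t \in s) ->
  OmegaPhi t x = \sum_(t' <- s) aldous_generator \1_[set t'] t * Phi t' x.
Proof.
move=> us sP; rewrite /OmegaPhi.
pose A (t' : cladograms m) :=
  [set u : m.-tuple (borel (rep x)) | tree_shape u = Some (val t')].
have mA t' : measurable (A t') := tree_shape_measurable (rep_T2cont x) t'.
have E : (fun u : m.-tuple (borel (rep x)) =>
    extend0 (aldous_generator \1_[set t]) (tree_shape u) : R) =
    fun u => \sum_(t' <- s) aldous_generator \1_[set t'] t * \1_(A t') u.
  apply/funext => u; rewrite (extend0E _ _ us sP); apply: eq_bigr => t' _.
  rewrite aldous_generator_sym indicE; congr (_ * _%:R).
  by congr nat_of_bool; apply/eqP/idP; rewrite inE.
rewrite E; have [_ ->] := Rintegral_sum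
  (mu := power_measure (amt_mu (rep x)) m) s
  (fun t' => aldous_generator (\1_[set t'] : _ -> R) t) measurableT
  (fun t' => integrable_indic (power_measure (amt_mu (rep x)) m) (mA t')).
apply: eq_bigr => t' _; congr (_ * _).
by rewrite /Rintegral integral_indic// setIT.
Qed.

End generator_duality.

Section euler_integral.
Context {R : realType} (v : R -> R).
Hypotheses (v_meas : measurable_fun setT v) (v_bound : forall s, `|v s| <= 1).
Notation leb := (@lebesgue_measure R).

Lemma bounded_itv_integrable (f : R -> R) M (b1 b2 : bool) (x y : R) :
  measurable_fun setT f -> (forall s, `|f s| <= M) ->
  leb.-integrable [set` Interval (BSide b1 x) (BSide b2 y)] (EFin \o f).
Proof.
move=> mf fM; apply: measurable_bounded_integrable.
- exact: measurable_itv.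
- have E := lebesgue_measure_itv (Interval (BSide b1 x) (BSide b2 y)).
  by rewrite [X in (X < _)%E]E; case: ifP => _ /=; rewrite ltry.
- exact: measurable_funTS.
exists M; split; first exact: num_real.
by move=> N MN s _; apply: (le_trans (fM s)); exact: ltW.
Qed.

(** Supplies the assumption of [volterra_euler] on [J], for the Lebesgue integral. *)
Lemma euler_integral (r h a e : R) : 0 <= r -> 0 <= h -> 0 <= e ->
  (forall s, r <= s <= r + h -> `|v s - a| <= e) ->
  `|\int[leb]_(s in `[0, r + h]) v s - \int[leb]_(s in `[0, r]) v s - h * a| <= e * h.
Proof.
move=> r0 h0 e0 va; have rh : r <= r + h by rewrite lerDl.
have iv b1 b2 x y : leb.-integrable [set` Interval (BSide b1 x) (BSide b2 y)] (EFin \o v).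
  exact: (bounded_itv_integrable _ _ _ _ v_meas v_bound).
rewrite (Rintegral_itvB (iv _ _ _ _)) ?bnd_simp//.
have mlen : fine (leb `]r, r + h]) = h.
  have E := lebesgue_measure_itv `]r, r + h]; rewrite [X in fine X]E /= lte_fin.
  case: ifPn => [_|].
    by rewrite -EFinB /= addrAC subrr add0r.
  by rewrite -leNgt gerDl => hle0; apply/eqP; rewrite eq_sym eq_le hle0 h0.
have ica c : leb.-integrable `]r, r + h] (EFin \o cst c).
  by apply: (bounded_itv_integrable (M := `|c|)); first exact: measurable_cst.
have -> : h * a = \int[leb]_(s in `]r, r + h]) a.
  by rewrite Rintegral_cst// mlen mulrC.
rewrite -RintegralB//; last exact: ica.
have ivB : leb.-integrable `]r, r + h] (EFin \o (fun s => v s - a)).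
  apply: (bounded_itv_integrable (M := 1 + `|a|)).
    by apply: measurable_funB => //; exact: measurable_cst.
  by move=> s; rewrite (le_trans (ler_normB _ _))// lerD.
apply: (le_trans (le_normr_Rintegral _ ivB)) => //.
have -> : e * h = \int[leb]_(s in `]r, r + h]) e by rewrite Rintegral_cst// mlen.
apply: le_Rintegral => //; last first.
- by move=> s; rewrite /= in_itv/= => /andP[rs sr]; apply: va; rewrite (ltW rs).
- exact: ica.
apply: (bounded_itv_integrable (f := fun s => `|v s - a|) (M := 1 + `|a|)).
  apply: measurableT_comp => //.
  by apply: measurable_funB => //; exact: measurable_cst.
by move=> s; rewrite normr_id (le_trans (ler_normB _ _))// lerD.
Qed.

End euler_integral.

Lemma sigma_algebra_setT (T : Type) (G : set (set T)) : <<s G >> setT.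
Proof.
have [h0 hC _] := smallest_sigma_algebra [set: T] G.
by have := hC _ h0; rewrite setD0.
Qed.

Section martingale.
Context {R : realType} {d : measure_display} {Omega : measurableType d}.
Variables (P : probability Omega R) (X : R -> Omega -> T2cont R).
Context {m : nat} (enum : seq (cladograms m)).
Hypotheses (enum_uniq : uniq enum) (enum_all : forall t, t \in enum).
Hypothesis X_meas : measurable_fun ([set t : R | 0 <= t] `*` [set: Omega])
  (fun p : R * Omega => X p.1 p.2 : borel (T2cont R)).
Notation leb := (@lebesgue_measure R).

(** Joint measurability of X is given for nonnegative times only; the value 0 at negative times
    yields a measurable function on the whole product. *)
Let path_phi (t : cladograms m) (p : R * Omega) : R :=
  if 0 <= p.1 then Phi t (X p.1 p.2) else 0.

Let path_phi_meas t : measurable_fun setT (path_phi t).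
Proof.
have mD : measurable ([set t : R | 0 <= t] `*` [set: Omega]).
  apply: measurableX => //; rewrite (_ : [set _ | _] = `[0, +oo[%classic) //.
  by apply/seteqP; split=> z /=; rewrite in_itv/= andbT.
have mf : measurable_fun ([set t : R | 0 <= t] `*` [set: Omega])
    (fun p : R * Omega => Phi t (X p.1 p.2)).
  exact: (measurable_comp measurableT (@subsetT _ _) (@Phi_measurable R m t) X_meas).
rewrite (_ : path_phi t = (fun p : R * Omega => Phi t (X p.1 p.2))
    \_ ([set t : R | 0 <= t] `*` [set: Omega])).
  exact/(measurable_restrictT _ mD).
apply/funext => p; rewrite /path_phi /patch; case: ifPn => p0.
  by rewrite mem_set.
by rewrite memNset//= => -[h]; rewrite h in p0.
Qed.

Let path_phi_ge0 t p : 0 <= path_phi t p.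
Proof. by rewrite /path_phi; case: ifP => // _; exact: Phi_ge0. Qed.

Let path_phi_le1 t p : path_phi t p <= 1.
Proof. by rewrite /path_phi; case: ifP => // _; exact: Phi_le1. Qed.

Let path_phi_bound t p : `|path_phi t p| <= 1.
Proof. by rewrite ger0_norm. Qed.

Let section_l t r : measurable_fun setT (fun w => path_phi t (r, w)).
Proof. by apply: (measurableT_comp (path_phi_meas t)); exact: measurable_pair1. Qed.

Let section_r t w : measurable_fun setT (fun r => path_phi t (r, w)).
Proof. by apply: (measurableT_comp (path_phi_meas t)); exact: measurable_pair2. Qed.

Definition mean (r : R) (t : cladograms m) : R := \int[P]_w path_phi t (r, w).

Let section_int t r : P.-integrable setT (EFin \o (fun w => path_phi t (r, w))).
Proof. exact: (probability_bounded_integrable P (section_l t r) (fun w => path_phi_bound t _)). Qed.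

Lemma meanE r t : 0 <= r -> mean r t = \int[P]_w Phi t (X r w).
Proof.
by move=> r0; apply: eq_Rintegral => w _; rewrite /path_phi /= r0.
Qed.

Lemma mean_EFin r t : 0 <= r -> (mean r t)%:E = (\int[P]_w (Phi t (X r w))%:E)%E.
Proof.
move=> r0; rewrite fineK; last exact: integrable_fin_num (section_int t r).
by apply: eq_integral => w _; rewrite /path_phi /= r0.
Qed.

Lemma mean_bound r t : `|mean r t| <= 1.
Proof.
rewrite ger0_norm; last exact: Rintegral_ge0.
have -> : (1 : R) = \int[P]_w 1.
  rewrite Rintegral_cst// [X in fine X](_ : _ = 1%E) ?mulr1//.
  exact: probability_setT.
apply: le_Rintegral => //.
exact: (finite_measure_integrable_cst P 1 measurableT).
Qed.

Let meanEFin r t : (mean r t)%:E = (\int[P]_w (path_phi t (r, w))%:E)%E.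
Proof. by rewrite fineK//; exact: integrable_fin_num (section_int t r). Qed.

Let mean_meas t : measurable_fun setT (mean^~ t).
Proof.
have mphi : measurable_fun setT (EFin \o path_phi t) by exact/measurable_EFinP.
have phi0 p : (0 <= (EFin \o path_phi t) p)%E by rewrite /= lee_fin.
have mF := measurable_fun_fubini_tonelli_F (m2 := P) (EFin \o path_phi t) mphi phi0.
exact: (measurableT_comp (@fine_measurable R _ measurableT) mF).
Qed.

Let time_integral (t : cladograms m) (T : R) (w : Omega) : R :=
  \int[leb]_(r in `[0, T]) path_phi t (r, w).

Let time_integralEFin t T w :
  (time_integral t T w)%:E = (\int[leb]_(r in `[0%R, T]) (path_phi t (r, w))%:E)%E.
Proof.
rewrite fineK//; apply: integrable_fin_num => //.
exact: (bounded_itv_integrable _ _ _ _ (section_r t w) (fun r => path_phi_bound t _)).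
Qed.

Let mean_itv_integrable t T : leb.-integrable `[0, T] (EFin \o mean^~ t).
Proof. exact: (bounded_itv_integrable _ _ _ _ (mean_meas t) (fun r => mean_bound r t)). Qed.

Lemma tonelli_time t T :
  P.-integrable setT (EFin \o time_integral t T) /\
  \int[P]_w time_integral t T w = \int[leb]_(r in `[0, T]) mean r t.
Proof.
(* Cutting off to times in [0, T] allows Tonelli on the full product of time and probability
   space. *)
pose F (p : R * Omega) : \bar R :=
  ((EFin \o path_phi t) \_ (`[0, T] `*` [set: Omega])) p.
have mI : measurable (`[0, T]%classic `*` [set: Omega]).
  by apply: measurableX => //; exact: measurable_itv.
have mF : measurable_fun setT F.
  apply/(measurable_restrictT _ mI); apply: measurable_funTS.
  exact/measurable_EFinP.
have F0 p : (0 <= F p)%E.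
  by rewrite /F /patch; case: ifP => // _; rewrite lee_fin.
have FI r w : F (r, w) = ((fun r => (path_phi t (r, w))%:E) \_ `[0, T]) r.
  rewrite /F /patch; case: (boolP (r \in `[0, T]%classic)) => rI.
    by rewrite mem_set//; split => //; rewrite inE in rI.
  by rewrite memNset// => -[/mem_set h _]; rewrite h in rI.
have E1 w : (\int[leb]_r F (r, w) = (time_integral t T w)%:E)%E.
  by rewrite time_integralEFin [RHS]integral_mkcond; apply: eq_integral => r _.
have E2 : (\int[leb]_r \int[P]_w F (r, w))%E =
    (\int[leb]_(r in `[0%R, T]) (mean r t)%:E)%E.
  rewrite [RHS]integral_mkcond; apply: eq_integral => r _; rewrite /patch.
  case: ifPn => rI.
    rewrite meanEFin; apply: eq_integral => w _; rewrite FI /patch ifT//.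
  by apply: integral0_eq => w _; rewrite FI /patch ifF//; exact/negbTE.
have E := fubini_tonelli (m1 := leb) (m2 := P) F mF F0.
have E3 : (\int[P]_w (time_integral t T w)%:E)%E =
    (\int[leb]_(r in `[0%R, T]) (mean r t)%:E)%E.
  by rewrite -E2 E; apply: eq_integral => w _; rewrite E1.
have J0 w : 0 <= time_integral t T w by apply: Rintegral_ge0.
split; last by rewrite /Rintegral E3.
apply/integrableP; split.
  rewrite (_ : _ \o _ = fun w => (\int[leb]_r F (r, w))%E).
    exact: (measurable_fun_fubini_tonelli_G (m1 := leb) F mF F0).
  by apply/funext => w; rewrite E1.
under eq_integral do rewrite /= ger0_norm//.
rewrite E3 -ge0_fin_numE; first by
  apply: integrable_fin_num => //; exact: mean_itv_integrable.
by apply: integral_ge0 => r _; rewrite lee_fin; exact: Rintegral_ge0.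
Qed.

Let drift (t t' : cladograms m) : R := aldous_generator \1_[set t'] t.

(** The expectation of a martingale is constant in time; Tonelli moves it inside the time integral,
    and [OmegaPhiE] expresses the drift through the means themselves. *)
Lemma mean_equation (P0 : probability (borel (T2cont R)) R) t T :
  martingale_problem_solution P P0 X -> 0 <= T ->
  mean T t = mean 0 t + \sum_(t' <- enum) drift t t' * \int[leb]_(r in `[0, T]) mean r t'.
Proof.
move=> [_ _ mart] T0.
pose F := fun x : T2cont R => \sum_(p <- [:: (1, Tagged (cladograms) t)])
  p.1 * Phi (tagged p.2) x.
pose G := fun x : T2cont R => \sum_(p <- [:: (1, Tagged (cladograms) t)])
  p.1 * OmegaPhi (tagged p.2) x.
have FE x : F x = Phi t x by rewrite /F big_seq1 mul1r.
have GE x : G x = \sum_(t' <- enum) drift t t' * Phi t' x.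
  by rewrite /G big_seq1 mul1r; exact: OmegaPhiE.
have FG : OmegaAld F G by exists [:: (1, Tagged (cladograms) t)].
pose M r w := F (X r w) - \int[leb]_(s in `[0, r]) G (X s w).
have ME r w : 0 <= r -> M r w =
    path_phi t (r, w) - \sum_(t' <- enum) drift t t' * time_integral t' r w.
  move=> r0; rewrite /M FE {1}/path_phi /= r0; congr (_ - _).
  have [_ <-] := Rintegral_sum (mu := leb) enum (drift t) (measurable_itv `[0, r])
    (fun t' => bounded_itv_integrable true false 0 r (section_r t' w)
      (fun s => path_phi_bound t' _)).
  apply: eq_Rintegral => s; rewrite inE /= in_itv /= => /andP[s0 _].
  by rewrite GE; apply: eq_bigr => t' _; rewrite /path_phi /= s0.
have EM r : 0 <= r -> \int[P]_w M r w =
    mean r t - \sum_(t' <- enum) drift t t' * \int[leb]_(s in `[0, r]) mean s t'.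
  move=> r0; have [iS ES] := Rintegral_sum (mu := P) enum (drift t) measurableT
    (fun t' => (tonelli_time t' r).1).
  transitivity (\int[P]_w (path_phi t (r, w)
      - \sum_(t' <- enum) drift t t' * time_integral t' r w)).
    by apply: eq_Rintegral => w _; exact: ME.
  rewrite RintegralB// ES; congr (_ - _).
  by apply: eq_bigr => t' _; rewrite (tonelli_time t' r).2.
(* The martingale property is used between times 0 and T on the whole space. *)
have [_ _ MT] := mart F G FG T T0.
have EMT : \int[P]_w M T w = \int[P]_w M 0 w.
  have T00 : 0 <= (0 : R) <= T by rewrite lexx.
  have FT : augmented P
    (sigma_process (@measurable _ (borel (T2cont R))) `[0, 0] X) setT.
    exact: sigma_algebra_setT.
  have E := MT 0 setT T00 FT.
  by rewrite /Rintegral E.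
move: EMT; rewrite !EM// => EMT.
have int0 t' : \int[leb]_(s in `[0, 0]) mean s t' = 0.
  by rewrite set_itv1 Rintegral_set1.
have sum0 : \sum_(t' <- enum) drift t t' * \int[leb]_(s in `[0, 0]) mean s t' = 0.
  by rewrite big1// => t' _; rewrite int0 mulr0.
by move: EMT; rewrite sum0 subr0 => <-; rewrite subrK.
Qed.

Lemma mean_euler (P0 : probability (borel (T2cont R)) R) :
  martingale_problem_solution P P0 X ->
  forall r h t, 0 <= r -> 0 <= h ->
  `|mean (r + h) t - mean r t - h * aldous_generator (mean r) t| <=
    generator_bound enum (@aldous_generator R m) ^+ 2 * h ^+ 2.
Proof.
move=> mart r h t r0 h0.
pose J (r : R) (t' : cladograms m) : R := \int[leb]_(s in `[0, r]) mean s t'.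
have LE phi (t1 : cladograms m) := aldous_generator_sum (R := R) phi t1 enum_uniq enum_all.
apply: (@volterra_euler R _ enum enum_uniq enum_all (@aldous_generator R m) LE mean J) => //.
- by move=> T t' T0; exact: mean_equation mart T0.
- move=> r' h' a e t' r'0 h'0 e0.
  exact: (euler_integral (mean_meas t') (fun s => mean_bound s t')).
- exact: mean_bound.
Qed.

(** [X 0] is measurable as a section of the jointly measurable process, so its law P0 enters by
    change of variables. *)
Lemma mean_initial (P0 : probability (borel (T2cont R)) R) t :
  martingale_problem_solution P P0 X -> mean 0 t = \int[P0]_x Phi t x.
Proof.
move=> [_ init _]; rewrite meanE// /Rintegral; congr fine.
have mX0 : measurable_fun setT (X 0 : Omega -> borel (T2cont R)).
  move=> _ B mB; rewrite setTI.
  have mp : measurable_fun [set: Omega] (fun w : Omega => ((0 : R), w)).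
    exact: measurable_pair1.
  have sub : [set ((0 : R), w) | w in [set: Omega]] `<=`
      [set t : R | 0 <= t] `*` [set: Omega].
    by move=> _ [w _ <-]; split => /=.
  have mD : measurable ([set t : R | 0 <= t] `*` [set: Omega]).
    apply: measurableX => //; rewrite (_ : [set _ | _] = `[0, +oo[%classic) //.
    by apply/seteqP; split=> z /=; rewrite in_itv/= andbT.
  have := measurable_comp mD sub X_meas mp.
  by move=> /(_ measurableT B mB); rewrite setTI.
have mPhi : measurable_fun setT (EFin \o (Phi t : borel (T2cont R) -> R)).
  by apply/measurable_EFinP; exact: Phi_measurable.
have Phi0 : {in [set: borel (T2cont R)], forall x, 0 <= (EFin \o Phi t) x}%E.
  by move=> x _; rewrite /= lee_fin Phi_ge0.
have := ge0_integral_pushforward mX0 P measurableT mPhi Phi0.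
rewrite preimage_setT => E; rewrite -[LHS]E.
by apply: eq_measure_integral => B mB _; exact: (init B mB).
Qed.

End martingale.

(** The Markov property is applied from time 0 on the whole space, where the chain is almost surely
    at [t]. *)
Lemma markov_chain_mean (R : realType) (d : measure_display) (Omega : measurableType d)
    (P : probability Omega R) (S : Type)
    (Y : R -> Omega -> S) (Q : R -> (S -> R) -> S -> R) (t : S) :
  (forall t B, 0 <= t -> measurable (Y t @^-1` B)) ->
  (forall s t (f : S -> R) A, 0 <= s -> 0 <= t ->
    sigma_process setT `[0, s] Y A ->
    (\int[P]_(w in A) (f (Y (s + t)%R w))%:E
      = \int[P]_(w in A) (Q t f (Y s w))%:E)%E) ->
  {ae P, forall w, Y 0 w = t} ->
  forall s (f : S -> R), 0 <= s -> (\int[P]_w (f (Y s w))%:E)%E = (Q s f t)%:E.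
Proof.
move=> mY QY Y0 s f s0.
have FT : sigma_process setT `[0, 0] Y setT by exact: sigma_algebra_setT.
have := QY 0 s f setT (lexx 0) s0 FT; rewrite add0r => ->.
rewrite (ae_eq_integral (cst (Q s f t)%:E)) //.
- rewrite integral_cst// [X in (_ * X)%E](_ : _ = 1%E) ?mule1//.
  exact: probability_setT.
- move=> _ B mB; rewrite setTI.
  exact: (mY 0 ((fun y => (Q s f y)%:E) @^-1` B) (lexx 0)).
- by apply: filterS Y0 => w -> _.
Qed.

Theorem proposition4p1 (R : realType) (d : measure_display)
    (Omega : measurableType d) (P : probability Omega R)
    (P0 : probability (borel (T2cont R)) R)
    (X : R -> Omega -> T2cont R)
    (hX : martingale_problem_solution P P0 X)
    (hXcadlag : forall w, cadlag (fun t => X t w))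
    (m : nat) (t : cladograms m)
    (Y : R -> Omega -> cladograms m)
    (hY : markov_chain P (@aldous_generator R m) Y)
    (hY0 : {ae P, forall w, Y 0 w = t})
    (hXY : independent P
      (sigma_process (@measurable _ (borel (T2cont R))) [set s | 0 <= s] X)
      (sigma_process setT [set s | 0 <= s] Y)) :
  forall s : R, 0 <= s ->
    (\int[P]_w power_measure (amt_mu (rep (X s w))) m
        [set u : m.-tuple (borel (rep (X s w))) | tree_shape u = Some (val t)]
     = \int[P0]_x \int[P]_w power_measure (amt_mu (rep x)) m
        [set u : m.-tuple (borel (rep x)) | tree_shape u = Some (val (Y s w))])%E.
Proof.
move=> s s0; have [enum [enum_uniq enum_all]] := cladograms_finite m.
have [mY [Q QL QY]] := hY; have [mX _ _] := hX.
have LE phi (t1 : cladograms m) := aldous_generator_sum (R := R) phi t1 enum_uniq enum_all.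
have step := mean_euler enum_uniq enum_all mX hX.
have meanQ := semigroup_unique enum_uniq enum_all QL LE
  (fun r t1 _ => mean_bound P mX r t1) (sqr_ge0 _)
  (fun r h t1 r0 h0 => step r h t1 r0 h0) t s0.
transitivity (mean P X s t)%:E.
  under eq_integral do rewrite -PhiE.
  by rewrite (mean_EFin P mX).
(* For fixed x the expectation over Y is the semigroup applied to [Phi^~ x] and evaluated at the
   initial state t. *)
transitivity (\int[P0]_x (Q s (fun t' => Phi t' x) t)%:E)%E; last first.
  apply: eq_integral => x _.
  rewrite -(markov_chain_mean mY QY hY0 (fun t' => Phi t' x) s0).
  by apply: eq_integral => w _; rewrite PhiE.
rewrite meanQ (semigroup_sum enum_uniq enum_all QL _ _ s0).
(* Row t of the transition matrix at time s. Both sides are the same combination, with these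
   weights, of the integrals of [Phi t'] against P0. *)
pose c t' := Q s \1_[set t'] t.
have PhiI (t' : cladograms m) : P0.-integrable setT (EFin \o Phi t').
  apply: (probability_bounded_integrable (M := 1) P0 (Phi_measurable t')) => x.
  by rewrite ger0_norm; [exact: Phi_le1 | exact: Phi_ge0].
have [I E] := Rintegral_sum (mu := P0) enum c measurableT PhiI.
transitivity (\int[P0]_x (\sum_(t' <- enum) c t' * Phi t' x)%:E)%E; last first.
  apply: eq_integral => x _; congr EFin.
  rewrite (semigroup_sum enum_uniq enum_all QL _ _ s0).
  by apply: eq_bigr => t' _; rewrite mulrC.
rewrite -[RHS](fineK (integrable_fin_num measurableT I)); congr EFin.
rewrite [RHS]E; apply: eq_bigr => t' _.
by rewrite mulrC (mean_initial mX t' hX).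
Qed.
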